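(* Let $G$ be a metric on $\mathrm{Imm}(S^1,\mathbb R^2)$ which is stronger than the $H^l$ metric $G^{H^l}$. Then the metric completion of the space $(\mathrm{Imm}(S^1,\mathbb R^2),G)$ is contained in the set $\mathrm{Imm}^l(S^1,\mathbb R^2)$ of all $H^l$ immersions.
   Context: $\mathrm{Imm}(S^1,\mathbb R^2)$ is the Fréchet manifold of smooth immersions $c:S^1\to\mathbb R^2$, with $T_c\mathrm{Imm}(S^1,\mathbb R^2)=C^\infty(S^1,\mathbb R^2)$. For a curve $c$, with $\theta$ the coordinate on $S^1$, write $D_s=\frac{1}{|\partial_\theta c|}\partial_\theta$ and $ds=|\partial_\theta c|\,d\theta$. $\mathrm{Diff}(S^1)$ acts on curves by $(c,\varphi)\mapsto c\circ\varphi$. A metric means a $\mathrm{Diff}(S^1)$-invariant Riemannian metric on $\mathrm{Imm}(S^1,\mathbb R^2)$ of the form $G_c(h,k)=\int_{S^1}\langle L_ch,k\rangle\,ds$, where $L$ is a smooth bundle automorphism of $T\mathrm{Imm}(S^1,\mathbb R^2)$, each $L_c$ is a pseudo-differential operator of order $2p$ for some $p$, symmetric and positive with respect to the $L^2$-metric $\int_{S^1}\langle h,k\rangle\,ds$, and $L_{c\circ\varphi}(h\circ\varphi)=L_c(h)\circ\varphi$ for all $\varphi\in\mathrm{Diff}(S^1)$. For an integer $l\ge0$, the Sobolev $H^l$ metric is $G^{H^l}_c(h,h)=\int_{S^1}\sum_{i=0}^l|D_s^ih|^2\,ds$. That $G$ is stronger than (dominates) $G^{H^l}$ means $G^{H^l}_c(h,h)\le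 G_c(h,h)$ for all $c\in\mathrm{Imm}(S^1,\mathbb R^2)$ and all $h\in T_c\mathrm{Imm}(S^1,\mathbb R^2)$. The metric completion is taken with respect to the geodesic distance of $G$, that is, the infimum of the $G$-lengths of paths in $\mathrm{Imm}(S^1,\mathbb R^2)$ connecting two given curves. The set of $H^l$ immersions is $\mathrm{Imm}^l(S^1,\mathbb R^2)=\{c\in H^l(S^1,\mathbb R^2): |c'|\neq0\}$, where $H^l(S^1,\mathbb R^2)$ is the Sobolev space of order $l$ and $c'=\partial_\theta c$.
   Formalization: Stated for l ≥ 2 (for l = 0, c' is undefined; for l = 1 the claim fails for the H^1 metric itself). ''Contained in'' means the identity extends to a continuous map from the completion into Imm^l; injectivity, false in general, is not claimed. *)

(* Defs.v *)
(* The circle is R / 2 pi Z: functions on it are 2 pi-periodic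
   functions of theta in R, and vectors of R^2 are row vectors (whose library
   norm is the sup norm; the Euclidean structure is [dot] and [enorm]). *)
From HB Require Import structures.
From mathcomp Require Import all_boot all_order all_algebra.
From mathcomp Require Import all_classical all_reals all_analysis.
Set Implicit Arguments.
Unset Strict Implicit.
Unset Printing Implicit Defensive.
Import Order.TTheory GRing.Theory Num.Theory numFieldNormedType.Exports.

Local Open Scope classical_set_scope.
Local Open Scope ring_scope.

Section Curves.
Variable R : realType.

Local Notation V := 'rV[R]_2.
Local Notation curve := (R -> 'rV[R]_2).

Definition dot (v w : V) : R := \sum_(i < 2) v 0 i * w 0 i.
Definition enorm (v : V) : R := Num.sqrt (dot v v).

Definition periodic (T : Type) (f : R -> T) : Prop :=
  forall theta, f (theta + 2 * pi) = f theta.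

Definition smooth (W : normedModType R) (f : R -> W) : Prop :=
  forall n theta, derivable (derive1n n f) theta 1.

Definition circle_int (f : R -> R) : R :=
  \int[lebesgue_measure]_(theta in `[0, 2 * pi]) f theta.

Definition Csmooth : set curve := [set h | smooth h /\ periodic h].

Definition Imm : set curve :=
  [set c | Csmooth c /\ forall theta, derive1 c theta != 0].

(* A diffeomorphism of S^1, given by its lift to the real line; both
   orientations are allowed. *)
Definition circle_diffeo (f : R -> R) : Prop :=
  [/\ smooth f,
      exists g : R -> R, [/\ smooth g, cancel f g & cancel g f] &
      (forall theta, f (theta + 2 * pi) = f theta + 2 * pi) \/
      (forall theta, f (theta + 2 * pi) = f theta - 2 * pi)].

(* [g'] is the derivative of [g : R -> C^oo(S^1, R^2)] in the Frechet topology: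
   the difference quotients converge in every C^k-seminorm. *)
Definition frechet_derivative (g g' : R -> curve) : Prop :=
  forall (t : R) (k : nat) (e : R), 0 < e ->
    \forall s \near (0 : R)^', forall theta,
      `| derive1n k (s^-1 *: (g (t + s) - g t) - g' t) theta | <= e.

Definition smooth_path (g : R -> curve) : Prop :=
  exists G : nat -> R -> curve,
    [/\ G 0%N = g, forall n t, Csmooth (G n t) &
        forall n, frechet_derivative (G n) (G n.+1)].

(* T Imm = Imm x C^oo(S^1, R^2); smoothness is that of the convenient calculus:
   smooth curves are mapped to smooth curves. *)
Definition smooth_bundle_map (L : curve -> curve -> curve) : Prop :=
  [/\ forall c h, Imm c -> Csmooth h -> Csmooth (L c h),
      forall c h k (a : R), Imm c -> Csmooth h -> Csmooth k ->
        L c (a *: h + k) = a *: L c h + L c k &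
      forall g h : R -> curve, smooth_path g -> (forall t, Imm (g t)) ->
        smooth_path h -> smooth_path (fun t => L (g t) (h t))].

Definition smooth_bundle_automorphism (L : curve -> curve -> curve) : Prop :=
  smooth_bundle_map L /\
  exists M, smooth_bundle_map M /\
    forall c h, Imm c -> Csmooth h -> L c (M c h) = h /\ M c (L c h) = h.

Definition fdiff (W : zmodType) (a : int -> W) (k : int) : W := a (k + 1) - a k.

(* Matrix-valued symbols in S^m on the circle (toroidal symbols): smooth
   periodic in theta, with
   |d_theta^alpha Delta_k^beta a(theta, k)| <= C (1 + |k|)^(m - beta). *)
Definition symbol (m : R) (a : int -> R -> 'M[R]_2) : Prop :=
  (forall k, smooth (a k) /\ periodic (a k)) /\
  forall alpha beta : nat, exists C : R, forall (k : int) (theta : R),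
    `| derive1n alpha (iter beta (@fdiff (R -> 'M[R]_2)) a k) theta | <=
      C * (1 + `|k|%:~R) `^ (m - beta%:R).

(* hat h(k) e^{i k theta} = fourier_re h k theta + i fourier_im h k theta *)
Definition fourier_re (h : curve) (k : int) (theta : R) : V :=
  \row_j ((2 * pi)^-1 * circle_int (fun y => cos (k%:~R * (theta - y)) * h y 0 j)).
Definition fourier_im (h : curve) (k : int) (theta : R) : V :=
  \row_j ((2 * pi)^-1 * circle_int (fun y => sin (k%:~R * (theta - y)) * h y 0 j)).

(* Pseudo-differential operators of order m on the circle, in the toroidal
   quantization P h (theta) = sum_{k in Z} sigma(theta, k) hat h(k) e^{i k theta},
   with complex symbol sigma = a + i b acting on row vectors.  As P maps real
   functions to real functions, only the real part of the series is kept; this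
   loses nothing, since Re (Op sigma) on real functions is Op of the symbol
   (sigma(theta, k) + conj sigma(theta, -k)) / 2, which is again in S^m. *)
Definition pseudo_differential (m : R) (P : curve -> curve) : Prop :=
  exists a b : int -> R -> 'M[R]_2,
    [/\ symbol m a, symbol m b &
    forall h, Csmooth h -> forall theta,
      (fun N : nat => \sum_(j < (2 * N).+1)
          let k := j%:Z - N%:Z in
          (fourier_re h k theta *m a k theta -
           fourier_im h k theta *m b k theta))
        @ \oo --> P h theta].

Definition arc_int (c : curve) (f : R -> R) : R :=
  circle_int (fun theta => f theta * enorm (derive1 c theta)).

Definition Ds (c h : curve) : curve :=
  fun theta => (enorm (derive1 c theta))^-1 *: derive1 h theta.

Definition metric_of (L : curve -> curve -> curve) (c h k : curve) : R :=
  arc_int c (fun theta => dot (L c h theta) (k theta)).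

Definition is_metric (G : curve -> curve -> curve -> R) : Prop :=
  exists L : curve -> curve -> curve,
    [/\ smooth_bundle_automorphism L,
        forall c, Imm c -> exists p : R, pseudo_differential (2 * p) (L c),
        forall c h k, Imm c -> Csmooth h -> Csmooth k ->
          arc_int c (fun theta => dot (L c h theta) (k theta)) =
          arc_int c (fun theta => dot (h theta) (L c k theta)),
        forall c h, Imm c -> Csmooth h -> h <> (fun=> 0) ->
          0 < arc_int c (fun theta => dot (L c h theta) (h theta)) &
        forall c h phi, Imm c -> Csmooth h -> circle_diffeo phi ->
          L (c \o phi) (h \o phi) = L c h \o phi] /\
    [/\ forall c h k, Imm c -> Csmooth h -> Csmooth k ->
          G c h k = metric_of L c h k &
        forall c h k phi, Imm c -> Csmooth h -> Csmooth k ->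
          circle_diffeo phi -> G (c \o phi) (h \o phi) (k \o phi) = G c h k].

Definition sobolev_metric (l : nat) (c h k : curve) : R :=
  arc_int c (fun theta =>
    \sum_(i < l.+1) dot (iter i (Ds c) h theta) (iter i (Ds c) k theta)).

Definition stronger (G G' : curve -> curve -> curve -> R) : Prop :=
  forall c h, Imm c -> Csmooth h -> G' c h h <= G c h h.

Definition velocity (g : R -> curve) (t : R) : curve :=
  fun theta => derive1 (fun s => g s theta) t.

Definition path_length (G : curve -> curve -> curve -> R) (g : R -> curve)
    : \bar R :=
  \int[lebesgue_measure]_(t in `[0, 1])
    (Num.sqrt (G (g t) (velocity g t) (velocity g t)))%:E.

(* Equal to +oo between curves in different components of Imm. *)
Definition geodesic_dist (G : curve -> curve -> curve -> R) (c0 c1 : curve)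
    : \bar R :=
  ereal_inf [set path_length G g | g in
    [set g : R -> curve | [/\ smooth_path g,
       forall t, 0 <= t <= 1 -> Imm (g t), g 0 = c0 & g 1 = c1]]].

Definition L2 (f : curve) : Prop := forall i : 'I_2,
  measurable_fun `[0, 2 * pi] (fun theta => f theta 0 i) /\
  (\int[lebesgue_measure]_(theta in `[0%R, (2 * pi)%R]) ((f theta 0 i) ^+ 2)%:E
     < +oo)%E.

Definition weak_derivative (k : nat) (f g : curve) : Prop :=
  forall phi : R -> R, smooth phi -> periodic phi -> forall i : 'I_2,
    circle_int (fun theta => f theta 0 i * derive1n k phi theta) =
    (-1) ^+ k * circle_int (fun theta => g theta 0 i * phi theta).

Definition sobolev (l : nat) : set curve :=
  [set f | [/\ periodic f, L2 f &
     forall k, (k <= l)%N -> exists g, L2 g /\ weak_derivative k f g]].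

(* the k-th weak derivative, which is unique up to null sets *)
Definition wderive (k : nat) (f : curve) : curve :=
  get [set g | L2 g /\ weak_derivative k f g].

Definition sobolev_norm (l : nat) (f : curve) : R :=
  Num.sqrt (\sum_(k < l.+1)
    circle_int (fun theta => dot (wderive k f theta) (wderive k f theta))).

(* Imm^l(S^1, R^2), for l >= 2: then H^l embeds in C^1, and a class in H^l is
   identified with its unique C^1 representative, for which |c'| <> 0 makes
   sense at every point. *)
Definition Imm_sobolev (l : nat) : set curve :=
  [set c | [/\ sobolev l c, forall theta, derivable c theta 1,
     continuous (derive1 c) & forall theta, derive1 c theta != 0]].

End Curves.

(* The metric completion of (A, d): Cauchy sequences in A modulo d(u_n, v_n) -> 0.
   The distance d may take the value +oo. *)
Section Completion.
Variables (R : realType) (T : Type) (A : set T) (d : T -> T -> \bar R).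
Local Open Scope ereal_scope.

Definition cauchy_seq (u : nat -> T) : Prop :=
  (forall n, A (u n)) /\
  forall e : R, (0 < e)%R -> exists N : nat, forall m n : nat,
    (N <= m)%N -> (N <= n)%N -> d (u m) (u n) < e%:E.

Definition cauchy_class (u : nat -> T) : set (nat -> T) :=
  [set v | cauchy_seq v /\ (fun n => d (u n) (v n)) @ \oo --> 0].

Definition completion : set (set (nat -> T)) :=
  [set x | exists2 u, cauchy_seq u & x = cauchy_class u].

Definition completion_embed (c : T) : set (nat -> T) := cauchy_class (fun=> c).

(* The limit does not depend on the representatives u, v; the infimum over
   them is only a way not to choose any. *)
Definition completion_dist (x y : set (nat -> T)) : \bar R :=
  ereal_inf [set lim ((fun n => d (uv.1 n) (uv.2 n)) @ \oo) |
    uv in [set uv : (nat -> T) * (nat -> T) | x uv.1 /\ y uv.2]].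

End Completion.

(* Main.v *)
(** Let [sigma] be the G-speed of a path [c_t] of immersions with velocity [h].  Domination
    of [G^{H^l}] gives [|D_s^i h|_{L^2(ds)} <= sigma] for [i <= l], hence on the circle
    [|D_s^i h| <= C sigma sqrt(length c)] pointwise for [1 <= i < l].  Thus [ln (1 + length c)]
    and [ln |c'|] vary at most at a rate proportional to [sigma]; expanding
    [d_theta^k h] in the [D_s^i h], whose coefficients involve the derivatives of [c] up to order
    [k] and the top one only linearly, Gronwall's lemma bounds successively the sup norms of the
    [c^(k)] with [k < l] and the L^2 norm of [c^(l)] along paths of length at most one.  On a
    ball of radius one the identity is therefore Lipschitz from the geodesic distance to the
    H^l norm, with [|c'|] bounded below, so a Cauchy sequence converges in H^l, hence in C^1, to
    an immersion.  Apart from domination, only the continuity of the speed of a smooth path is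
    used: it makes the geodesic distance satisfy the triangle inequality. *)
Require Import Defs.
From HB Require Import structures.
From mathcomp Require Import all_boot all_order all_algebra.
From mathcomp Require Import all_classical all_reals all_analysis.
From mathcomp Require Import measurable_realfun ring lra.

Import Order.TTheory GRing.Theory Num.Theory numFieldNormedType.Exports.

Local Open Scope classical_set_scope.
Local Open Scope ring_scope.

(** * Calculus of smooth functions on the line *)

Section SmoothFunctions.
Context {R : realType}.
Implicit Types (f g : R -> R).

(** The norms to be estimated need not be differentiable along a path, for instance where they
    vanish. Gronwall's lemma is therefore run on two-sided Dini bounds, which a seminorm of a smooth
    path satisfies with its value on the velocity. Constants depend only on [l] and on a bound [K]
    for the initial curve, so that one radius serves for all representatives of a point of the
    completion. The top derivative of [c] occurs only beside [D_s h], which is bounded pointwise as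
    soon as [l >= 2].

    A path that competes in the distance consists of immersions only for times in [[0, 1]], whereas
    [L] is smooth along paths of immersions defined for all times; moreover, smooth paths do not
    concatenate smoothly. Reparametrisation by a flat step function cures both, at the price of a
    change of variables in the length.

    The norm [sobolev_norm] rests on weak derivatives picked by choice, while the limits are built
    by completeness of L2. Comparing the two takes the uniqueness of weak derivatives, obtained by
    testing against smooth bumps on arcs. *)

Lemma derive1_eq {W : normedModType R} {f : R -> W} {x : R} {d : W} :
  is_derive x 1 f d -> derive1 f x = d.
Proof. by move=> fd; rewrite derive1E derive_val. Qed.

Lemma derivable_is_derive {W : normedModType R} {f : R -> W} {x : R} :
  derivable f x 1 -> is_derive x 1 f (derive1 f x).
Proof. by move=> df; apply: DeriveDef => //; rewrite derive1E. Qed.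

Lemma is_derive_continuous {f} {x d : R} :
  is_derive x 1 f d -> {for x, continuous f}.
Proof.
by case=> df _; apply/differentiable_continuous; rewrite -derivable1_diffP.
Qed.

Lemma derivable_continuous f :
  (forall x : R, derivable f x 1) -> continuous f.
Proof.
by move=> df x; apply: is_derive_continuous; exact: derivable_is_derive.
Qed.

Lemma is_derive_comp f g (x df dg : R) :
  is_derive x 1 g dg -> is_derive (g x) 1 f df ->
  is_derive x 1 (f \o g) (df * dg).
Proof.
move=> gd fd; apply: DeriveDef.
  by apply/derivable1_diffP; apply: differentiable_comp;
     apply/derivable1_diffP; [case: gd|case: fd].
rewrite -derive1E derive1_comp; [|by case: gd|by case: fd].
by rewrite (derive1_eq gd) (derive1_eq fd).
Qed.

(** Peels off the first derivative rather than the last one, so that the product and chain rules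
    follow by induction over all pairs of functions at once. *)
Fixpoint ntimes_derivable (n : nat) (f : R -> R) : Prop :=
  if n is m.+1 then
    (forall x : R, derivable f x 1) /\ ntimes_derivable m (derive1 f)
  else True.

Lemma ntimes_derivableP f : smooth f <-> forall n, ntimes_derivable n f.
Proof.
split=> [sf n|nf n x].
  have : forall m x, derivable (derive1n m f) x 1 by [].
  elim: n f {sf} => //= n IH f sf; split; first exact: (sf 0%N).
  by apply: IH => m x; rewrite -derive1Sn; exact: (sf m.+1).
have := nf n.+1; elim: n f {nf} => [f []//|n IH f [_ nf]].
by rewrite derive1Sn; exact: IH.
Qed.

Lemma ntimes_derivableW n f : ntimes_derivable n.+1 f -> ntimes_derivable n f.
Proof.
by elim: n f => //= n IH f [df [df' nf]]; split => //; apply: IH.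
Qed.

Lemma ntimes_derivable_cst n (a : R) : ntimes_derivable n (fun=> a).
Proof.
elim: n a => //= n IH a; split=> //.
by rewrite (_ : derive1 _ = fun=> 0)//; apply/funext => x; rewrite derive1_cst.
Qed.

Lemma ntimes_derivableD n f g : ntimes_derivable n f -> ntimes_derivable n g ->
  ntimes_derivable n (fun x => f x + g x).
Proof.
elim: n f g => //= n IH f g [df nf] [dg ng]; split.
  by move=> x; apply: derivableD.
rewrite (_ : derive1 _ = fun x => derive1 f x + derive1 g x); first exact: IH.
apply/funext => x; apply: derive1_eq.
by apply: is_deriveD; exact: derivable_is_derive.
Qed.

Lemma ntimes_derivableM n f g : ntimes_derivable n f -> ntimes_derivable n g ->
  ntimes_derivable n (fun x => f x * g x).
Proof.
elim: n f g => //= n IH f g [df nf] [dg ng]; split.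
  by move=> x; apply: derivableM.
rewrite (_ : derive1 _ = fun x => f x * derive1 g x + g x * derive1 f x); last first.
  apply/funext => x; apply: derive1_eq.
  by apply: is_deriveM; exact: derivable_is_derive.
by apply: ntimes_derivableD; apply: IH => //; exact: ntimes_derivableW.
Qed.

Lemma ntimes_derivable_comp n f g :
  ntimes_derivable n f -> ntimes_derivable n g -> ntimes_derivable n (f \o g).
Proof.
elim: n f g => //= n IH f g [df nf] [dg ng]; split.
  move=> x; have := is_derive_comp f g x _ _ (derivable_is_derive (dg x))
    (derivable_is_derive (df (g x))).
  by case.
rewrite (_ : derive1 _ = fun x => (derive1 f \o g) x * derive1 g x).
  by apply: ntimes_derivableM => //; apply: IH => //; exact: ntimes_derivableW.
apply/funext => x; apply: derive1_eq.
by apply: is_derive_comp; exact: derivable_is_derive.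
Qed.

Lemma smooth_derivable {W : normedModType R} {f : R -> W} :
  smooth f -> forall x : R, derivable f x 1.
Proof. by move=> sf; exact: (sf 0%N). Qed.

Lemma smooth_derive1 {W : normedModType R} {f : R -> W} :
  smooth f -> smooth (derive1 f).
Proof. by move=> sf n x; rewrite -derive1Sn; exact: sf. Qed.

Lemma smooth_derive1n {W : normedModType R} n {f : R -> W} :
  smooth f -> smooth (derive1n n f).
Proof. by move=> sf; elim: n => // n; exact: smooth_derive1. Qed.

Lemma smooth_is_derive {W : normedModType R} {f : R -> W} :
  smooth f -> forall x : R, is_derive x 1 f (derive1 f x).
Proof.
by move=> sf x; exact: derivable_is_derive (smooth_derivable sf x).
Qed.

Lemma smooth_continuous f : smooth f -> continuous f.
Proof. by move=> sf; apply: derivable_continuous; exact: smooth_derivable. Qed.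

Lemma smooth_cst (a : R) : smooth (fun=> a : R).
Proof. by apply/ntimes_derivableP => n; exact: ntimes_derivable_cst. Qed.

Lemma smoothD f g : smooth f -> smooth g -> smooth (fun x => f x + g x).
Proof.
move=> /ntimes_derivableP sf /ntimes_derivableP sg; apply/ntimes_derivableP => n.
exact: ntimes_derivableD.
Qed.

Lemma smoothM f g : smooth f -> smooth g -> smooth (fun x => f x * g x).
Proof.
move=> /ntimes_derivableP sf /ntimes_derivableP sg; apply/ntimes_derivableP => n.
exact: ntimes_derivableM.
Qed.

Lemma smooth_comp f g : smooth f -> smooth g -> smooth (f \o g).
Proof.
move=> /ntimes_derivableP sf /ntimes_derivableP sg; apply/ntimes_derivableP => n.
exact: ntimes_derivable_comp.
Qed.

(* Bootstraps regularity from the equation [f' = P f]. *)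
Lemma smooth_ode f (P : (R -> R) -> R -> R) :
  (forall x : R, is_derive x 1 f (P f x)) ->
  (forall n, ntimes_derivable n f -> ntimes_derivable n (P f)) -> smooth f.
Proof.
move=> fP nP; apply/ntimes_derivableP; elim=> //= n IH; split.
  by move=> x; case: (fP x).
rewrite (_ : derive1 f = P f); first exact: nP.
by apply/funext => x; exact: derive1_eq.
Qed.

Lemma is_deriveV f (x d : R) : f x != 0 -> is_derive x 1 f d ->
  is_derive x 1 (fun y => (f y)^-1) (- ((f x)^-1 * (f x)^-1) * d).
Proof.
move=> fx0 [df dfE]; apply: DeriveDef; first exact: derivableV fx0 df.
by rewrite (deriveV fx0 df) dfE -expr2 exprVn.
Qed.

Lemma smoothV f : (forall x, f x != 0) -> smooth f -> smooth (fun x => (f x)^-1).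
Proof.
(* The reciprocal solves [g' = - g ^ 2 f'], whose right-hand side is as regular as [g]. *)
move=> f0 sf; pose P (g : R -> R) (x : R) : R := (- (g x * g x)) * derive1 f x.
apply: (smooth_ode (fun x : R => (f x)^-1) P).
  by move=> x; exact: is_deriveV (f0 x) (smooth_is_derive sf x).
move=> n ng; apply: ntimes_derivableM; last first.
  by move: n {ng}; apply/ntimes_derivableP; exact: smooth_derive1.
rewrite (_ : (fun _ => _) = fun x => -1 * ((f x)^-1 * (f x)^-1)); last first.
  by apply/funext => x; rewrite mulN1r.
apply: ntimes_derivableM (ntimes_derivable_cst _ _) _.
exact: ntimes_derivableM.
Qed.

Lemma smooth_affine (a b : R) : smooth (fun x => a * x + b).
Proof.
apply: smoothD; last exact: smooth_cst.
apply: smoothM; first exact: smooth_cst.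
apply/ntimes_derivableP; case=> //= n; split=> //.
rewrite (_ : derive1 _ = (fun=> 1 : R)); first exact: ntimes_derivable_cst.
by apply/funext => x; apply: derive1_eq.
Qed.

Lemma smooth_cos : smooth (@cos R).
Proof.
apply/ntimes_derivableP.
suff H n : ntimes_derivable n (@cos R) /\ ntimes_derivable n (@sin R).
  by move=> n; case: (H n).
elim: n => //= n [IHc IHs]; split; split=> //.
- rewrite (_ : derive1 _ = fun x => -1 * sin x).
    exact: ntimes_derivableM (ntimes_derivable_cst _ _) IHs.
  by apply/funext => x; rewrite mulN1r; apply: derive1_eq.
- rewrite (_ : derive1 _ = cos)//.
  by apply/funext => x; apply: derive1_eq.
Qed.

End SmoothFunctions.

(** * A smooth step function, flat at both ends *)

Section SmoothStep.
Context {R : realType}.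
Implicit Types (f g : R -> R).

(** With the quotient cleared, [s = 0] needs no exclusion and the remainders of sums, products and
    compositions can be added up. *)
Lemma is_deriveP {W : normedModType R} {f : R -> W} {x : R} {d : W} :
  is_derive x 1 f d <-> forall e : R, 0 < e -> exists2 r : R, 0 < r &
    forall s, `|s| < r -> `|f (x + s) - f x - s *: d| <= e * `|s|.
Proof.
split=> [[df dE] e e0|H].
  have : h^-1 *: (f (h *: 1 + x) - f x) @[h --> (0:R)^'] --> d.
    by rewrite -dE; exact: df.
  move/cvgrPdist_le => /(_ e e0) [r /= r0 Hr]; exists r => // s sr.
  have [->|s0] := eqVneq s 0; first by rewrite addr0 subrr scale0r subr0 !normr0 mulr0.
  have := Hr s; rewrite /= sub0r normrN => /(_ sr s0).
  rewrite [s *: 1]mulr1 (addrC s) => Hs.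
  rewrite (_ : _ - _ = s *: (s^-1 *: (f (x + s) - f x) - d)); last first.
    by rewrite [RHS]scalerBr scalerA mulfV// scale1r.
  by rewrite normrZ mulrC ler_wpM2r// distrC.
have C : h^-1 *: (f (h *: 1 + x) - f x) @[h --> (0:R)^'] --> d.
  apply/cvgrPdist_le => e e0; have [r r0 Hr] := H e e0.
  exists r => //= s; rewrite /= sub0r normrN => sr s0.
  rewrite [s *: 1]mulr1 (addrC s) distrC.
  rewrite (_ : _ - d = s^-1 *: (f (x + s) - f x - s *: d)); last first.
    by rewrite [RHS]scalerBr scalerA mulVf// scale1r.
  by rewrite normrZ normfV ler_pdivrMl ?normr_gt0// mulrC; exact: Hr.
apply: DeriveDef; first by apply/cvg_ex; exists d; exact: C.
by apply/cvg_lim => //; exact: norm_hausdorff.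
Qed.

(** The classical flat function [exp (-1/x)] with a polynomial in [y = 1/x] in front. The family is
    stable under derivation, the factor [y ^ 2] in the derivative coming from [y' = - y ^ 2], so
    that one derivative proves smoothness. *)
Definition flat_exp (p : {poly R}) (x : R) : R :=
  if 0 < x then p.[x^-1] * expR (- x^-1) else 0.

Lemma monomial_le_expR n (y : R) : 0 <= y -> y ^+ n <= n`!%:R * expR y.
Proof.
move=> y0; case: n => [|n]; first by rewrite expr0 fact0 mul1r (le_trans _ (expR_ge1Dx y))// lerDl.
have := expR_ge1Dxn n y0; have f0 : 0 < (n.+1)`!%:R :> R by rewrite ltr0n fact_gt0.
move=> H; rewrite -ler_pdivrMl// mulrC; apply: le_trans H.
by rewrite lerDr.
Qed.

(** At [y = 1 / s] the right-hand side is [C s ^ 2], hence negligible before [s]: this is the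
    vanishing derivative of [flat_exp] at 0. *)
Lemma poly_expR_bound (p : {poly R}) : exists2 C : R, 0 <= C &
  forall y, 0 < y -> `|p.[y]| * expR (- y) <= C * y ^- 2.
Proof.
(* Monomial by monomial, from [y ^ (i + 2) <= (i + 2)! exp y]. *)
exists (\sum_(i < size p) `|p`_i| * (i.+2)`!%:R).
  by apply: sumr_ge0 => i _; rewrite mulr_ge0.
move=> y y0; rewrite horner_coef.
apply: (@le_trans _ _ ((\sum_(i < size p) `|p`_i * y ^+ i|) * expR (- y))).
  by rewrite ler_wpM2r ?expR_ge0// ler_norm_sum.
rewrite !mulr_suml; apply: ler_sum => i _.
rewrite normrM (ger0_norm (exprn_ge0 _ (ltW y0))) -!mulrA ler_wpM2l//.
rewrite expRN ler_pdivrMr ?expR_gt0// mulrAC ler_pdivlMr ?exprn_gt0// -exprD addn2.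
exact: monomial_le_expR (ltW y0).
Qed.

Lemma is_derive_flat_exp p (x : R) :
  is_derive x 1 (flat_exp p) (flat_exp ('X^2 * (p - p^`())) x).
Proof.
case: (ltgtP x 0) => x0.
- rewrite (_ : flat_exp (_ * _) x = 0); last by rewrite /flat_exp ltNge (ltW x0).
  apply: (near_eq_is_derive (f := cst (0 : R))).
  near=> y; rewrite /flat_exp ifF//; apply/negbTE; rewrite -leNgt.
  by near: y; apply: filterS (lt_nbhsl x0) => y /ltW.
- have d1 : is_derive x 1 (fun y : R => y^-1) (- (x^-1 * x^-1) * 1).
    by apply: is_deriveV; rewrite gt_eqF.
  have d2 := is_derive_comp (horner p) _ x _ _ d1 (is_derive_poly p x^-1).
  have d3 := is_derive_comp expR _ x _ _ (is_deriveN d1) (is_derive_expR (- x^-1)).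
  have d4 := is_deriveM d2 d3.
  have E : \forall y \near x, ((horner p \o (fun y : R => y^-1)) *
     (expR \o - (fun y : R => y^-1))) y = flat_exp p y.
    near=> y; rewrite /flat_exp ifT//.
    by near: y; exact: lt_nbhsr.
  apply: (is_derive_eq (near_eq_is_derive E d4)).
  rewrite /flat_exp x0 /= !hornerE /GRing.scale/=; ring.
rewrite x0 (_ : flat_exp (_ * _) 0 = 0); last by rewrite /flat_exp ltxx.
have [C C0 HC] := poly_expR_bound p.
apply/is_deriveP => e e0; exists (e / (C + 1)).
  by rewrite divr_gt0// ltr_wpDl.
move=> s sr; rewrite add0r scaler0 subr0 /flat_exp ltxx subr0.
case: ifPn => [s0|_]; last by rewrite normr0 mulr_ge0// ltW.
rewrite normrM (ger0_norm (expR_ge0 _)).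
have := HC s^-1; rewrite invr_gt0 => /(_ s0) /le_trans; apply.
rewrite exprVn invrK (gtr0_norm s0) expr2 mulrA ler_wpM2r ?(ltW s0)//.
move: sr; rewrite (gtr0_norm s0) ltr_pdivlMr ?ltr_wpDl// => /ltW.
apply: le_trans; rewrite mulrC ler_wpM2l ?(ltW s0)// lerDl//.
Unshelve. all: by end_near. Qed.

Lemma smooth_flat_exp p : smooth (flat_exp p).
Proof.
apply/ntimes_derivableP => n; elim: n p => //= n IH p; split.
  by move=> x; case: (is_derive_flat_exp p x).
rewrite (_ : derive1 _ = flat_exp ('X^2 * (p - p^`()))); first exact: IH.
by apply/funext => x; exact: derive1_eq (is_derive_flat_exp p x).
Qed.

Let e := flat_exp 1.
Let e' := flat_exp 'X^2.

Let e_gt0 (x : R) : 0 < x -> 0 < e x.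
Proof. by move=> x0; rewrite /e /flat_exp x0 !hornerE expR_gt0. Qed.

Let e_eq0 (x : R) : x <= 0 -> e x = 0.
Proof. by move=> x0; rewrite /e /flat_exp ltNge x0. Qed.

Let is_derive_e (x : R) : is_derive x 1 e (e' x).
Proof.
have := is_derive_flat_exp 1 x; rewrite -/e derivC.
by rewrite (_ : 'X^2 * (1 - 0) = 'X^2)// subr0 mulr1.
Qed.

Let e'_ge0 (x : R) : 0 <= e' x.
Proof.
rewrite /e' /flat_exp; case: ifP => // x0.
by rewrite hornerXn mulr_ge0 ?expR_ge0// exprn_ge0// invr_ge0 ltW.
Qed.

Let e_incr (x y : R) : 0 <= x -> x < y -> e x < e y.
Proof.
rewrite le_eqVlt => /orP[/eqP <-|x0] xy; first by rewrite (e_eq0 0)// e_gt0.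
rewrite /e /flat_exp x0 (lt_trans x0 xy) !hornerE ltr_expR.
by rewrite ltrN2 ltf_pV2// ?posrE// (lt_trans x0 xy).
Qed.

Let e_ge0 (x : R) : 0 <= e x.
Proof. by case: (leP x 0) => [/e_eq0 ->//|/e_gt0/ltW]. Qed.

Let den_gt0 (x : R) : 0 < e x + e (1 - x).
Proof.
case: (leP x 0) => [x0|x0]; last by rewrite ltr_wpDr ?e_ge0 ?e_gt0.
by rewrite ltr_wpDl ?e_ge0// e_gt0// subr_gt0 (le_lt_trans x0).
Qed.

(** The denominator is positive because [x] or [1 - x] is. The function serves twice: to bring paths
    to rest at their ends, and to build test functions close to the indicator of an arc. *)
Definition smooth_step (x : R) : R :=
  flat_exp 1 x / (flat_exp 1 x + flat_exp 1 (1 - x)).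

Local Notation psi := smooth_step.

Lemma smooth_smooth_step : smooth psi.
Proof.
have se : smooth e by exact: smooth_flat_exp.
have se1 : smooth (fun x => e (1 - x)).
  rewrite (_ : (fun _ => _) = e \o (fun x => -1 * x + 1)).
    exact: smooth_comp se (smooth_affine (-1) 1).
  by apply/funext => x /=; rewrite mulN1r addrC.
apply: (smoothM e _ se).
apply: (smoothV _ _ (smoothD e _ se se1)) => x.
by rewrite gt_eqF// den_gt0.
Qed.

Lemma smooth_step0 x : x <= 0 -> psi x = 0.
Proof. by move=> x0; rewrite /psi -/e (e_eq0 _ x0) mul0r. Qed.

Lemma smooth_step1 x : 1 <= x -> psi x = 1.
Proof.
move=> x1; rewrite /psi -/e (e_eq0 (1 - x)) ?subr_le0// addr0 divff// gt_eqF//.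
by rewrite e_gt0// (lt_le_trans _ x1).
Qed.

Lemma smooth_step_ge0 x : 0 <= psi x.
Proof. by rewrite /psi -/e divr_ge0// ltW// den_gt0. Qed.

Lemma smooth_step_le1 x : psi x <= 1.
Proof. by rewrite /psi -/e ler_pdivrMr ?den_gt0// mul1r lerDl. Qed.

(** The change of variables in the length integral asks for strict monotonicity. *)
Lemma smooth_step_incr : {in `[0, 1] &, {homo psi : x y / x < y}}.
Proof.
move=> x y; rewrite !in_itv/= => /andP[x0 x1] /andP[y0 y1] xy.
rewrite /psi -/e ltr_pdivrMr ?den_gt0// mulrAC ltr_pdivlMr ?den_gt0//.
have exy := e_incr x y x0 xy.
have exy' : e (1 - y) < e (1 - x) by apply: e_incr; lra.
have ey0 : 0 < e y by apply: e_gt0; lra.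
have h1 : e x * e (1 - y) <= e y * e (1 - y) by rewrite ler_wpM2r// ltW.
have h2 : e y * e (1 - y) < e y * e (1 - x) by rewrite ltr_pM2l.
by rewrite !mulrDr (mulrC (e x) (e y)) ltrD2l (le_lt_trans h1).
Qed.

Let derive1_smooth_step x : derive1 psi x =
  (e x + e (1 - x)) ^- 2 * (e (1 - x) * e' x + e x * e' (1 - x)).
Proof.
have d1 : is_derive x 1 (fun x : R => 1 - x) (0 - 1) by exact: is_deriveB.
have d2 := is_derive_comp e _ x _ _ d1 (is_derive_e (1 - x)).
have d3 := is_deriveD (is_derive_e x) d2.
have dV := is_deriveV (e + (e \o (fun x : R => 1 - x))) x _
  (lt0r_neq0 (den_gt0 x)) d3.
rewrite (derive1_eq (is_deriveM (is_derive_e x) dV)).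
rewrite sub0r mulrN1 -exprVn expr2 /= /GRing.scale/=.
rewrite (_ : (e + (e \o (fun x : R => 1 - x))) x = e x + e (1 - x))//.
set D := (X in - (X^-1 * X^-1)).
have D0 : D != 0 by rewrite lt0r_neq0// den_gt0.
have -> : D^-1 * e' x = D^-1 * D^-1 * (D * e' x).
  by rewrite !mulrA -(mulrA D^-1 D^-1 D) mulVf// mulr1.
rewrite /D /=; ring.
Qed.

Lemma derive1_smooth_step_ge0 x : 0 <= derive1 psi x.
Proof.
rewrite derive1_smooth_step mulr_ge0//; last by rewrite addr_ge0// mulr_ge0.
by rewrite invr_ge0 exprn_ge0// ltW// den_gt0.
Qed.

Let e'_eq0 (x : R) : x <= 0 -> e' x = 0.
Proof. by move=> x0; rewrite /e' /flat_exp ltNge x0. Qed.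

Lemma derive1_smooth_step0 x : x <= 0 -> derive1 psi x = 0.
Proof.
by move=> x0; rewrite derive1_smooth_step (e'_eq0 _ x0) (e_eq0 _ x0) !(mulr0, mul0r, addr0).
Qed.

Lemma derive1_smooth_step1 x : 1 <= x -> derive1 psi x = 0.
Proof.
move=> x1; have x0 : 1 - x <= 0 by rewrite subr_le0.
by rewrite derive1_smooth_step (e'_eq0 _ x0) (e_eq0 _ x0) !(mulr0, mul0r, addr0).
Qed.

End SmoothStep.

(** * Euclidean geometry of the plane *)

Section PlaneVectors.
Context {R : realType}.
Local Notation V := 'rV[R]_2.
Implicit Types (u v w : V).

Lemma dotE v w : dot v w = v 0 0 * w 0 0 + v 0 1 * w 0 1.
Proof.
rewrite /dot big_ord_recl big_ord1; congr (_ * _ + v 0 _ * w 0 _); exact/val_inj.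
Qed.

Lemma dotC v w : dot v w = dot w v.
Proof. by rewrite !dotE mulrC (mulrC (v 0 1)). Qed.

Lemma dotDl u v w : dot (u + v) w = dot u w + dot v w.
Proof. by rewrite !dotE !mxE; ring. Qed.

Lemma dotZl (a : R) v w : dot (a *: v) w = a * dot v w.
Proof. by rewrite !dotE !mxE; ring. Qed.

Lemma dotZr (a : R) v w : dot v (a *: w) = a * dot v w.
Proof. by rewrite dotC dotZl dotC. Qed.

Lemma dot_ge0 v : 0 <= dot v v.
Proof. by rewrite dotE addr_ge0// -expr2 sqr_ge0. Qed.

Lemma enorm_ge0 v : 0 <= enorm v.
Proof. exact: sqrtr_ge0. Qed.

Lemma sqr_enorm v : enorm v ^+ 2 = dot v v.
Proof. by rewrite sqr_sqrtr// dot_ge0. Qed.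

Lemma enormZ (a : R) v : enorm (a *: v) = `|a| * enorm v.
Proof.
by rewrite /enorm dotZl dotZr mulrA -expr2 sqrtrM ?sqr_ge0// sqrtr_sqr.
Qed.

Lemma enorm0 : enorm (0 : V) = 0.
Proof. by rewrite -(scale0r 0) enormZ normr0 mul0r. Qed.

Lemma dot_le_enorm v w : dot v w <= enorm v * enorm w.
Proof.
rewrite -[leRHS]ger0_norm ?mulr_ge0 ?enorm_ge0//.
apply: le_trans (ler_norm _) _; rewrite -!sqrtr_sqr ler_wsqrtr//.
rewrite exprMn !sqr_enorm -subr_ge0.
(* Lagrange's identity: the defect in Cauchy-Schwarz is the square of the determinant. *)
rewrite (_ : _ - _ = (v 0 0 * w 0 1 - v 0 1 * w 0 0) ^+ 2) ?sqr_ge0//.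
by rewrite !dotE; ring.
Qed.

Lemma enormD v w : enorm (v + w) <= enorm v + enorm w.
Proof.
rewrite -(@ler_pXn2r _ 2)// ?nnegrE ?addr_ge0 ?enorm_ge0//.
rewrite sqrrD !sqr_enorm dotDl (dotC v) (dotC w) !dotDl (dotC w v).
have := dot_le_enorm v w; lra.
Qed.

Lemma coord_le_enorm v i : `|v 0 i| <= enorm v.
Proof.
rewrite -sqrtr_sqr ler_wsqrtr// /dot (bigD1 i)//= -expr2 lerDl.
by apply: sumr_ge0 => j _; rewrite -expr2 sqr_ge0.
Qed.

Lemma enorm_le_coords v : enorm v <= `|v 0 0| + `|v 0 1|.
Proof.
rewrite -(@ler_pXn2r _ 2)// ?nnegrE ?addr_ge0 ?enorm_ge0// sqr_enorm dotE.
rewrite sqrrD !real_normK ?num_real// -!expr2 lerD2r lerDl.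
by rewrite mulrn_wge0// mulr_ge0.
Qed.

Lemma coord_le_norm v i : `|v 0 i| <= `|v|.
Proof.
rewrite {2}/Num.Def.normr/= mx_normrE.
exact: (@le_bigmax _ _ _ 0 (fun j : 'I_1 * 'I_2 => `|v j.1 j.2|) (ord0, i)).
Qed.

Lemma norm_le_coords v (e : R) : 0 <= e -> (forall i, `|v 0 i| <= e) -> `|v| <= e.
Proof.
move=> e0 H; rewrite /Num.Def.normr/= mx_normrE; apply: bigmax_le => //= -[i j] _ /=.
by rewrite ord1.
Qed.

Lemma norm_le_enorm v : `|v| <= enorm v.
Proof. by apply: norm_le_coords => [|i]; [exact: enorm_ge0|exact: coord_le_enorm]. Qed.

(** The seminorms in [frechet_derivative] use the sup norm of row vectors; this transfers them to
    the Euclidean norm. *)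
Lemma enorm_le_norm v : enorm v <= 2 * `|v|.
Proof.
rewrite (le_trans (enorm_le_coords v))//.
have := coord_le_norm v 0; have := coord_le_norm v 1; lra.
Qed.

Lemma enorm_eq0 v : (enorm v == 0) = (v == 0).
Proof.
apply/idP/idP => [/eqP v0|/eqP ->]; last by rewrite enorm0.
by have := norm_le_enorm v; rewrite v0 normr_le0.
Qed.

Lemma enorm_gt0 v : (0 < enorm v) = (v != 0).
Proof. by rewrite lt_def enorm_ge0 andbT enorm_eq0. Qed.

Lemma enormN v : enorm (- v) = enorm v.
Proof. by rewrite -scaleN1r enormZ normrN1 mul1r. Qed.

Lemma ler_enormB v w : `|enorm v - enorm w| <= enorm (v - w).
Proof.
rewrite ler_norml; have := enormD (v - w) w; rewrite subrK => h1.
have := enormD (w - v) v; rewrite subrK -(enormN (w - v)) opprB => h2.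
by apply/andP; split; lra.
Qed.

End PlaneVectors.

(** * Smooth plane curves *)

Section PlaneCurves.
Context {R : realType}.
Local Notation V := 'rV[R]_2.
Implicit Types (f g : R -> V) (a : R -> R).

Lemma is_derive_coord {f} {x : R} {d : V} : is_derive x 1 f d ->
  forall i, is_derive x 1 (fun t => f t 0 i) (d 0 i).
Proof.
move=> [df <-] i; apply: DeriveDef; first by move/derivable_mxP : df.
by rewrite derive_mx// mxE.
Qed.

Lemma is_derive_vec {f} {x : R} {d : V} :
  (forall i, is_derive x 1 (fun t => f t 0 i) (d 0 i)) -> is_derive x 1 f d.
Proof.
move=> H; have df : derivable f x 1.
  by apply/derivable_mxP => i j; rewrite ord1; case: (H j).
apply: DeriveDef => //; rewrite derive_mx//; apply/rowP => j.
by rewrite mxE; case: (H j).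
Qed.

Lemma derive1_coord f (x : R) i :
  derivable f x 1 -> derive1 f x 0 i = derive1 (fun t => f t 0 i) x.
Proof.
by move=> /derivable_is_derive df; rewrite (derive1_eq (is_derive_coord df i)).
Qed.

Lemma derive1n_coord n f i : smooth f ->
  (fun t => derive1n n f t 0 i) = derive1n n (fun t => f t 0 i).
Proof.
move=> sf; elim: n => // n IH; apply/funext => t.
by rewrite !derive1nS -IH derive1_coord//; exact: sf.
Qed.

Lemma smooth_coordP f : smooth f <-> forall i, smooth (fun t => f t 0 i).
Proof.
split=> [sf i n x|sf].
  rewrite -derive1n_coord//; have := sf n x => /derivable_is_derive d.
  by case: (is_derive_coord d i).
pose F n t : V := \row_i derive1n n (fun t => f t 0 i) t.
have F0 : F 0%N = f by apply/funext => t; apply/rowP => i; rewrite mxE.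
have FS n (x : R) : is_derive x 1 (F n) (F n.+1 x).
  apply: is_derive_vec => i; rewrite mxE derive1nS.
  rewrite (_ : (fun t => F n t 0 i) = derive1n n (fun t => f t 0 i)).
    by apply: derivable_is_derive; exact: sf.
  by apply/funext => t; rewrite mxE.
suff E n : derive1n n f = F n by move=> n x; rewrite E; case: (FS n x).
elim: n => [|n IH]; first by rewrite derive1n0.
by rewrite derive1nS IH; apply/funext => x; exact: derive1_eq (FS n x).
Qed.

Lemma smooth_curveD f g : smooth f -> smooth g -> smooth (f + g).
Proof.
move=> /smooth_coordP sf /smooth_coordP sg; apply/smooth_coordP => i.
rewrite (_ : (fun _ => _) = fun t => f t 0 i + g t 0 i).
  exact: smoothD (sf i) (sg i).
by apply/funext => t; rewrite mxE.
Qed.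

Lemma smooth_curveM a f : smooth a -> smooth f -> smooth (fun t => a t *: f t).
Proof.
move=> sa /smooth_coordP sf; apply/smooth_coordP => i.
rewrite (_ : (fun _ => _) = fun t => a t * f t 0 i).
  exact: smoothM sa (sf i).
by apply/funext => t; rewrite mxE.
Qed.

Lemma smooth_curveZ (b : R) f : smooth f -> smooth (b *: f).
Proof. by move=> sf; exact: (smooth_curveM (fun=> b) f (smooth_cst b) sf). Qed.

Lemma smooth_curve_cst v : smooth (fun=> v : V).
Proof. by apply/smooth_coordP => i; exact: smooth_cst. Qed.

Lemma smooth_curveB f g : smooth f -> smooth g -> smooth (f - g).
Proof.
move=> sf sg; rewrite (_ : f - g = f + -1 *: g); last by rewrite scaleN1r.
exact: smooth_curveD sf (smooth_curveZ (-1) _ sg).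
Qed.

Lemma derive1nD {W : normedModType R} n (f g : R -> W) : smooth f -> smooth g ->
  derive1n n (f + g) = derive1n n f + derive1n n g.
Proof.
move=> sf sg; elim: n => // n IH; rewrite !derive1nS IH; apply/funext => x.
exact: derive1_eq (is_deriveD (derivable_is_derive (sf n x)) (derivable_is_derive (sg n x))).
Qed.

Lemma derive1nZ {W : normedModType R} n (b : R) (f : R -> W) : smooth f ->
  derive1n n (b *: f) = b *: derive1n n f.
Proof.
move=> sf; elim: n => // n IH; rewrite !derive1nS IH; apply/funext => x.
exact: derive1_eq (is_deriveZ _ (derivable_is_derive (sf n x))).
Qed.

Lemma derive1nB {W : normedModType R} n (f g : R -> W) : smooth f -> smooth g ->
  derive1n n (f - g) = derive1n n f - derive1n n g.
Proof.
move=> sf sg; elim: n => // n IH; rewrite !derive1nS IH; apply/funext => x.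
exact: derive1_eq (is_deriveB (derivable_is_derive (sf n x)) (derivable_is_derive (sg n x))).
Qed.

Lemma derive1n_cst {W : normedModType R} n (v : W) :
  derive1n n (fun=> v : W) = fun=> (if n is 0%N then v else 0).
Proof.
elim: n => [//|n IH]; rewrite derive1nS IH; apply/funext => x.
by rewrite derive1_cst.
Qed.

Lemma periodic_derive1 {W : normedModType R} (f : R -> W) : Defs.periodic f ->
  Defs.periodic (derive1 f).
Proof.
move=> pf x; rewrite /derive1.
rewrite (_ : (fun h => h^-1 *: (f (h + (x + 2 * pi)) - f (x + 2 * pi))) =
  (fun h => h^-1 *: (f (h + x) - f x)))//.
by apply/funext => h; rewrite addrA !pf.
Qed.

Lemma periodic_derive1n {W : normedModType R} n (f : R -> W) : Defs.periodic f ->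
  Defs.periodic (derive1n n f).
Proof. by move=> pf; elim: n => // n; rewrite derive1nS; exact: periodic_derive1. Qed.

Lemma CsmoothD f g : Csmooth f -> Csmooth g -> Csmooth (f + g).
Proof.
move=> [sf pf] [sg pg]; split; first exact: smooth_curveD.
by move=> x; rewrite !fctE pf pg.
Qed.

Lemma CsmoothZ (b : R) f : Csmooth f -> Csmooth (b *: f).
Proof.
move=> [sf pf]; split; first exact: smooth_curveZ.
by move=> x; rewrite !fctE pf.
Qed.

Lemma CsmoothB f g : Csmooth f -> Csmooth g -> Csmooth (f - g).
Proof.
move=> sf sg; rewrite (_ : f - g = f + -1 *: g); last by rewrite scaleN1r.
exact: CsmoothD sf (CsmoothZ (-1) _ sg).
Qed.

Lemma Csmooth_cst (v : V) : Csmooth (fun=> v).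
Proof. by split; [exact: smooth_curve_cst|]. Qed.

Lemma Csmooth0 : Csmooth (0 : R -> V).
Proof. exact: (Csmooth_cst 0). Qed.

Lemma Csmooth_derive1n n f : Csmooth f -> Csmooth (derive1n n f).
Proof. by move=> [sf pf]; split; [exact: smooth_derive1n|exact: periodic_derive1n]. Qed.

Lemma smooth_coord f i : smooth f -> smooth (fun t => f t 0 i).
Proof. by move/smooth_coordP. Qed.

Lemma smooth_dot f g : smooth f -> smooth g -> smooth (fun t => dot (f t) (g t)).
Proof.
move=> sf sg.
rewrite (_ : (fun _ => _) = fun t => f t 0 0 * g t 0 0 + f t 0 1 * g t 0 1).
  by apply: smoothD; apply: smoothM; exact: smooth_coord.
by apply/funext => t; rewrite dotE.
Qed.

Lemma is_derive_dot {f g} {x : R} {df dg : V} :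
  is_derive x 1 f df -> is_derive x 1 g dg ->
  is_derive x 1 (fun t => dot (f t) (g t)) (dot df (g x) + dot (f x) dg).
Proof.
move=> dfx dgx.
have d (i : 'I_2) := is_deriveM (is_derive_coord dfx i) (is_derive_coord dgx i).
have := is_deriveD (d 0) (d 1); rewrite /GRing.scale/= => D.
rewrite (_ : (fun t => _) = (fun t => f t 0 0) * (fun t => g t 0 0) +
                            (fun t => f t 0 1) * (fun t => g t 0 1)).
  by apply: is_derive_eq; rewrite !dotE; ring.
by apply/funext => t; rewrite dotE.
Qed.

(* Stated so that [b = 1 / |f|] solves an equation polynomial in [b], as [smooth_ode] needs. *)
Lemma is_derive_inv_enorm {f} {x : R} {df : V} : f x != 0 -> is_derive x 1 f df ->
  is_derive x 1 (fun t => (enorm (f t))^-1)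
    (- ((enorm (f x))^-1 ^+ 3 * dot (f x) df)).
Proof.
move=> fx0 dfx; have n0 : 0 < enorm (f x) by rewrite enorm_gt0.
have d0 : 0 < dot (f x) (f x) by rewrite -sqr_enorm exprn_gt0.
have d1 := is_derive_comp Num.sqrt _ _ _ _ (is_derive_dot dfx dfx)
  (is_derive1_sqrt d0).
have := is_deriveV _ _ _ _ d1; rewrite /= -/(enorm (f x)) => /(_ (lt0r_neq0 n0)) D.
apply: is_derive_eq D _; rewrite (dotC df).
by field; rewrite lt0r_neq0.
Qed.

Lemma smooth_inv_enorm f : (forall x, f x != 0) -> smooth f ->
  smooth (fun t => (enorm (f t))^-1).
Proof.
move=> f0 sf; pose P (b : R -> R) (x : R) : R :=
  (- 1) * (b x * (b x * b x) * dot (f x) (derive1 f x)).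
apply: (smooth_ode (fun t => (enorm (f t))^-1) P).
  move=> x; apply: is_derive_eq (is_derive_inv_enorm (f0 x) (smooth_is_derive sf x)) _.
  by rewrite /P mulN1r !exprS expr0 mulr1.
move=> n nb; apply: ntimes_derivableM (ntimes_derivable_cst _ _) _.
apply: ntimes_derivableM; first by do 2 apply: ntimes_derivableM => //.
move: n {nb}; apply/ntimes_derivableP.
exact: smooth_dot sf (smooth_derive1 sf).
Qed.

(** Makes [|c'|] a polynomial in the coordinates of [c'] and in [1 / |c'|], which are among the
    generators of the class [coefficient]. *)
Lemma enorm_inv_enorm (v : V) : v != 0 -> enorm v = (enorm v)^-1 * dot v v.
Proof. by rewrite -enorm_gt0 => v0; rewrite -sqr_enorm expr2 mulKf// lt0r_neq0. Qed.

Lemma Csmooth_Ds (c h : R -> V) : Imm c -> Csmooth h -> Csmooth (Ds c h).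
Proof.
move=> [[sc pc] c0] [sh ph]; split.
  exact: smooth_curveM (smooth_inv_enorm _ c0 (smooth_derive1 sc)) (smooth_derive1 sh).
by move=> x; rewrite /Ds !periodic_derive1.
Qed.

Lemma Csmooth_iter_Ds n (c h : R -> V) : Imm c -> Csmooth h -> Csmooth (iter n (Ds c) h).
Proof. by move=> ic sh; elim: n => [|n IH]; [exact: sh|exact: Csmooth_Ds ic IH]. Qed.

End PlaneCurves.

(** * Integrals over the circle *)

Section CircleIntegral.
Context {R : realType}.
Local Notation mu := (@lebesgue_measure R).
Local Notation V := 'rV[R]_2.
Implicit Types (f g : R -> R).

Lemma twopi_gt0 : 0 < 2 * pi :> R.
Proof. by rewrite mulr_gt0// pi_gt0. Qed.

Lemma twopi_ge0 : 0 <= 2 * pi :> R.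
Proof. exact: ltW twopi_gt0. Qed.

Lemma continuous_integrable f (a b : R) :
  continuous f -> mu.-integrable `[a, b] (EFin \o f).
Proof.
move=> cf; apply: continuous_compact_integrable; first exact: segment_compact.
exact: continuous_subspaceT.
Qed.

Lemma circle_intD f g : continuous f -> continuous g ->
  circle_int (fun t => f t + g t) = circle_int f + circle_int g.
Proof. by move=> cf cg; apply: RintegralD => //; exact: continuous_integrable. Qed.

Lemma circle_intB f g : continuous f -> continuous g ->
  circle_int (fun t => f t - g t) = circle_int f - circle_int g.
Proof. by move=> cf cg; apply: RintegralB => //; exact: continuous_integrable. Qed.

Lemma circle_intZ (a : R) f : continuous f ->
  circle_int (fun t => a * f t) = a * circle_int f.
Proof. by move=> cf; apply: RintegralZl => //; exact: continuous_integrable. Qed.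

Lemma eq_circle_int f g : (forall t, 0 <= t <= 2 * pi -> f t = g t) ->
  circle_int f = circle_int g.
Proof. by move=> fg; apply: eq_Rintegral => t /[!inE]/=; rewrite in_itv/=; exact: fg. Qed.

Lemma le_circle_int f g : continuous f -> continuous g ->
  (forall t, 0 <= t <= 2 * pi -> f t <= g t) -> circle_int f <= circle_int g.
Proof.
move=> cf cg fg; apply: le_Rintegral; first by [].
- exact: continuous_integrable.
- exact: continuous_integrable.
by move=> t /=; rewrite in_itv/=; exact: fg.
Qed.

Lemma circle_int_ge0 f : (forall t, 0 <= t <= 2 * pi -> 0 <= f t) ->
  0 <= circle_int f.
Proof. by move=> f0; apply: Rintegral_ge0 => t /=; rewrite in_itv/=; exact: f0. Qed.

Lemma circle_int_cst (a : R) : circle_int (fun=> a) = a * (2 * pi).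
Proof.
by rewrite /circle_int Rintegral_cst//= lebesgue_measure_itv/= lte_fin twopi_gt0/= ?subr0.
Qed.

Lemma norm_circle_int f : continuous f ->
  `|circle_int f| <= circle_int (fun t => `|f t|).
Proof. by move=> cf; apply: le_normr_Rintegral => //; exact: continuous_integrable. Qed.

Lemma continuous_norm f : continuous f -> continuous (fun t => `|f t|).
Proof. by move=> cf t; apply: continuous_comp (cf t) _; exact: norm_continuous. Qed.

Lemma continuous_mul f g : continuous f -> continuous g ->
  continuous (fun t => f t * g t).
Proof. by move=> cf cg t; apply: continuousM; [exact: cf|exact: cg]. Qed.

Lemma continuous_add f g : continuous f -> continuous g ->
  continuous (fun t => f t + g t).
Proof. by move=> cf cg t; apply: continuousD; [exact: cf|exact: cg]. Qed.

Lemma continuous_cst (a : R) : continuous (fun _ : R => a).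
Proof. by move=> t; exact: cvg_cst. Qed.

Lemma circle_int_le_cst f (M : R) : continuous f ->
  (forall t, 0 <= t <= 2 * pi -> `|f t| <= M) -> `|circle_int f| <= 2 * pi * M.
Proof.
move=> cf fM; rewrite mulrC -circle_int_cst; apply: le_trans (norm_circle_int _ cf) _.
apply: le_circle_int => //; [exact: continuous_norm|exact: continuous_cst].
Qed.

Lemma FTC_continuous (F f : R -> R) (a b : R) : a <= b ->
  (forall x : R, is_derive x 1 F (f x)) -> continuous f ->
  (\int[mu]_(x in `[a, b]) (f x)%:E)%E = (F b - F a)%:E.
Proof.
rewrite le_eqVlt => /orP[/eqP ->|ab] dF cf.
  by rewrite set_itv1 integral_set1 subrr.
rewrite (continuous_FTC2 (F := F) ab)//; first exact: continuous_subspaceT.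
  have cF : continuous F by move=> x; exact: is_derive_continuous (dF x).
  split=> [x _||]; first by case: (dF x).
    exact: cvg_at_right_filter (cF a).
  exact: cvg_at_left_filter (cF b).
by move=> x _; exact: derive1_eq (dF x).
Qed.

Lemma FTC_smooth f (a b : R) : a <= b -> smooth f ->
  \int[mu]_(x in `[a, b]) derive1 f x = f b - f a.
Proof.
move=> ab sf.
by rewrite /Rintegral (FTC_continuous f _ a b ab (smooth_is_derive sf)
  (smooth_continuous _ (smooth_derive1 sf))).
Qed.

Lemma periodic2pi f : Defs.periodic f -> f (2 * pi) = f 0.
Proof. by move=> pf; rewrite -[in RHS](pf 0) add0r. Qed.

Lemma circle_int_derive1 f : smooth f -> Defs.periodic f ->
  circle_int (derive1 f) = 0.
Proof. by move=> sf pf; rewrite /circle_int FTC_smooth ?twopi_ge0// periodic2pi// subrr. Qed.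

Lemma circle_int_parts f g : smooth f -> smooth g -> Defs.periodic f ->
  Defs.periodic g ->
  circle_int (fun t => f t * derive1 g t) = - circle_int (fun t => derive1 f t * g t).
Proof.
move=> sf sg pf pg; have sfg := smoothM f g sf sg.
have cf := smooth_continuous _ sf; have cg := smooth_continuous _ sg.
have cf' := smooth_continuous _ (smooth_derive1 sf).
have cg' := smooth_continuous _ (smooth_derive1 sg).
have pfg : Defs.periodic (fun t => f t * g t) by move=> t; rewrite pf pg.
have := circle_int_derive1 _ sfg pfg.
rewrite (_ : derive1 _ = fun t => f t * derive1 g t + derive1 f t * g t); last first.
  apply/funext => t.
  rewrite (derive1_eq (is_deriveM (smooth_is_derive sf t) (smooth_is_derive sg t))).
  by rewrite /GRing.scale/= (mulrC (g t)).
by rewrite circle_intD; [move/eqP; rewrite addr_eq0 => /eqP|exact: continuous_mul..].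
Qed.

(** To be applied to each coordinate separately: the derivative of a closed plane curve may vanish
    nowhere. *)
Lemma circle_Rolle f : smooth f -> Defs.periodic f ->
  exists2 t, 0 <= t <= 2 * pi & derive1 f t = 0.
Proof.
move=> sf pf; have cf := smooth_continuous _ sf.
have [] := @Rolle R f 0 (2 * pi) twopi_gt0 _ _ _.
- by move=> x _; exact: smooth_derivable.
- exact: continuous_subspaceT.
- by rewrite periodic2pi.
move=> t; rewrite in_itv/= => /andP[t0 t1] [_ ft]; exists t; first by rewrite !ltW.
by rewrite derive1E.
Qed.

Lemma circle_osc f (x y : R) : smooth f -> 0 <= x <= 2 * pi -> 0 <= y <= 2 * pi ->
  `|f x - f y| <= circle_int (fun t => `|derive1 f t|).
Proof.
wlog xy : x y / y <= x => [H|] sf x0 y0.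
  by have [yx|/ltW xy] := leP y x; [exact: H|rewrite distrC; exact: H].
have cf' := smooth_continuous _ (smooth_derive1 sf).
rewrite -FTC_smooth//; apply: le_trans (le_normr_Rintegral _ _) _ => //.
  exact: continuous_integrable.
have in1 := continuous_integrable _ y x (continuous_norm _ cf').
have in2 := continuous_integrable _ 0 (2 * pi) (continuous_norm _ cf').
rewrite /circle_int /Rintegral fine_le//.
- exact: integrable_fin_num.
- exact: integrable_fin_num.
apply: ge0_subset_integral => //.
- by move/integrableP : in2 => [].
- move=> t /=; rewrite !in_itv/= => /andP[yt tx].
  by case/andP: x0 => _ /(le_trans tx) ->; case/andP: y0 => /le_trans ->.
Qed.

Lemma periodic_int (T : Type) (f : R -> T) (k : int) x :
  Defs.periodic f -> f (x + k%:~R * (2 * pi)) = f x.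
Proof.
move=> pf; case: k => n; first elim: n x => [|n IH] x.
- by rewrite mul0r addr0.
- by rewrite intS rmorphD/= mulrDl mul1r addrA IH pf.
rewrite NegzE; elim: n x => [|n IH] x.
  by rewrite -[in RHS](subrK (2 * pi) x) pf mulN1r.
rewrite -[in RHS](IH x) -[in RHS](subrK (2 * pi) (x + _)) pf.
by congr f; rewrite -(addn1 n.+1) PoszD opprD rmorphD/= mulrDl mulN1r addrA.
Qed.

Lemma periodic_rep (x : R) : exists2 y, 0 <= y <= 2 * pi &
  forall (T : Type) (f : R -> T), Defs.periodic f -> f x = f y.
Proof.
pose k := Num.floor (x / (2 * pi)).
exists (x + (- k)%:~R * (2 * pi)); last by move=> T f pf; rewrite periodic_int.
have h1 : k%:~R <= x / (2 * pi) by exact: Num.Theory.floor_le.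
have h2 : x / (2 * pi) < (k + 1)%:~R by exact: floorD1_gt.
rewrite mulrNz mulNr subr_ge0 -ler_pdivlMr ?twopi_gt0// h1/=.
rewrite lerBlDr; move: h2; rewrite ltr_pdivrMr ?twopi_gt0// rmorphD/= mulrDl mul1r.
by rewrite addrC => /ltW.
Qed.

Lemma periodic_bounded f : continuous f -> Defs.periodic f ->
  exists2 M : R, 0 < M & forall t, `|f t| <= M.
Proof.
move=> cf pf; have cn := continuous_norm _ cf.
have [c _ Hc] := @EVT_max R (fun t => `|f t|) 0 (2 * pi) twopi_ge0 (continuous_subspaceT cn).
exists (`|f c| + 1) => [|t]; first by rewrite ltr_wpDl.
have [y y0 H] := periodic_rep t; rewrite (H _ f pf) (le_trans (Hc y _))//.
by rewrite lerDl.
Qed.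

(** Yields the Cauchy-Schwarz inequalities below: the quadratic polynomial will be the integral of a
    square depending on [x]. *)
Lemma quadratic_discriminant (A B C : R) : 0 <= A ->
  (forall x, 0 <= A * x ^+ 2 + B * x *+ 2 + C) -> B ^+ 2 <= A * C.
Proof.
rewrite le_eqVlt => /orP[/eqP <- H|A0 H].
  rewrite mul0r; have [->|B0] := eqVneq B 0; first by rewrite expr0n.
  (* When [A = 0] the polynomial is affine, and takes the value [-1] at this point. *)
  have := H (- (C + 1) / (2 * B)); rewrite mul0r add0r.
  have -> : B * (- (C + 1) / (2 * B)) *+ 2 = - (C + 1).
    by rewrite -mulr_natl; field.
  lra.
have := H (- B / A); rewrite (_ : _ + C = C - B ^+ 2 / A); last first.
  by field; rewrite gt_eqF.
by rewrite subr_ge0 ler_pdivrMr// mulrC.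
Qed.

End CircleIntegral.

(** * The L2 norm of smooth curves *)

Section L2norm.
Context {R : realType}.
Local Notation V := 'rV[R]_2.
Implicit Types (f g : R -> V).

Definition l2norm f : R := Num.sqrt (circle_int (fun t => dot (f t) (f t))).

Lemma l2norm_ge0 f : 0 <= l2norm f.
Proof. exact: sqrtr_ge0. Qed.

Lemma sqr_l2norm f : l2norm f ^+ 2 = circle_int (fun t => dot (f t) (f t)).
Proof. by rewrite sqr_sqrtr// circle_int_ge0// => t _; exact: dot_ge0. Qed.

Lemma continuous_dot f g : smooth f -> smooth g ->
  continuous (fun t => dot (f t) (g t)).
Proof. by move=> sf sg; apply: smooth_continuous; exact: smooth_dot. Qed.

Lemma l2normZ (a : R) f : smooth f -> l2norm (a *: f) = `|a| * l2norm f.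
Proof.
move=> sf; rewrite /l2norm.
rewrite (_ : (fun t => _) = fun t => a ^+ 2 * dot (f t) (f t)); last first.
  by apply/funext => t; rewrite !fctE dotZl dotZr mulrA.
by rewrite circle_intZ; [rewrite sqrtrM ?sqr_ge0// sqrtr_sqr|exact: continuous_dot].
Qed.

Lemma circle_int_dot_CS f g : smooth f -> smooth g ->
  circle_int (fun t => dot (f t) (g t)) ^+ 2 <= l2norm f ^+ 2 * l2norm g ^+ 2.
Proof.
move=> sf sg; rewrite !sqr_l2norm.
have cff := continuous_dot _ _ sf sf; have cgg := continuous_dot _ _ sg sg.
have cfg := continuous_dot _ _ sf sg.
apply: quadratic_discriminant; first by apply: circle_int_ge0 => t _; exact: dot_ge0.
move=> x; rewrite (_ : _ + _ = circle_int (fun t => dot (x *: f t + g t) (x *: f t + g t))).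
  by apply: circle_int_ge0 => t _; exact: dot_ge0.
rewrite (_ : (fun t => dot (x *: f t + g t) _) =
    fun t => (x ^+ 2 * dot (f t) (f t) + (x *+ 2) * (dot (f t) (g t))) +
      dot (g t) (g t)); last first.
  by apply/funext => t; rewrite !dotE !mxE; ring.
have c1 := continuous_mul _ _ (continuous_cst (x ^+ 2)) cff.
have c2 := continuous_mul _ _ (continuous_cst (x *+ 2)) cfg.
rewrite circle_intD//; last exact: continuous_add.
rewrite circle_intD// !circle_intZ//; ring.
Qed.

Lemma l2normD f g : smooth f -> smooth g -> l2norm (f + g) <= l2norm f + l2norm g.
Proof.
move=> sf sg.
rewrite -(@ler_pXn2r _ 2)// ?nnegrE ?addr_ge0 ?l2norm_ge0// sqrrD.
have cff := continuous_dot _ _ sf sf; have cgg := continuous_dot _ _ sg sg.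
have cfg := continuous_dot _ _ sf sg.
have c2 := continuous_mul _ _ (continuous_cst 2) cfg.
rewrite [leLHS]sqr_l2norm (_ : (fun t => dot ((f + g) t) _) =
    fun t => (dot (f t) (f t) + 2 * (dot (f t) (g t))) + dot (g t) (g t)); last first.
  by apply/funext => t; rewrite !fctE !dotE !mxE; ring.
rewrite circle_intD//; last exact: continuous_add.
rewrite circle_intD// !circle_intZ// -!sqr_l2norm lerD2r lerD2l.
rewrite -[leRHS]mulr_natl ler_pM2l// (le_trans (ler_norm _))//.
rewrite -(@ler_pXn2r _ 2)// ?nnegrE ?mulr_ge0 ?l2norm_ge0//.
by rewrite exprMn real_normK ?num_real// circle_int_dot_CS.
Qed.

Lemma l2norm_le f (M : R) : smooth f -> 0 <= M ->
  (forall t, 0 <= t <= 2 * pi -> enorm (f t) <= M) ->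
  l2norm f <= Num.sqrt (2 * pi) * M.
Proof.
move=> sf M0 fM.
rewrite -(@ler_pXn2r _ 2)// ?nnegrE ?mulr_ge0 ?l2norm_ge0 ?sqrtr_ge0//.
rewrite exprMn sqr_l2norm (sqr_sqrtr twopi_ge0) mulrC -circle_int_cst.
apply: le_circle_int; [exact: continuous_dot|exact: continuous_cst|move=> t t0].
by rewrite -sqr_enorm ler_pXn2r ?nnegrE ?enorm_ge0// fM.
Qed.

Lemma Csmooth_bounded f : Csmooth f -> exists2 M : R, 0 < M & forall t, enorm (f t) <= M.
Proof.
move=> [sf pf].
have [M M0 HM] : exists2 M : R, 0 < M & forall t, `|dot (f t) (f t)| <= M.
  by apply: periodic_bounded; [exact: continuous_dot|move=> t; rewrite pf].
exists (M + 1) => [|t]; first by rewrite addr_gt0.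
rewrite -(@ler_pXn2r _ 2)// ?nnegrE ?enorm_ge0 ?addr_ge0 ?(ltW M0)// sqr_enorm.
by have := HM t; have := ler_norm (dot (f t) (f t)); nra.
Qed.

End L2norm.

(** * Mean value inequality and Gronwall's lemma for Dini bounds *)

Section DiniBounds.
Context {R : realType}.
Implicit Types (F P p : R -> R).

(** Real induction: the supremum of the points [t] with [H t <= H a] is itself such a point by the
    left half of the local hypothesis, and if it were below [b] the right half would go beyond
    it. *)
Lemma locally_nonincreasing (H : R -> R) (a b : R) : a <= b ->
  (forall t, a <= t <= b -> exists2 r : R, 0 < r & forall s, 0 <= s < r ->
     H (t + s) <= H t /\ H t <= H (t - s)) -> H b <= H a.
Proof.
move=> ab loc; pose A := [set t | a <= t <= b /\ H t <= H a].
have Aa : A a by split; rewrite ?lexx.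
have hA : has_sup A by split; [exists a|exists b => t [/andP[]]].
have sA t : A t -> t <= sup A by move=> At; exact: sup_upper_bound.
have s1 : a <= sup A <= b.
  by rewrite sA//= ge_sup//; [exists a|move=> t [/andP[]]].
have [r r0 Hr] := loc _ s1.
have As : H (sup A) <= H a.
  have [x [/andP[ax xb] Hx] sx] := sup_adherent r0 hA.
  have xs : x <= sup A by apply: sA; split=> //; rewrite ax.
  have /Hr [_] : 0 <= sup A - x < r by apply/andP; split; lra.
  by rewrite subKr => /le_trans; apply.
have [sb|bs] := ltP (sup A) b; last first.
  by rewrite (_ : b = sup A)//; apply/eqP; rewrite eq_le bs; case/andP: s1.
pose s := Num.min (r / 2) (b - sup A).
have s0 : 0 < s by rewrite lt_min subr_gt0 sb divr_gt0.
have sr : s < r by rewrite (le_lt_trans (_ : _ <= r / 2))// ?ge_min ?lexx//; lra.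
have sbA : s <= b - sup A by rewrite ge_min lexx orbT.
have /Hr [H1 _] : 0 <= s < r by rewrite (ltW s0).
have : A (sup A + s).
  split; last exact: le_trans As.
  by case/andP: s1 => ? ?; apply/andP; split; lra.
by move/sA; lra.
Qed.

(** A bound [q] on the absolute values of all Dini derivatives of [F] at [t]. Being two-sided in [s]
    and in sign, it passes to [- F] and to compositions. *)
Definition dini F (t q : R) := forall e : R, 0 < e -> exists2 r : R, 0 < r &
  forall s, `|s| < r -> `|F (t + s) - F t| <= `|s| * (q + e).

Lemma dini_MVT F P p (a b : R) : a <= b ->
  (forall t, a <= t <= b -> is_derive t 1 P (p t)) ->
  (forall t, a <= t <= b -> dini F t (p t)) -> F b - F a <= P b - P a.
Proof.
move=> ab dP dF; apply/ler_addgt0Pr => e e0.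
(* The extra slope [d] pays for the remainders of [F] and of [P], half of it for each, and costs at
   most [e] over the whole interval; the [+ 1] allows [a = b]. *)
pose d := e / (b - a + 1).
have ba : 0 < b - a + 1 by lra.
have d0 : 0 < d by rewrite divr_gt0.
pose H t := F t - P t - d * t.
suff : H b <= H a.
  rewrite /H => Hba; have : d * (b - a) <= e.
    by rewrite mulrAC ler_pdivrMr// ler_pM2l//; lra.
  lra.
apply: locally_nonincreasing => // t tab.
have d2 : 0 < d / 2 by lra.
have [r1 r10 H1] := is_deriveP.1 (dP t tab) _ d2.
have [r2 r20 H2] := dF t tab _ d2.
exists (Num.min r1 r2); first by rewrite lt_min r10.
move=> s /andP[s0]; rewrite lt_min => /andP[s1 s2].
have := H1 s; have := H1 (- s); have := H2 s; have := H2 (- s).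
rewrite !normrN (ger0_norm s0) => /(_ s2) h1 /(_ s2) h2 /(_ s1) h3 /(_ s1) h4.
move: h1 h2 h3 h4; rewrite /GRing.scale/= !ler_norml => /andP[? ?] /andP[? ?] /andP[? ?] /andP[? ?].
by rewrite /H; split; nra.
Qed.

Lemma dini_comp F (f : R -> R) (t q d : R) : 0 <= q -> dini F t q ->
  is_derive (F t) 1 f d -> dini (f \o F) t (`|d| * q).
Proof.
move=> q0 dF /is_deriveP df e e0.
have q1 : 0 < 2 * (q + 1) by lra.
have d1 : 0 < 2 * (`|d| + 1) by have := normr_ge0 d; lra.
(* Chosen so that [e1 q] and [(|d| + e1) e2] are at most [e / 2] each. *)
pose e1 := Num.min 1 (e / (2 * (q + 1))); pose e2 := e / (2 * (`|d| + 1)).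
have e10 : 0 < e1 by rewrite lt_min ltr01 divr_gt0.
have e20 : 0 < e2 by rewrite divr_gt0.
have e1q : e1 * q <= e / 2.
  have : e1 <= e / (2 * (q + 1)) by rewrite ge_min lexx orbT.
  by rewrite ler_pdivlMr//; nra.
have e2d : (`|d| + e1) * e2 <= e / 2.
  have -> : e / 2 = (`|d| + 1) * e2 by rewrite /e2; field; lra.
  by rewrite ler_pM2r// lerD2l ge_min lexx.
have [r1 r10 H1] := df _ e10; have [r2 r20 H2] := dF _ e20.
have qe : 0 < q + e2 by lra.
exists (Num.min r2 (r1 / (q + e2))) => [|s].
  by rewrite lt_min r20 divr_gt0.
rewrite lt_min ltr_pdivlMr// => /andP[s2 s1].
have h2 := H2 _ s2; have h1 := H1 _ (le_lt_trans h2 s1).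
rewrite subrKC in h1.
have : `|f (F (t + s)) - f (F t)| <= (`|d| + e1) * `|F (t + s) - F t|.
  have := ler_normD (f (F (t + s)) - f (F t) - (F (t + s) - F t) *: d) ((F (t + s) - F t) *: d).
  rewrite subrK normrZ => /le_trans; apply.
  by rewrite mulrDl addrC (mulrC `|d|) lerD2l.
move=> /le_trans; apply; have nd := normr_ge0 d.
have : (`|d| + e1) * `|F (t + s) - F t| <= (`|d| + e1) * (`|s| * (q + e2)).
  by rewrite ler_wpM2l// addr_ge0// ltW.
move=> /le_trans; apply; have ns := normr_ge0 s; rewrite mulrCA ler_wpM2l//.
rewrite mulrDr mulrDl -addrA lerD2l; lra.
Qed.

(** Both [ln F] and [- ln F] have the Dini bound [K sigma], to be compared with the primitive [K S].
    The second one gives the reverse inequality, which will keep [|c'|] away from 0. *)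
Lemma dini_gronwall F (S sigma : R -> R) (K a b : R) : a <= b -> 0 <= K ->
  (forall t, a <= t <= b -> 0 < F t) ->
  (forall t, a <= t <= b -> 0 <= sigma t) ->
  (forall t, a <= t <= b -> is_derive t 1 S (sigma t)) ->
  (forall t, a <= t <= b -> dini F t (K * F t * sigma t)) ->
  F b <= F a * expR (K * (S b - S a)) /\ F a <= F b * expR (K * (S b - S a)).
Proof.
move=> ab K0 F0 s0 dS dF.
have Fa0 : 0 < F a by apply: F0; rewrite lexx.
have Fb0 : 0 < F b by apply: F0; rewrite lexx ab.
have dln t : a <= t <= b -> dini (@ln R \o F) t (K * sigma t).
  move=> tab; have Ft := F0 t tab.
  have E : `|(F t)^-1| * (K * F t * sigma t) = K * sigma t.
    by rewrite normfV gtr0_norm//; field; rewrite gt_eqF.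
  rewrite -E; apply: dini_comp (dF t tab) (is_derive1_ln Ft).
  by apply: mulr_ge0; [apply: mulr_ge0 K0 _; exact: ltW|exact: s0].
have dS' t : a <= t <= b -> is_derive t 1 (fun t => K * S t) (K * sigma t).
  by move=> /dS d; have := is_deriveZ K d.
have h1 := dini_MVT _ _ _ _ _ ab dS' dln.
have dln' t : a <= t <= b -> dini (fun t => - ln (F t)) t (K * sigma t).
  move=> tab e e0; have [r r0 Hr] := dln t tab e e0; exists r => // s sr.
  by rewrite opprK addrC distrC; exact: Hr.
have h2 := dini_MVT _ _ _ _ _ ab dS' dln'.
split.
  rewrite -[leLHS]lnK ?posrE// -[X in X * _]lnK ?posrE// -expRD ler_expR.
  by rewrite mulrBr -lerBlDl.
rewrite -[leLHS]lnK ?posrE// -[X in X * _]lnK ?posrE// -expRD ler_expR.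
by rewrite mulrBr -lerBlDl; move: h2; rewrite opprK addrC.
Qed.

End DiniBounds.

(** * Smooth paths in the Frechet space of closed curves *)

Section SmoothPaths.
Context {R : realType}.
Local Notation V := 'rV[R]_2.
Local Notation curve := (R -> V).
Implicit Types (g h : R -> curve) (a phi : R -> R).

(** The form that [frechet_derivative] takes once the quotient is cleared, as in [is_deriveP]. *)
Definition path_derivative g g' : Prop :=
  forall (t : R) (k : nat) (e : R), 0 < e -> exists2 r : R, 0 < r &
    forall s, `|s| < r -> forall theta,
      `|derive1n k (g (t + s)) theta - derive1n k (g t) theta -
        s *: derive1n k (g' t) theta| <= e * `|s|.

Lemma frechet_derivativeP g g' : (forall t, Csmooth (g t)) ->
  (forall t, Csmooth (g' t)) -> frechet_derivative g g' <-> path_derivative g g'.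
Proof.
move=> sg sg'.
have E t k s theta : s != 0 ->
    derive1n k (g (t + s)) theta - derive1n k (g t) theta - s *: derive1n k (g' t) theta =
    s *: derive1n k (s^-1 *: (g (t + s) - g t) - g' t) theta.
  move=> s0; have [s1 _] := sg (t + s); have [s2 _] := sg t; have [s3 _] := sg' t.
  have s12 := smooth_curveB _ _ s1 s2.
  rewrite (derive1nB k _ _ (smooth_curveZ s^-1 _ s12) s3) (derive1nZ k _ _ s12).
  rewrite (derive1nB k _ _ s1 s2) !fctE scalerBr.
  by rewrite [s *: (s^-1 *: _)]scalerA mulfV// scale1r.
split=> H t k e e0.
  have [r /= r0 Hr] := H t k e e0; exists r => // s sr theta.
  have [->|s0] := eqVneq s 0.
    by rewrite addr0 subrr scale0r subr0 !normr0 mulr0.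
  by rewrite E// normrZ mulrC ler_wpM2r// Hr//= sub0r normrN.
have [r r0 Hr] := H t k e e0; exists r => //= s; rewrite /= sub0r normrN => sr s0 theta.
have := Hr s sr theta.
by rewrite E// normrZ mulrC ler_pM2r// normr_gt0.
Qed.

Lemma path_derivative_is_derive {g g'} : path_derivative g g' ->
  forall k (t : R) theta, is_derive t 1 (fun t => derive1n k (g t) theta)
    (derive1n k (g' t) theta).
Proof.
move=> H k t theta; apply/is_deriveP => e e0; have [r r0 Hr] := H t k e e0.
by exists r => // s sr; exact: Hr.
Qed.

Lemma path_derivative_velocity {g g'} : path_derivative g g' -> velocity g = g'.
Proof.
move=> H; apply/funext => t; apply/funext => theta; rewrite /velocity.
exact: derive1_eq (path_derivative_is_derive H 0%N t theta).
Qed.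

Lemma path_derivativeD g g' h h' :
  (forall t, Csmooth (g t)) -> (forall t, Csmooth (g' t)) ->
  (forall t, Csmooth (h t)) -> (forall t, Csmooth (h' t)) ->
  path_derivative g g' -> path_derivative h h' ->
  path_derivative (fun t => g t + h t) (fun t => g' t + h' t).
Proof.
move=> sg sg' sh sh' dg dh t k e e0; have e2 : 0 < e / 2 by rewrite divr_gt0.
have [r1 r10 H1] := dg t k _ e2; have [r2 r20 H2] := dh t k _ e2.
exists (Num.min r1 r2) => [|s]; first by rewrite lt_min r10.
rewrite lt_min => /andP[s1 s2] theta.
have [sa _] := sg (t + s); have [sb _] := sg t; have [sc _] := sg' t.
have [ta _] := sh (t + s); have [tb _] := sh t; have [tc _] := sh' t.
rewrite (derive1nD k _ _ sa ta) (derive1nD k _ _ sb tb) (derive1nD k _ _ sc tc) !fctE.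
rewrite (_ : _ - _ = (derive1n k (g (t + s)) theta - derive1n k (g t) theta -
        s *: derive1n k (g' t) theta) + (derive1n k (h (t + s)) theta -
        derive1n k (h t) theta - s *: derive1n k (h' t) theta)); last first.
  by rewrite scalerDr !opprD !addrA; do 2 (apply/rowP => i; rewrite !mxE; ring).
apply: le_trans (ler_normD _ _) _.
have := H1 s s1 theta; have := H2 s s2 theta; lra.
Qed.

Lemma Csmooth_sup k (f : curve) : Csmooth f ->
  exists2 M : R, 0 < M & forall theta, `|derive1n k f theta| <= M.
Proof.
move=> sf; have [M M0 HM] := Csmooth_bounded _ (Csmooth_derive1n k f sf).
by exists M => // theta; exact: le_trans (norm_le_enorm _) (HM theta).
Qed.

Lemma path_derivativeM a g g' : smooth a ->
  (forall t, Csmooth (g t)) -> (forall t, Csmooth (g' t)) ->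
  path_derivative g g' ->
  path_derivative (fun t => a t *: g t) (fun t => derive1 a t *: g t + a t *: g' t).
Proof.
move=> sa sg sg' dg t k e e0.
have [X X0 HX] := Csmooth_sup k _ (sg t); have [Y Y0 HY] := Csmooth_sup k _ (sg' t).
(* One third of [e] for each term of the decomposition below: the remainder of [g], the variation of
   [a] along [g'], and the remainder of [a]. *)
pose e1 := e / (3 * (`|a t| + 1)); pose e2 := Num.min 1 (e / (3 * Y)).
pose e3 := e / (3 * X).
have na : 0 < 3 * (`|a t| + 1) by have := normr_ge0 (a t); lra.
have e10 : 0 < e1 by rewrite divr_gt0.
have e20 : 0 < e2 by rewrite lt_min ltr01 divr_gt0// mulr_gt0.
have e30 : 0 < e3 by rewrite divr_gt0// mulr_gt0.
have [r1 r10 H1] := dg t k _ e10.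
have [r3 r30 H3] := is_deriveP.1 (smooth_is_derive sa t) _ e30.
have [r2 r20 H2] : exists2 r, 0 < r & forall s, `|s| < r -> `|a (t + s) - a t| <= e2.
  have := smooth_continuous _ sa t => /cvgrPdist_le /(_ _ e20) [r /= r0 Hr].
  exists r => // s sr; rewrite distrC; apply: Hr => /=.
  by rewrite opprD addNKr normrN.
exists (Num.min r1 (Num.min r2 r3)) => [|s]; first by rewrite !lt_min r10 r20.
rewrite !lt_min => /and3P[s1 s2 s3] theta.
have [sga _] := sg (t + s); have [sgb _] := sg t; have [sgc _] := sg' t.
rewrite (derive1nD k _ _ (smooth_curveZ _ _ sgb) (smooth_curveZ _ _ sgc)).
rewrite !derive1nZ// !fctE.
move: (H1 s s1 theta) (HX theta) (HY theta) (H2 s s2) (H3 s s3).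
set A := derive1n k (g (t + s)) theta; set B := derive1n k (g t) theta.
set C := derive1n k (g' t) theta => h1 hX hY h2 h3.
rewrite (_ : _ - _ = a (t + s) *: (A - B - s *: C) + ((a (t + s) - a t) * s) *: C +
   (a (t + s) - a t - s * derive1 a t) *: B); last first.
  by apply/rowP => i; rewrite !mxE; ring.
apply: le_trans (ler_normD _ _) _.
have b1 : `|a (t + s) *: (A - B - s *: C)| <= e / 3 * `|s|.
  rewrite normrZ (_ : e / 3 = (`|a t| + 1) * e1); last by rewrite /e1; field; lra.
  rewrite -mulrA; apply: ler_pM => //.
  have := ler_normD (a (t + s) - a t) (a t); rewrite subrK => /le_trans; apply.
  rewrite addrC lerD2l; apply: le_trans h2 _; by rewrite ge_min lexx.
have b2 : `|((a (t + s) - a t) * s) *: C| <= e / 3 * `|s|.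
  rewrite normrZ normrM mulrAC ler_wpM2r//.
  have : e2 <= e / (3 * Y) by rewrite ge_min lexx orbT.
  rewrite ler_pdivlMr ?mulr_gt0// => h.
  by apply: le_trans (ler_pM _ _ h2 hY) _ => //; lra.
have b3 : `|(a (t + s) - a t - s * derive1 a t) *: B| <= e / 3 * `|s|.
  rewrite normrZ; apply: le_trans (ler_pM _ _ h3 hX) _ => //.
  by rewrite mulrAC ler_wpM2r// /e3 (_ : e / (3 * X) * X = e / 3)//; field; lra.
apply: le_trans (lerD (ler_normD _ _) (lexx _)) _; lra.
Qed.

Lemma path_derivative_comp phi g g' : smooth phi ->
  (forall t, Csmooth (g' t)) -> path_derivative g g' ->
  path_derivative (g \o phi) (fun t => derive1 phi t *: g' (phi t)).
Proof.
move=> sphi sg' dg t k e e0.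
have [Y Y0 HY] := Csmooth_sup k _ (sg' (phi t)).
pose d := derive1 phi t.
have nd : 0 < 2 * (`|d| + 1) by have := normr_ge0 d; lra.
(* [e1] controls the remainder of [g] over the increment [u] of [phi], and [e2] the remainder of
   [phi] itself. *)
pose e1 := e / (2 * (`|d| + 1)); pose e2 := Num.min 1 (e / (2 * Y)).
have e10 : 0 < e1 by rewrite divr_gt0.
have e20 : 0 < e2 by rewrite lt_min ltr01 divr_gt0// mulr_gt0.
have [r1 r10 H1] := dg (phi t) k _ e10.
have [r2 r20 H2] := is_deriveP.1 (smooth_is_derive sphi t) _ e20.
exists (Num.min r2 (r1 / (`|d| + 1))) => [|s].
  by rewrite lt_min r20 divr_gt0//; lra.
rewrite lt_min ltr_pdivlMr; last by lra.
move=> /andP[s2 s1] theta.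
pose u := phi (t + s) - phi t.
have h2 : `|u - s * d| <= e2 * `|s| by exact: H2 s s2.
have us : `|u| <= (`|d| + 1) * `|s|.
  have := ler_normD (u - s * d) (s * d); rewrite subrK normrM => /le_trans; apply.
  have : e2 <= 1 by rewrite ge_min lexx.
  have := normr_ge0 s; nra.
have := H1 u; rewrite subrKC => /(_ _ theta) h1.
have {h1} := h1 (le_lt_trans us _); rewrite (mulrC (`|d| + 1)) => /(_ s1).
have [sgc _] := sg' (phi t); rewrite derive1nZ// !fctE /= -/d.
move: (HY theta).
set A := derive1n k (g (phi (t + s))) theta; set B := derive1n k (g (phi t)) theta.
set C := derive1n k (g' (phi t)) theta => hY h1.
rewrite (_ : _ - _ = (A - B - u *: C) + (u - s * d) *: C); last first.
  by apply/rowP => i; rewrite !mxE; ring.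
apply: le_trans (ler_normD _ _) _.
have b1 : `|A - B - u *: C| <= e / 2 * `|s|.
  apply: le_trans h1 _; apply: le_trans (ler_wpM2l (ltW e10) us) _.
  by rewrite mulrA ler_wpM2r// /e1 (_ : e / (2 * (`|d| + 1)) * (`|d| + 1) = e / 2)//; field; lra.
have b2 : `|(u - s * d) *: C| <= e / 2 * `|s|.
  rewrite normrZ; apply: le_trans (ler_pM _ _ h2 hY) _ => //.
  rewrite mulrAC ler_wpM2r//.
  have : e2 <= e / (2 * Y) by rewrite ge_min lexx orbT.
  by rewrite ler_pdivlMr ?mulr_gt0//; lra.
lra.
Qed.

(** The sequence required by [smooth_path] leaves no choice, each term being the velocity of the
    previous one. The recursive form lets the product and chain rules go by induction, as for
    [ntimes_derivable]. *)
Fixpoint ntimes_path (n : nat) g : Prop :=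
  (forall t, Csmooth (g t)) /\
  if n is m.+1 then path_derivative g (velocity g) /\ ntimes_path m (velocity g)
  else True.

Lemma ntimes_path_Csmooth n g : ntimes_path n g -> forall t, Csmooth (g t).
Proof. by case: n => [|n] []. Qed.

Lemma ntimes_pathW n g : ntimes_path n.+1 g -> ntimes_path n g.
Proof.
elim: n g => [|n IH] g [sg [dg ng]]; split=> //; split=> //.
exact: IH.
Qed.

Lemma smooth_pathP g : smooth_path g <-> forall n, ntimes_path n g.
Proof.
split=> [[G [<- sG dG]] n|ng].
  have dG' m := (frechet_derivativeP _ _ (sG m) (sG m.+1)).1 (dG m).
  elim: n 0%N => [|n IH] m; split=> //.
  by rewrite (path_derivative_velocity (dG' m)).
have nG n m : ntimes_path m (iter n (@velocity R) g).
  by elim: n m => [|n IH] m //; have [_ []] := IH m.+1.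
exists (fun n => iter n (@velocity R) g); split=> // [n t|n].
  exact: ntimes_path_Csmooth (nG n 0%N) t.
have [sg [dg [sg' _]]] := nG n 1%N.
have [_ H] := frechet_derivativeP _ _ sg sg'.
exact: (H dg).
Qed.

Lemma ntimes_pathD n g h : ntimes_path n g -> ntimes_path n h ->
  ntimes_path n (fun t => g t + h t).
Proof.
elim: n g h => [|n IH] g h [sg Hg] [sh Hh]; split.
- by move=> t; exact: CsmoothD (sg t) (sh t).
- by [].
- by move=> t; exact: CsmoothD (sg t) (sh t).
have [dg ng] := Hg; have [dh nh] := Hh.
have d := path_derivativeD _ _ _ _ sg (ntimes_path_Csmooth _ _ ng) sh
  (ntimes_path_Csmooth _ _ nh) dg dh.
by rewrite (path_derivative_velocity d); split=> //; exact: IH.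
Qed.

Lemma ntimes_pathM n a g : smooth a -> ntimes_path n g ->
  ntimes_path n (fun t => a t *: g t).
Proof.
elim: n a g => [|n IH] a g sa [sg Hg]; split.
- by move=> t; exact: CsmoothZ (sg t).
- by [].
- by move=> t; exact: CsmoothZ (sg t).
have [dg ng] := Hg.
have d := path_derivativeM _ _ _ sa sg (ntimes_path_Csmooth _ _ ng) dg.
rewrite (path_derivative_velocity d); split=> //; apply: ntimes_pathD; last exact: IH.
apply: IH; first exact: smooth_derive1.
by apply: ntimes_pathW; split.
Qed.

Lemma ntimes_path_comp n phi g : smooth phi -> ntimes_path n g ->
  ntimes_path n (g \o phi).
Proof.
move=> sphi; elim: n g => [|n IH] g [sg Hg]; split.
- by move=> t; exact: sg.
- by [].
- by move=> t; exact: sg.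
have [dg ng] := Hg.
have d := path_derivative_comp _ _ _ sphi (ntimes_path_Csmooth _ _ ng) dg.
rewrite (path_derivative_velocity d); split=> //.
by apply: ntimes_pathM; [exact: smooth_derive1|exact: IH].
Qed.

Lemma ntimes_path_cst n (c : curve) : Csmooth c -> ntimes_path n (fun=> c).
Proof.
elim: n c => [|n IH] c sc; split=> //.
have d : path_derivative (fun=> c) (fun=> 0).
  move=> t k e e0; exists 1 => // s _ theta.
  rewrite (_ : (0 : curve) = (fun=> 0))// derive1n_cst subrr sub0r.
  rewrite (_ : (if k is 0%N then _ else _) = 0) ?scaler0 ?oppr0 ?normr0; last by case: k.
  by rewrite mulr_ge0// ltW.
by rewrite (path_derivative_velocity d); split=> //; apply: IH; exact: Csmooth0.
Qed.

Lemma smooth_pathD g h : smooth_path g -> smooth_path h ->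
  smooth_path (fun t => g t + h t).
Proof.
move=> /smooth_pathP sg /smooth_pathP sh; apply/smooth_pathP => n.
exact: ntimes_pathD.
Qed.

Lemma smooth_path_comp phi g : smooth phi -> smooth_path g -> smooth_path (g \o phi).
Proof. by move=> sa /smooth_pathP sg; apply/smooth_pathP => n; exact: ntimes_path_comp. Qed.

Lemma smooth_path_cst (c : curve) : Csmooth c -> smooth_path (fun=> c).
Proof. by move=> sc; apply/smooth_pathP => n; exact: ntimes_path_cst. Qed.

Lemma smooth_path_Csmooth g : smooth_path g -> forall t, Csmooth (g t).
Proof. by move=> /smooth_pathP/(_ 0%N)[]. Qed.

Lemma smooth_path_velocity g : smooth_path g -> smooth_path (velocity g).
Proof. by move=> /smooth_pathP sg; apply/smooth_pathP => n; have [_ []] := sg n.+1. Qed.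

Lemma smooth_path_derivative g : smooth_path g -> path_derivative g (velocity g).
Proof. by move=> /smooth_pathP/(_ 1%N)[_ []]. Qed.

Lemma velocityD g h : smooth_path g -> smooth_path h ->
  velocity (fun t => g t + h t) = fun t => velocity g t + velocity h t.
Proof.
move=> sg sh; apply: path_derivative_velocity; apply: path_derivativeD;
 by [exact: smooth_path_Csmooth|apply: smooth_path_Csmooth; exact: smooth_path_velocity|
     exact: smooth_path_derivative].
Qed.

Lemma velocity_comp phi g : smooth phi -> smooth_path g ->
  velocity (g \o phi) = fun t => derive1 phi t *: velocity g (phi t).
Proof.
move=> sphi sg; apply: path_derivative_velocity; apply: path_derivative_comp => //.
  by apply: smooth_path_Csmooth; exact: smooth_path_velocity.
exact: smooth_path_derivative.
Qed.

Lemma velocity_cst (c : curve) : velocity (fun=> c) = fun=> 0.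
Proof.
by apply/funext => t; apply/funext => theta; rewrite /velocity derive1_cst.
Qed.

(** By the reverse triangle inequality the increment of [p] is at most [p] of the increment of the
    path; the remainder of the latter is small in the [k]-th seminorm, which dominates [p]. With [w]
    the initial curve, [p] measures a displacement. *)
Lemma path_dini g (p : curve -> R) (k : nat) (C : R) (w : curve) :
  smooth_path g -> Csmooth w -> 0 <= C ->
  (forall f f', Csmooth f -> Csmooth f' -> p (f + f') <= p f + p f') ->
  (forall (a : R) f, Csmooth f -> p (a *: f) = `|a| * p f) ->
  (forall f M, Csmooth f -> 0 <= M -> (forall theta, `|derive1n k f theta| <= M) ->
     p f <= C * M) ->
  forall t, dini (fun t => p (g t - w)) t (p (velocity g t)).
Proof.
move=> sg sw C0 pD pZ pC t e e0.
have C1 : 0 < C + 1 by lra.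
have e1 : 0 < e / (C + 1) by rewrite divr_gt0.
have [r r0 Hr] := smooth_path_derivative _ sg t k _ e1.
exists r => // s sr; have {}Hr := Hr s sr.
have st := smooth_path_Csmooth _ sg t; have sts := smooth_path_Csmooth _ sg (t + s).
have sv := smooth_path_Csmooth _ (smooth_path_velocity _ sg) t.
have pN f : Csmooth f -> p (- f) = p f.
  by move=> sf; rewrite -scaleN1r pZ// normrN1 mul1r.
have pB f f' : Csmooth f -> Csmooth f' -> `|p f - p f'| <= p (f - f').
  move=> sf sh; have sfh := CsmoothB _ _ sf sh.
  have h1 := pD _ _ sfh sh; have h2 := pD _ _ (CsmoothB _ _ sh sf) sf.
  rewrite !subrK in h1 h2; rewrite -(pN _ (CsmoothB _ _ sh sf)) opprB in h2.
  by rewrite ler_norml; apply/andP; split; lra.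
apply: le_trans (pB _ _ (CsmoothB _ _ sts sw) (CsmoothB _ _ st sw)) _.
rewrite (_ : _ - _ = (g (t + s) - g t - s *: velocity g t) + s *: velocity g t); last first.
  by rewrite subrK opprB addrA subrK.
have sd := CsmoothB _ _ (CsmoothB _ _ sts st) (CsmoothZ s _ sv).
apply: le_trans (pD _ _ sd (CsmoothZ s _ sv)) _.
rewrite pZ// addrC mulrDr lerD2l.
have : p (g (t + s) - g t - s *: velocity g t) <= C * (e / (C + 1) * `|s|).
  apply: pC => //; first by rewrite mulr_ge0// ltW.
  move=> theta; have := Hr theta.
  have [s1 _] := sts; have [s2 _] := st; have [s3 _] := sv.
  rewrite (derive1nB k _ _ (smooth_curveB _ _ s1 s2) (smooth_curveZ s _ s3)).
  by rewrite (derive1nB k _ _ s1 s2) (derive1nZ k _ _ s3) !fctE.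
move=> /le_trans; apply; rewrite mulrA mulrC ler_wpM2l//.
by rewrite mulrCA; apply: ler_piMr; [exact: ltW|rewrite ler_pdivrMr//; lra].
Qed.

End SmoothPaths.

(** * Expansion of parameter derivatives in arc length derivatives *)

Section ArcLengthExpansion.
Context {R : realType}.
Local Notation V := 'rV[R]_2.
Local Notation curve := (R -> V).
Implicit Types (Q : curve -> R -> R) (c h : curve).

(* The functions of the jet of [c] that occur when [d_theta^n h] is expanded in the [D_s^i h]. *)
Inductive coefficient (m : nat) : (curve -> R -> R) -> Prop :=
| coefficient_cst a : coefficient m (fun _ _ => a)
| coefficient_derive1n j i : (0 < j <= m)%N ->
    coefficient m (fun c x => derive1n j c x 0 i)
| coefficient_inv : coefficient m (fun c x => (enorm (derive1 c x))^-1)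
| coefficientD Q1 Q2 : coefficient m Q1 -> coefficient m Q2 ->
    coefficient m (fun c x => Q1 c x + Q2 c x)
| coefficientM Q1 Q2 : coefficient m Q1 -> coefficient m Q2 ->
    coefficient m (fun c x => Q1 c x * Q2 c x)
| coefficient_eq Q1 Q2 : coefficient m Q1 ->
    (forall c, Imm c -> Q1 c = Q2 c) -> coefficient m Q2.

Lemma coefficientW m m' Q : (m <= m')%N -> coefficient m Q -> coefficient m' Q.
Proof.
move=> mm'; elim=> {Q} [a|j i /andP[j0 jm]||||].
- exact: coefficient_cst.
- by apply: coefficient_derive1n; rewrite j0 (leq_trans jm).
- exact: coefficient_inv.
- by move=> Q1 Q2 _ H1 _ H2; exact: coefficientD.
- by move=> Q1 Q2 _ H1 _ H2; exact: coefficientM.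
- by move=> Q1 Q2 _ H1 E; exact: coefficient_eq H1 E.
Qed.

(** Starts at order 1: the coefficients do not change when the curve is translated. *)
Definition jet_bounded (m : nat) (K : R) c (x : R) : Prop :=
  (enorm (derive1 c x))^-1 <= K /\
  forall j, (0 < j <= m)%N -> enorm (derive1n j c x) <= K.

Lemma coefficient_bounded m Q (K : R) : coefficient m Q ->
  exists2 C : R, 0 <= C & forall c x, Imm c -> jet_bounded m K c x -> `|Q c x| <= C.
Proof.
elim=> {Q} [a|j i jm||Q1 Q2 _ [C1 C10 H1] _ [C2 C20 H2]|
  Q1 Q2 _ [C1 C10 H1] _ [C2 C20 H2]|Q1 Q2 _ [C1 C10 H1] E].
- by exists `|a|.
- exists `|K| => // c x _ [_ /(_ j jm) cK].
  by rewrite (le_trans (coord_le_enorm _ _))// (le_trans cK)// ler_norm.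
- exists `|K| => // c x _ [cK _].
  by rewrite ger0_norm ?invr_ge0 ?enorm_ge0// (le_trans cK)// ler_norm.
- exists (C1 + C2) => [|c x ic cK]; first exact: addr_ge0.
  by rewrite (le_trans (ler_normD _ _))// lerD ?H1 ?H2.
- exists (C1 * C2) => [|c x ic cK]; first exact: mulr_ge0.
  by rewrite normrM ler_pM ?H1 ?H2.
- by exists C1 => // c x ic cK; rewrite -E// H1.
Qed.

(* Affine in the top derivative, which Gronwall's lemma can therefore bound along a path. *)
Definition affine_top (m : nat) Q Q0 Q1 B : Prop := forall c x, Imm c ->
  Q c x = Q0 c x * derive1n m.+1 c x 0 0 + Q1 c x * derive1n m.+1 c x 0 1 + B c x.

(** A derivative of order [m + 1] arises only from a generator of order [m], or from [1 / |c'|] when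
    [m = 1], and it arises linearly; sums and the product rule keep this form. *)
Lemma coefficient_derivable m Q : (0 < m)%N -> coefficient m Q ->
  (forall c, Imm c -> forall x : R, derivable (Q c) x 1) /\
  exists Q0 Q1 B, [/\ coefficient m Q0, coefficient m Q1, coefficient m B &
    affine_top m (fun c => derive1 (Q c)) Q0 Q1 B].
Proof.
move=> m0; have c0 := coefficient_cst m 0.
elim=> {Q} [a|j i /andP[j0 jm]||Q1 Q2 cQ1 [d1 [A1 [B1 [D1 [cA1 cB1 cD1 E1]]]]]
    cQ2 [d2 [A2 [B2 [D2 [cA2 cB2 cD2 E2]]]]]|
    Q1 Q2 cQ1 [d1 [A1 [B1 [D1 [cA1 cB1 cD1 E1]]]]]
    cQ2 [d2 [A2 [B2 [D2 [cA2 cB2 cD2 E2]]]]]|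
    Q1 Q2 cQ1 [d1 [A1 [B1 [D1 [cA1 cB1 cD1 E1]]]]] EQ].
- split=> [c _ x|]; first exact: derivable_cst.
  exists (fun _ _ => 0), (fun _ _ => 0), (fun _ _ => 0); split=> // c x _.
  by rewrite derive1_cst !mul0r !addr0.
- have dj c : Imm c -> forall x : R, is_derive x 1 (fun y => derive1n j c y 0 i)
      (derive1n j.+1 c x 0 i).
    move=> [[sc _] _] x; apply: is_derive_coord.
    exact: smooth_is_derive (smooth_derive1n j sc) x.
  split=> [c ic x|]; first by case: (dj c ic x).
  have [jm'|jm'] := ltnP j m.
    exists (fun _ _ => 0), (fun _ _ => 0), (fun c x => derive1n j.+1 c x 0 i); split=> //.
      exact: coefficient_derive1n.
    by move=> c x ic; rewrite (derive1_eq (dj c ic x)) !mul0r !add0r.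
  have {jm jm'} jE : j = m by apply/eqP; rewrite eqn_leq jm.
  exists (fun _ _ => (i == 0)%:R), (fun _ _ => (i == 1)%:R), (fun _ _ => 0); split=> //.
  + exact: coefficient_cst.
  + exact: coefficient_cst.
  move=> c x ic; rewrite (derive1_eq (dj c ic x)) jE addr0.
  have [/eqP->|/eqP->] : i == 0 \/ i == 1 by case: i {dj} => -[|[|[]]]//; [left|right].
  + by rewrite mul1r mul0r addr0.
  + by rewrite mul0r mul1r add0r.
- have di c : Imm c -> forall x : R, is_derive x 1 (fun y => (enorm (derive1 c y))^-1)
      (- ((enorm (derive1 c x))^-1 ^+ 3 * dot (derive1 c x) (derive1n 2 c x))).
    move=> [[sc _] c'0] x.
    exact: is_derive_inv_enorm (c'0 x) (smooth_is_derive (smooth_derive1 sc) x).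
  split=> [c ic x|]; first by case: (di c ic x).
  pose b c x := (enorm (derive1 c x))^-1.
  have cb : coefficient m b by exact: coefficient_inv.
  pose E i c x := -1 * (b c x * (b c x * b c x)) * derive1n 1 c x 0 i.
  have cE i : coefficient m (E i).
    apply: coefficientM; last by exact: coefficient_derive1n.
    apply: coefficientM; first exact: coefficient_cst.
    by do 2 apply: coefficientM => //.
  have [m1|m1] := ltnP 1 m.
    exists (fun _ _ => 0), (fun _ _ => 0), (fun c x => E 0 c x * derive1n 2 c x 0 0 +
      E 1 c x * derive1n 2 c x 0 1); split=> //.
      by apply: coefficientD; apply: coefficientM => //; exact: coefficient_derive1n.
    move=> c x ic; rewrite (derive1_eq (di c ic x)) !mul0r !add0r dotE /E /b.
    by rewrite derive1n1; move: (derive1n 2 c x) ((enorm _)^-1) => u b'; ring.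
  have mE : m = 1%N by apply/eqP; rewrite eqn_leq m1.
  exists (E 0), (E 1), (fun _ _ => 0); split=> //.
  move=> c x ic; rewrite (derive1_eq (di c ic x)) mE addr0 dotE /E /b derive1n1.
  move: (derive1n 2 c x) ((enorm _)^-1) => u b'; ring.
- split=> [c ic x|]; first exact: derivableD (d1 c ic x) (d2 c ic x).
  exists (fun c x => A1 c x + A2 c x), (fun c x => B1 c x + B2 c x),
    (fun c x => D1 c x + D2 c x); split; try exact: coefficientD.
  move=> c x ic; have := is_deriveD (derivable_is_derive (d1 c ic x))
    (derivable_is_derive (d2 c ic x)) => /derive1_eq ->.
  by rewrite E1// E2//; ring.
- split=> [c ic x|]; first exact: derivableM (d1 c ic x) (d2 c ic x).
  exists (fun c x => Q1 c x * A2 c x + Q2 c x * A1 c x),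
    (fun c x => Q1 c x * B2 c x + Q2 c x * B1 c x),
    (fun c x => Q1 c x * D2 c x + Q2 c x * D1 c x);
    split; try by apply: coefficientD; exact: coefficientM.
  move=> c x ic; have := is_deriveM (derivable_is_derive (d1 c ic x))
    (derivable_is_derive (d2 c ic x)) => /derive1_eq ->.
  by rewrite /GRing.scale/= E1// E2//; ring.
- split=> [c ic x|]; first by rewrite -EQ//; exact: d1.
  exists A1, B1, D1; split=> // c x ic; rewrite -EQ//; exact: E1.
Qed.

Lemma coefficient_affine_top m Q Q0 Q1 B : coefficient m Q0 -> coefficient m Q1 ->
  coefficient m B -> affine_top m Q Q0 Q1 B -> coefficient m.+1 Q.
Proof.
move=> c0 c1 cB E.
have W Q' : coefficient m Q' -> coefficient m.+1 Q' by apply: coefficientW.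
apply: (coefficient_eq _ (fun c x => Q0 c x * derive1n m.+1 c x 0 0 +
   Q1 c x * derive1n m.+1 c x 0 1 + B c x)); last first.
  by move=> c ic; apply/funext => x; rewrite E.
apply: coefficientD; last exact: W.
by apply: coefficientD; apply: coefficientM; try exact: W;
   apply: coefficient_derive1n; rewrite /= leqnn.
Qed.

Lemma coefficient_derive1 m Q : (0 < m)%N -> coefficient m Q ->
  coefficient m.+1 (fun c => derive1 (Q c)).
Proof.
move=> m0 cQ; have [_ [Q0 [Q1 [B [c0 c1 cB E]]]]] := coefficient_derivable m Q m0 cQ.
exact: coefficient_affine_top c0 c1 cB E.
Qed.

Lemma coefficient_enorm m : (0 < m)%N -> coefficient m (fun c x => enorm (derive1 c x)).
Proof.
move=> m0; apply: (coefficient_eq _ (fun c x => (enorm (derive1 c x))^-1 *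
  (derive1n 1 c x 0 0 * derive1n 1 c x 0 0 + derive1n 1 c x 0 1 * derive1n 1 c x 0 1))).
  apply: coefficientM; first exact: coefficient_inv.
  by apply: coefficientD; apply: coefficientM; exact: coefficient_derive1n.
by move=> c [_ c'0]; apply/funext => x; rewrite [RHS]enorm_inv_enorm// dotE.
Qed.

Lemma derive1_Ds c f (x : R) : Imm c ->
  derive1 f x = enorm (derive1 c x) *: Ds c f x.
Proof.
by move=> [_ c'0]; rewrite /Ds scalerA mulfV ?scale1r// enorm_eq0.
Qed.

Definition arc_expansion (n : nat) (P : nat -> curve -> R -> R) : Prop :=
  forall c h x, Imm c -> Csmooth h ->
    derive1n n h x = \sum_(i < n) P i c x *: iter i.+1 (Ds c) h x.

(** The product rule with [d_theta = |c'| D_s]: the first summand differentiates the old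
    coefficient, the second raises the order of the arc length derivative. The zeros are the missing
    terms at [i = n] and [i = 0]. *)
Definition next_coefficient (n : nat) (P : nat -> curve -> R -> R) (i : nat) c x : R :=
  (if (i < n)%N then derive1 (P i c) x else 0) +
  (if i is j.+1 then enorm (derive1 c x) * P j c x else 0).

Lemma arc_expansionS n P : (0 < n)%N -> (forall i, (i < n)%N -> coefficient n (P i)) ->
  arc_expansion n P -> arc_expansion n.+1 (next_coefficient n P).
Proof.
move=> n0 cP EP c h x ic sh; rewrite derive1nS.
rewrite (_ : derive1n n h = \sum_(i < n) (fun y => P i c y *: iter i.+1 (Ds c) h y)); last first.
  by apply/funext => y; rewrite fct_sumE; exact: EP.
have dP (i : 'I_n) : is_derive x 1 (fun y => P i c y *: iter i.+1 (Ds c) h y)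
    (derive1 (P i c) x *: iter i.+1 (Ds c) h x +
     (enorm (derive1 c x) * P i c x) *: iter i.+2 (Ds c) h x).
  have [dPi _] := coefficient_derivable _ _ n0 (cP i (ltn_ord i)).
  have [sX _] := Csmooth_iter_Ds i.+1 c h ic sh.
  apply: is_derive_vec => j.
  rewrite (_ : (fun y => _) = (P i c) * (fun y => iter i.+1 (Ds c) h y 0 j)); last first.
    by apply/funext => y; rewrite mxE.
  have := is_deriveM (derivable_is_derive (dPi c ic x))
    (is_derive_coord (smooth_is_derive sX x) j) => D.
  apply: is_derive_eq D _; rewrite (derive1_Ds c (iter i.+1 (Ds c) h) x ic).
  rewrite -[Ds c (iter _ _ _)]/(iter i.+2 (Ds c) h).
  move: (derive1 (P i c) x) (P i c x) (enorm _) (iter i.+1 _ _ _) (iter i.+2 _ _ _).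
  by move=> p' p u v w; rewrite !mxE /GRing.scale/=; ring.
rewrite (derive1_eq (is_derive_sum (fun i => dP i))) big_split/=.
rewrite (eq_bigr (fun i : 'I_n.+1 =>
   (if (i < n)%N then derive1 (P i c) x else 0) *: iter i.+1 (Ds c) h x +
   (if (i : nat) is j.+1 then enorm (derive1 c x) * P j c x else 0) *:
     iter i.+1 (Ds c) h x)); last by move=> i _; rewrite -scalerDl.
rewrite big_split/=; congr (_ + _).
  rewrite big_ord_recr/= ltnn scale0r addr0; apply: eq_bigr => i _.
  by rewrite ltn_ord.
by rewrite big_ord_recl/= scale0r add0r.
Qed.

(** Only the coefficient of [D_s h] contains a derivative of [c] of order [k + 2], because it comes
    from differentiating [|c'|] at every step; any other term has spent at least one of the
    derivatives on raising the order of [D_s]. Its affine form is what makes Gronwall's lemma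
    applicable. *)
Lemma arc_expansion_exists k : exists P Q0 Q1 B,
  [/\ arc_expansion k.+2 P, forall i, (0 < i < k.+2)%N -> coefficient k.+1 (P i),
    affine_top k.+1 (P 0%N) Q0 Q1 B &
    [/\ coefficient k.+1 Q0, coefficient k.+1 Q1 & coefficient k.+1 B]].
Proof.
have step n P : (0 < n)%N -> coefficient n (P 0%N) ->
    (forall i, (0 < i < n)%N -> coefficient n.-1 (P i)) -> arc_expansion n P ->
    exists P' Q0 Q1 B,
    [/\ arc_expansion n.+1 P', forall i, (0 < i < n.+1)%N -> coefficient n (P' i),
      affine_top n (P' 0%N) Q0 Q1 B &
      [/\ coefficient n Q0, coefficient n Q1 & coefficient n B]].
  move=> n0 c0 cP EP.
  have cP' i : (i < n)%N -> coefficient n (P i).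
    case: i => [//|i] i_n; apply: coefficientW (cP i.+1 i_n); exact: leq_pred.
  have [_ [Q0 [Q1 [B [cQ0 cQ1 cB E]]]]] := coefficient_derivable n _ n0 c0.
  exists (next_coefficient n P), Q0, Q1, B; split=> //.
  - exact: arc_expansionS.
  - case=> [//|i] i_n; rewrite /next_coefficient; case i_n' : (i.+1 < n)%N; last first.
      apply: coefficientD; first exact: coefficient_cst.
      by apply: coefficientM; [exact: coefficient_enorm|exact: cP'].
    apply: (coefficientD _ (fun c => derive1 (P i.+1 c))); last first.
      by apply: coefficientM; [exact: coefficient_enorm|exact: cP'].
    rewrite -(prednK n0); apply: coefficient_derive1; last exact: cP.
    by rewrite -ltnS prednK// (leq_trans _ i_n').
  - by move=> c x ic; rewrite /next_coefficient n0 addr0; exact: E.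
elim: k => [|k [P [Q0 [Q1 [B [EP cP aP [c0 c1 cB]]]]]]].
  (* The recursion starts from [d_theta h = |c'| D_s h]. *)
  apply: (step 1%N (fun i c x => if i is 0%N then enorm (derive1 c x) else 0)) => //.
  - exact: coefficient_enorm.
  - by case=> [|[]].
  - move=> c h x ic sh; rewrite big_ord1; exact: derive1_Ds.
apply: (step k.+2 P) => //; exact: coefficient_affine_top c0 c1 cB aP.
Qed.

Lemma enorm_sum (I : finType) (F : I -> V) :
  enorm (\sum_i F i) <= \sum_i enorm (F i).
Proof.
elim/big_ind2 : _ => [|v a w b va wb|//]; first by rewrite enorm0.
by rewrite (le_trans (enormD _ _))// lerD.
Qed.

(** The slack [E] lets the same constant bound the remaining coefficients of the expansion. *)
Let affine_bound (q0 q1 b t0 t1 C0 C1 D E T : R) : `|q0| <= C0 -> `|q1| <= C1 ->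
  `|b| <= D -> `|t0| <= T -> `|t1| <= T -> 0 <= E ->
  `|q0 * t0 + q1 * t1 + b| <= (C0 + C1 + D + E) * (1 + T).
Proof.
move=> h0 h1 hb ht0 ht1 E0.
apply: le_trans (ler_normD _ _) _; apply: le_trans (lerD (ler_normD _ _) (lexx _)) _.
rewrite !normrM.
have g0 := ler_pM (normr_ge0 _) (normr_ge0 _) h0 ht0.
have g1 := ler_pM (normr_ge0 _) (normr_ge0 _) h1 ht1.
have T0 := le_trans (normr_ge0 _) ht0; have C00 := le_trans (normr_ge0 _) h0.
have C10 := le_trans (normr_ge0 _) h1; have D0 := le_trans (normr_ge0 _) hb.
have := mulr_ge0 D0 T0; have := mulr_ge0 E0 T0.
rewrite mulrDr mulr1 !mulrDl; lra.
Qed.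

Lemma derive1n_le_arc (k : nat) (K : R) : exists2 C : R, 0 <= C &
  forall c h x, Imm c -> Csmooth h -> jet_bounded k.+1 K c x ->
    enorm (derive1n k.+2 h x) <=
      C * ((1 + enorm (derive1n k.+2 c x)) * enorm (Ds c h x) +
           \sum_(i < k.+1) enorm (iter i.+2 (Ds c) h x)).
Proof.
have [P [Q0 [Q1 [B [EP cP aP [c0 c1 cB]]]]]] := arc_expansion_exists k.
have [C0 C00 H0] := coefficient_bounded _ _ K c0.
have [C1 C10 H1] := coefficient_bounded _ _ K c1.
have [D D0 HD] := coefficient_bounded _ _ K cB.
have /boolp.choice [E HE] : forall i : 'I_k.+1, exists r : R, 0 <= r /\
    forall c x, Imm c -> jet_bounded k.+1 K c x -> `|P i.+1 c x| <= r.
  by move=> i; have [r r0 Hr] := coefficient_bounded _ _ K (cP i.+1 (ltn_ord i)); exists r.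
exists (C0 + C1 + D + \sum_i E i) => [|c h x ic sh cK].
  by rewrite !addr_ge0// sumr_ge0// => i _; have [] := HE i.
have sE0 : 0 <= \sum_i E i by apply: sumr_ge0 => i _; have [] := HE i.
have sX0 : 0 <= \sum_(i < k.+1) enorm (iter i.+2 (Ds c) h x).
  by apply: sumr_ge0 => i _; exact: enorm_ge0.
rewrite (EP c h x ic sh) big_ord_recl; apply: le_trans (enormD _ _) _.
rewrite mulrDr; apply: lerD.
  rewrite enormZ mulrA; apply: ler_wpM2r; first exact: enorm_ge0.
  rewrite (aP c x ic).
  by apply: affine_bound; [exact: H0|exact: H1|exact: HD|exact: coord_le_enorm|
    exact: coord_le_enorm|exact: sE0].
apply: le_trans (enorm_sum _ _) _; rewrite mulr_sumr ler_sum// => i _.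
rewrite enormZ lift0; apply: ler_wpM2r; first exact: enorm_ge0.
have [_ Hi] := HE i; apply: le_trans (Hi c x ic cK) _; rewrite (bigD1 i)//=.
have : 0 <= \sum_(j | j != i) E j by apply: sumr_ge0 => j _; have [] := HE j.
lra.
Qed.

End ArcLengthExpansion.

(** * Sobolev inequalities with respect to arc length *)

Section ArcEstimates.
Context {R : realType}.
Local Notation V := 'rV[R]_2.
Local Notation curve := (R -> V).
Implicit Types (c h f : curve).

Lemma continuous_enorm f : (forall i, continuous (fun t => f t 0 i)) ->
  continuous (fun t => enorm (f t)).
Proof.
move=> cf t; rewrite /continuous_at.
apply: (@continuous_comp _ _ _ (fun t => dot (f t) (f t)) Num.sqrt); last exact: sqrt_continuous.
rewrite (_ : (fun t => _) = fun t => f t 0 0 * f t 0 0 + f t 0 1 * f t 0 1); last first.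
  by apply/funext => s; rewrite dotE.
by apply: (continuous_add _ _ _ _ t); apply: continuous_mul.
Qed.

Lemma smooth_continuous_enorm f : smooth f -> continuous (fun t => enorm (f t)).
Proof.
by move=> sf; apply: continuous_enorm => i; apply: smooth_continuous; exact: smooth_coord.
Qed.

Lemma weighted_CS (e a : R -> R) : continuous e -> continuous a ->
  (forall t, 0 <= a t) ->
  circle_int (fun t => e t * a t) ^+ 2 <=
    circle_int a * circle_int (fun t => e t ^+ 2 * a t).
Proof.
move=> ce ca a0; apply: quadratic_discriminant; first by apply: circle_int_ge0.
have cee : continuous (fun t => e t ^+ 2) by exact: continuous_mul.
have c1 := continuous_mul _ _ ce ca; have c2 := continuous_mul _ _ cee ca.
move=> x; rewrite (_ : _ + _ = circle_int (fun t => (x + e t) ^+ 2 * a t)).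
  by apply: circle_int_ge0 => t _; rewrite mulr_ge0// sqr_ge0.
rewrite (_ : (fun t => (x + e t) ^+ 2 * a t) =
    fun t => (x ^+ 2 * a t + (x *+ 2) * (e t * a t)) + e t ^+ 2 * a t); last first.
  by apply/funext => t; ring.
have d1 := continuous_mul _ _ (continuous_cst (x ^+ 2)) ca.
have d2 := continuous_mul _ _ (continuous_cst (x *+ 2)) c1.
rewrite circle_intD//; last exact: continuous_add.
rewrite circle_intD// !circle_intZ//; ring.
Qed.

Definition curve_length c : R := circle_int (fun t => enorm (derive1 c t)).

Lemma curve_length_ge0 c : 0 <= curve_length c.
Proof. by apply: circle_int_ge0 => t _; exact: enorm_ge0. Qed.

Lemma arc_int_le_sobolev l i c h : Imm c -> Csmooth h -> (i <= l)%N ->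
  arc_int c (fun t => dot (iter i (Ds c) h t) (iter i (Ds c) h t)) <=
    sobolev_metric l c h h.
Proof.
move=> ic sh il; have [[sc _] c'0] := ic.
have ca : continuous (fun t => enorm (derive1 c t)).
  exact: smooth_continuous_enorm (smooth_derive1 sc).
have cX j : continuous (fun t => dot (iter j (Ds c) h t) (iter j (Ds c) h t)).
  have [sX _] := Csmooth_iter_Ds j c h ic sh; exact: continuous_dot.
apply: le_circle_int.
- exact: continuous_mul.
- apply: continuous_mul => //.
  rewrite (_ : (fun t => _) =
    \sum_(j < l.+1) (fun t => dot (iter j (Ds c) h t) (iter j (Ds c) h t))).
    by elim/big_rec : _ => [|j f _ cf]; [exact: continuous_cst|exact: continuous_add].
  by apply/funext => t; rewrite fct_sumE.
move=> t _; rewrite ler_wpM2r ?enorm_ge0//.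
rewrite (bigD1 (inord i : 'I_l.+1))//= inordK// lerDl.
by apply: sumr_ge0 => j _; exact: dot_ge0.
Qed.

(** Each coordinate of [D_s^(i+1) h] vanishes somewhere, by Rolle's theorem for [D_s^i h]. It is
    thus at most its total variation, the arc length integral of a coordinate of [D_s^(i+2) h], to
    which Cauchy-Schwarz applies. The factor 2 counts the coordinates. *)
Lemma Ds_sup i c h (x : R) : Imm c -> Csmooth h ->
  enorm (iter i.+1 (Ds c) h x) <= 2 * Num.sqrt (curve_length c) *
   Num.sqrt (arc_int c (fun t => dot (iter i.+2 (Ds c) h t) (iter i.+2 (Ds c) h t))).
Proof.
move=> ic sh; have [[sc pc] c'0] := ic.
have sX j := Csmooth_iter_Ds j c h ic sh.
have ca : continuous (fun t => enorm (derive1 c t)).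
  exact: smooth_continuous_enorm (smooth_derive1 sc).
have [y y0 Hy] := periodic_rep x; have [s1 p1] := sX i.+1.
rewrite (Hy _ _ p1) {Hy}.
set A := arc_int _ _; suff H j : `|iter i.+1 (Ds c) h y 0 j| <=
    Num.sqrt (curve_length c) * Num.sqrt A.
  rewrite (le_trans (enorm_le_coords _))// -mulrA mulr_natl mulr2n lerD//; exact: H.
have [s0 p0] := sX i; have [s2 p2] := sX i.+2.
have [z z0 Hz] := circle_Rolle (fun t => iter i (Ds c) h t 0 j) (smooth_coord _ j s0)
  (fun t => congr1 (fun v : V => v 0 j) (p0 t)).
have wz : iter i.+1 (Ds c) h z 0 j = 0.
  by rewrite /= /Ds mxE derive1_coord ?Hz ?mulr0//; exact: smooth_derivable s0 z.
apply: (@le_trans _ _ `|iter i.+1 (Ds c) h y 0 j - iter i.+1 (Ds c) h z 0 j|).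
  have e (a b : R) : b = 0 -> `|a| <= `|a - b| by move=> ->; rewrite subr0.
  exact: e wz.
apply: le_trans (circle_osc (fun t => iter i.+1 (Ds c) h t 0 j) y z
  (smooth_coord _ j s1) y0 z0) _.
rewrite -sqrtrM ?curve_length_ge0//.
rewrite (_ : (fun t => _) = fun t => `|iter i.+2 (Ds c) h t 0 j| * enorm (derive1 c t)); last first.
  apply/funext => t; rewrite -derive1_coord; last exact: smooth_derivable s1 t.
  rewrite (derive1_Ds c _ t ic) mxE normrM mulrC; congr (_ * _).
  by rewrite ger0_norm ?enorm_ge0.
have ce : continuous (fun t => `|iter i.+2 (Ds c) h t 0 j|).
  by apply: continuous_norm; apply: smooth_continuous; exact: smooth_coord.
apply: le_trans (ler_norm _) _; rewrite -sqrtr_sqr ler_wsqrtr//.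
apply: le_trans (weighted_CS _ _ ce ca _) _ => [t|]; first exact: enorm_ge0.
rewrite ler_wpM2l ?curve_length_ge0//; apply: le_circle_int.
- apply: continuous_mul => //; exact: continuous_mul.
- by apply: continuous_mul => //; exact: continuous_dot.
move=> t _; rewrite ler_wpM2r ?enorm_ge0// -sqr_enorm.
by rewrite ler_pXn2r ?nnegrE ?enorm_ge0// coord_le_enorm.
Qed.

Lemma Ds_sup_sobolev l i c h (x s : R) : Imm c -> Csmooth h -> (0 < i < l)%N -> 0 <= s ->
  sobolev_metric l c h h <= s ^+ 2 ->
  enorm (iter i (Ds c) h x) <= 2 * Num.sqrt (curve_length c) * s.
Proof.
case: i => [//|i] ic sh il s0 hs; apply: le_trans (Ds_sup i c h x ic sh) _.
rewrite ler_wpM2l ?mulr_ge0 ?sqrtr_ge0// -[leRHS]ger0_norm// -sqrtr_sqr ler_wsqrtr//.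
by apply: le_trans hs; exact: arc_int_le_sobolev.
Qed.

(** The left-hand side is the arc length integral of [|D_s h|], hence at most [s] times the square
    root of the length of [c]. The weaker factor [1 + curve_length c] is the positive quantity to
    which Gronwall's lemma is applied. *)
Lemma length_velocity l c h (s : R) : Imm c -> Csmooth h -> (0 < l)%N -> 0 <= s ->
  sobolev_metric l c h h <= s ^+ 2 ->
  curve_length h <= (1 + curve_length c) * s.
Proof.
move=> ic sh l0 s0 hs; have [[sc pc] c'0] := ic.
have ca : continuous (fun t => enorm (derive1 c t)).
  exact: smooth_continuous_enorm (smooth_derive1 sc).
have [sX _] := Csmooth_iter_Ds 1 c h ic sh; have ce := smooth_continuous_enorm _ sX.
have L0 := curve_length_ge0 c.
have -> : curve_length h = circle_int (fun t => enorm (Ds c h t) * enorm (derive1 c t)).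
  apply: eq_circle_int => t _; rewrite (derive1_Ds c h t ic) enormZ mulrC.
  by rewrite ger0_norm ?enorm_ge0.
rewrite -(@ler_pXn2r _ 2)// ?nnegrE; first last.
- by rewrite mulr_ge0// addr_ge0.
- by apply: circle_int_ge0 => t _; rewrite mulr_ge0 ?enorm_ge0.
apply: le_trans (weighted_CS _ _ ce ca _) _ => [t|]; first exact: enorm_ge0.
rewrite (_ : (fun t => _ ^+ 2 * _) = fun t => dot (iter 1 (Ds c) h t) (iter 1 (Ds c) h t) *
    enorm (derive1 c t)); last by apply/funext => t; rewrite sqr_enorm.
have H := le_trans (arc_int_le_sobolev l 1 c h ic sh l0) hs.
apply: le_trans (ler_wpM2l L0 H) _.
rewrite exprMn ler_wpM2r ?sqr_ge0//; rewrite -/(curve_length c); nra.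
Qed.

(** A coordinate of [f] itself may have no zero. It is compared instead with its value where its
    modulus is least, which is at most the L2 norm because the circle has length at least 1. *)
Lemma Sobolev_sup f (M : R) : Csmooth f -> (forall x, enorm (derive1 f x) <= M) ->
  forall x, enorm (f x) <= 2 * (l2norm f + 2 * pi * M).
Proof.
move=> [sf pf] fM x; have [y y0 ->] := periodic_rep x; last exact: pf.
apply: le_trans (enorm_le_coords _) _.
suff H j : `|f y 0 j| <= l2norm f + 2 * pi * M.
  by rewrite mulr_natl mulr2n lerD.
have cfj := smooth_continuous _ (smooth_coord _ j sf).
have cn := continuous_norm _ cfj.
have [z zI Hz] := @EVT_min R (fun t => `|f t 0 j|) 0 (2 * pi) twopi_ge0 (continuous_subspaceT cn).
have z0 : 0 <= z <= 2 * pi by move: zI; rewrite in_itv.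
have cd' := smooth_continuous _ (smooth_coord _ j (smooth_derive1 sf)).
have dE : derive1 (fun t => f t 0 j) = fun t => derive1 f t 0 j.
  by apply/funext => t; rewrite derive1_coord//; exact: smooth_derivable sf t.
have osc : `|f y 0 j - f z 0 j| <= 2 * pi * M.
  apply: le_trans (circle_osc _ y z (smooth_coord _ j sf) y0 z0) _.
  rewrite dE mulrC -circle_int_cst; apply: le_circle_int.
  - exact: continuous_norm.
  - exact: continuous_cst.
  by move=> t _; exact: le_trans (coord_le_enorm _ _) (fM t).
have zl : `|f z 0 j| <= l2norm f.
  rewrite -(@ler_pXn2r _ 2)// ?nnegrE ?l2norm_ge0// sqr_l2norm.
  apply: (@le_trans _ _ (`|f z 0 j| ^+ 2 * (2 * pi))).
    rewrite ler_peMr ?sqr_ge0//; have := pi_ge2 R; lra.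
  rewrite -circle_int_cst; apply: le_circle_int.
  - exact: continuous_cst.
  - exact: continuous_dot.
  move=> t t0; rewrite -sqr_enorm ler_pXn2r ?nnegrE ?enorm_ge0//.
  apply: le_trans (coord_le_enorm _ j); apply: Hz; by rewrite in_itv.
have := ler_normD (f y 0 j - f z 0 j) (f z 0 j); rewrite subrK => /le_trans; apply.
by rewrite addrC lerD.
Qed.

End ArcEstimates.

(** * Uniform bounds along short paths *)

Section PathEstimates.
Context {R : realType}.
Local Notation V := 'rV[R]_2.
Local Notation curve := (R -> V).
Variable l : nat.
Hypothesis l2 : (2 <= l)%N.
Implicit Types (c h f : curve) (g : R -> curve) (S sigma : R -> R).

(** In dimension one an H^l bound is uniform for the derivatives of order below [l] but only L2 for
    the last one. A single [K] covers everything, so that later constants depend on [K] alone. *)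
Definition controlled (K : R) c : Prop :=
  [/\ Imm c, forall x, jet_bounded l.-1 K c x & l2norm (derive1n l c) <= K].

(* [sigma] plays the role of the speed of [g] for a metric dominating the Sobolev metric. *)
Definition rectified g S sigma : Prop :=
  [/\ smooth_path g, forall t, Imm (g t), forall t : R, is_derive t 1 S (sigma t),
    forall t, 0 <= sigma t &
    forall t, sobolev_metric l (g t) (velocity g t) (velocity g t) <= sigma t ^+ 2].

Definition short_path (K : R) g S sigma : Prop :=
  [/\ rectified g S sigma, controlled K (g 0) & S 1 - S 0 <= 1].

Lemma diniW (F : R -> R) (t q q' : R) : q <= q' -> dini F t q -> dini F t q'.
Proof.
move=> qq dF e e0; have [r r0 Hr] := dF e e0; exists r => // s sr.
by rewrite (le_trans (Hr s sr))// ler_wpM2l// lerD2r.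
Qed.

Lemma dini1D (F : R -> R) (t q : R) : dini F t q -> dini (fun t => 1 + F t) t q.
Proof.
move=> dF e e0; have [r r0 Hr] := dF e e0; exists r => // s sr.
by rewrite opprD addrACA subrr add0r Hr.
Qed.

Lemma rectified_ndecr g S sigma (a b : R) : rectified g S sigma -> a <= b -> S a <= S b.
Proof.
move=> [_ _ dS s0 _] ab; rewrite -subr_ge0.
have := dini_MVT (fun=> 0) S sigma a b ab (fun t _ => dS t); rewrite subrr; apply.
move=> t _ e e0; exists 1 => // s _; rewrite subrr normr0 mulr_ge0//.
by rewrite addr_ge0// ltW.
Qed.

Lemma short_gronwall (F : R -> R) K g S sigma : 0 <= K ->
  rectified g S sigma -> S 1 - S 0 <= 1 ->
  (forall t, 0 <= t <= 1 -> 0 < F t) ->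
  (forall t, 0 <= t <= 1 -> dini F t (K * F t * sigma t)) ->
  forall t, 0 <= t <= 1 -> F t <= F 0 * expR K /\ F 0 <= F t * expR K.
Proof.
move=> K0 rg S1 F0 dF t /andP[t0 t1]; have [_ _ dS s0 _] := rg.
have st (s : R) : 0 <= s <= t -> 0 <= s <= 1.
  by move=> /andP[-> st]; exact: le_trans t1.
have [h1 h2] := dini_gronwall F S sigma K 0 t t0 K0 (fun s hs => F0 s (st s hs))
  (fun s _ => s0 s) (fun s _ => dS s) (fun s hs => dF s (st s hs)).
have Ht : expR (K * (S t - S 0)) <= expR K.
  rewrite ler_expR ler_piMr//; apply: le_trans S1; rewrite lerD2r.
  exact: rectified_ndecr rg t1.
split.
  by apply: le_trans h1 _; rewrite ler_wpM2l// ltW// F0// lexx ler01.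
by apply: le_trans h2 _; rewrite ler_wpM2l// ltW// F0// t0.
Qed.

Lemma dini_seminorm g (p : curve -> R) (k : nat) (C : R) :
  smooth_path g -> 0 <= C ->
  (forall f f', Csmooth f -> Csmooth f' -> p (f + f') <= p f + p f') ->
  (forall (a : R) f, Csmooth f -> p (a *: f) = `|a| * p f) ->
  (forall f M, Csmooth f -> 0 <= M -> (forall x, `|derive1n k f x| <= M) ->
     p f <= C * M) ->
  forall t, dini (fun t => p (g t)) t (p (velocity g t)).
Proof.
move=> sg C0 pD pZ pC t.
have := path_dini g p k C 0 sg Csmooth0 C0 pD pZ pC t.
by rewrite (_ : (fun t => p (g t - 0)) = fun t => p (g t))//; apply/funext => s; rewrite subr0.
Qed.

Lemma curve_lengthD f f' : Csmooth f -> Csmooth f' ->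
  curve_length (f + f') <= curve_length f + curve_length f'.
Proof.
move=> [sf _] [sf' _].
have c1 := smooth_continuous_enorm _ (smooth_derive1 sf).
have c2 := smooth_continuous_enorm _ (smooth_derive1 sf').
have c3 := smooth_continuous_enorm _ (smooth_derive1 (smooth_curveD _ _ sf sf')).
rewrite /curve_length -(circle_intD _ _ c1 c2); apply: le_circle_int.
- exact: c3.
- exact: continuous_add.
by move=> t _; rewrite -derive1n1 (derive1nD 1 _ _ sf sf'); exact: enormD.
Qed.

Lemma curve_lengthZ (a : R) f : Csmooth f ->
  curve_length (a *: f) = `|a| * curve_length f.
Proof.
move=> [sf _]; rewrite /curve_length -circle_intZ; last first.
  exact: smooth_continuous_enorm (smooth_derive1 sf).
by apply: eq_circle_int => t _; rewrite -derive1n1 (derive1nZ 1 _ _ sf) enormZ.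
Qed.

Lemma curve_length_le f (M : R) : Csmooth f -> 0 <= M ->
  (forall x, enorm (derive1 f x) <= M) -> curve_length f <= M * (2 * pi).
Proof.
move=> [sf _] M0 fM; rewrite -circle_int_cst; apply: le_circle_int.
- exact: smooth_continuous_enorm (smooth_derive1 sf).
- exact: continuous_cst.
- by move=> t _; exact: fM.
Qed.

Lemma short_path_Ds (K : R) : exists2 K1 : R, 0 <= K1 &
  forall g S sigma, short_path K g S sigma -> forall t, 0 <= t <= 1 ->
  forall i x, (0 < i < l)%N ->
    enorm (iter i (Ds (g t)) (velocity g t) x) <= K1 * sigma t.
Proof.
have l0 : (0 < l)%N by exact: ltnW.
(* Gronwall's bound for [1 + curve_length (g t)]: the rate is [sigma], and the initial length is at
   most [2 pi |K|]. *)
pose B := (1 + `|K| * (2 * pi)) * expR 1.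
exists (2 * Num.sqrt B) => [|g S sigma [rg [_ jK _] S1] t t01 i x il].
  by rewrite mulr_ge0// sqrtr_ge0.
have [sg ig dS s0 hs] := rg.
have sv := smooth_path_Csmooth _ (smooth_path_velocity _ sg).
have L : curve_length (g t) <= B.
  have dF s : dini (fun t => 1 + curve_length (g t)) s
      (1 * (1 + curve_length (g s)) * sigma s).
    rewrite mul1r; apply: diniW (length_velocity l _ _ _ (ig s) (sv s) l0 (s0 s) (hs s)) _.
    apply: dini1D; apply: (dini_seminorm g curve_length 1 (2 * (2 * pi)) sg).
    - by rewrite mulr_ge0// twopi_ge0.
    - exact: curve_lengthD.
    - exact: curve_lengthZ.
    - move=> f M sf M0 fM; rewrite mulrAC; apply: curve_length_le => //.
        by rewrite mulr_ge0.
      by move=> y; apply: le_trans (enorm_le_norm _) _; rewrite ler_pM2l//; exact: fM.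
  have F0 s : 0 <= s <= 1 -> 0 < 1 + curve_length (g s).
    by move=> _; rewrite ltr_wpDr// curve_length_ge0.
  have [H _] := short_gronwall _ 1 g S sigma ler01 rg S1 F0 (fun s _ => dF s) t t01.
  have : curve_length (g 0) <= `|K| * (2 * pi).
    apply: curve_length_le; [exact: smooth_path_Csmooth|exact: normr_ge0|].
    move=> y; have [_ /(_ 1%N)] := jK y; rewrite derive1n1 => cK.
    apply: le_trans (ler_norm K); apply: cK.
    by rewrite /= -ltnS prednK.
  move=> h; apply: (@le_trans _ _ (1 + curve_length (g t))); first by rewrite lerDr.
  by apply: le_trans H _; rewrite ler_wpM2r ?expR_ge0// lerD2l.
apply: le_trans (Ds_sup_sobolev l i _ _ x _ (ig t) (sv t) il (s0 t) (hs t)) _.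
by rewrite ler_wpM2r// ler_pM2l// ler_wsqrtr.
Qed.

Lemma dini_enorm_derive1n g k (x : R) : smooth_path g -> forall t,
  dini (fun t => enorm (derive1n k (g t) x)) t (enorm (derive1n k (velocity g t) x)).
Proof.
move=> sg t; apply: (dini_seminorm g (fun f => enorm (derive1n k f x)) k 2 sg).
- by [].
- by move=> f f' [sf _] [sf' _]; rewrite (derive1nD k _ _ sf sf'); exact: enormD.
- by move=> a f [sf _]; rewrite (derive1nZ k _ _ sf) enormZ.
- by move=> f M _ _ fM; rewrite (le_trans (enorm_le_norm _))// ler_pM2l.
Qed.

Lemma jet_boundedW m n (K K' : R) c x : (m <= n)%N -> K <= K' ->
  jet_bounded n K c x -> jet_bounded m K' c x.
Proof.
move=> mn KK [h1 h2]; split; first exact: le_trans KK.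
move=> j /andP[j0 jm]; apply: le_trans KK; apply: h2.
by rewrite j0 (leq_trans jm).
Qed.

Let le_invM (a b e : R) : 0 < a -> 0 < b -> b <= a * e -> a^-1 <= b^-1 * e.
Proof.
by move=> a0 b0 H; rewrite -[leLHS]mul1r ler_pdivrMr// -mulrA ler_pdivlMl// mulr1 mulrC.
Qed.

(** Both halves of Gronwall's conclusion serve here: one bounds [|c'|], the other its inverse. *)
Lemma short_path_jet1 (K : R) : exists2 K1 : R, 0 <= K1 &
  forall g S sigma, short_path K g S sigma -> forall t, 0 <= t <= 1 ->
  forall x, jet_bounded 1 K1 (g t) x.
Proof.
have [C C0 HC] := short_path_Ds K.
exists (`|K| * expR C) => [|g S sigma sp t t01 x]; first by rewrite mulr_ge0// expR_ge0.
have [rg [_ jK _] S1] := sp; have [sg ig dS s0 hs] := rg.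
pose F t := enorm (derive1n 1 (g t) x).
have F0 s : 0 < F s by rewrite enorm_gt0 derive1n1; have [_] := ig s; exact.
have dF s : 0 <= s <= 1 -> dini F s (C * F s * sigma s).
  move=> s01; apply: diniW (dini_enorm_derive1n g 1 x sg s).
  rewrite derive1n1 (derive1_Ds _ _ _ (ig s)) enormZ ger0_norm ?enorm_ge0//.
  rewrite mulrAC mulrC ler_wpM2r ?enorm_ge0//.
  by apply: (HC _ _ _ sp s s01 1%N x).
have [h1 h2] := short_gronwall F C g S sigma C0 rg S1 (fun s _ => F0 s) dF t t01.
have [b0 /(_ 1%N)] := jK x; rewrite /= -ltnS (prednK (ltnW l2)) => /(_ l2) a0.
split; last first.
  move=> j /andP[j0 j1]; have -> : j = 1%N by apply/eqP; rewrite eqn_leq j1.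
  by apply: le_trans h1 _; rewrite ler_wpM2r ?expR_ge0// (le_trans a0)// ler_norm.
have F0' := F0 0; have Ft' := F0 t; have e0 := expR_gt0 C.
apply: (@le_trans _ _ ((F 0)^-1 * expR C)).
  exact: le_invM Ft' F0' h2.
by rewrite ler_wpM2r ?expR_ge0// (le_trans b0)// ler_norm.
Qed.

Let arc_sum_bound (C K1 T s : R) n : 0 <= C -> 0 <= K1 * s -> 0 <= T ->
  C * ((1 + T) * (K1 * s) + (K1 * s) *+ n) <= C * (K1 + K1 *+ n) * (1 + T) * s.
Proof.
move=> C0 s0 T0; rewrite -!mulrA ler_wpM2l//.
have -> : (K1 + K1 *+ n) * ((1 + T) * s) = (1 + T) * (K1 * s) + (K1 * s) *+ n * (1 + T).
  by rewrite -(mulr_natl K1) -(mulr_natl (K1 * s)); ring.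
by rewrite lerD2l ler_peMr ?mulrn_wge0// lerDl.
Qed.

(** Since [k + 1 < l], all the [D_s^i h] of the expansion are bounded pointwise, and so is its
    left-hand side. At order [l] an estimate survives only in L2, see [l2_bound_derive1n]. *)
Lemma Ds_bound_derive1n (k : nat) (K K1 : R) : (0 < k)%N -> (k.+1 < l)%N -> 0 <= K1 ->
  exists2 C : R, 0 <= C &
  forall c h (x s : R), Imm c -> Csmooth h -> jet_bounded k K c x ->
    (forall i x, (0 < i < l)%N -> enorm (iter i (Ds c) h x) <= K1 * s) ->
    enorm (derive1n k.+1 h x) <= C * (1 + enorm (derive1n k.+1 c x)) * s.
Proof.
case: k => [//|k] _ kl K10; have [C C0 HC] := derive1n_le_arc k K.
exists (C * (K1 + K1 *+ k.+1)) => [|c h x s ic sh jK hX].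
  by apply: mulr_ge0 C0 _; apply: (addr_ge0 K10); rewrite mulrn_wge0.
apply: le_trans (HC c h x ic sh jK) _.
have T0 := enorm_ge0 (derive1n k.+2 c x).
have h1 : enorm (Ds c h x) <= K1 * s by apply: (hX 1%N x).
have s0 : 0 <= K1 * s by exact: le_trans (enorm_ge0 _) h1.
have h2 : \sum_(i < k.+1) enorm (iter i.+2 (Ds c) h x) <= (K1 * s) *+ k.+1.
  rewrite -[X in _ <= _ *+ X]card_ord -sumr_const; apply: ler_sum => i _.
  by apply: hX; apply: leq_trans kl; exact: (ltn_ord i).
apply: le_trans (arc_sum_bound _ _ _ _ k.+1 C0 s0 T0).
apply: ler_wpM2l => //; apply: lerD h2; apply: ler_wpM2l h1.
by rewrite addr_ge0.
Qed.

Lemma short_path_jet (K : R) : exists2 K1 : R, 0 <= K1 &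
  forall g S sigma, short_path K g S sigma -> forall t, 0 <= t <= 1 ->
  forall x, jet_bounded l.-1 K1 (g t) x.
Proof.
have [K1 K10 HK1] := short_path_Ds K.
suff H k : (k.+1 < l)%N -> exists2 B : R, 0 <= B &
    forall g S sigma, short_path K g S sigma -> forall t, 0 <= t <= 1 ->
    forall x, jet_bounded k.+1 B (g t) x.
  have := H l.-2; case: l l2 => [//|[//|m]] _ /=; apply; exact: leqnn.
elim: k => [_|k IH kl]; first exact: short_path_jet1.
have [B B0 HB] := IH (ltnW kl).
have [C C0 HC] := Ds_bound_derive1n k.+1 B K1 isT kl K10.
exists (B + (1 + `|K|) * expR C) => [|g S sigma sp t t01 x].
  by rewrite addr_ge0// mulr_ge0 ?expR_ge0// addr_ge0.
have [rg [_ jK _] S1] := sp; have [sg ig dS s0 hs] := rg.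
have sv := smooth_path_Csmooth _ (smooth_path_velocity _ sg).
have E0 : 0 <= (1 + `|K|) * expR C by rewrite mulr_ge0 ?expR_ge0// addr_ge0.
have [b1 b2] := HB g S sigma sp t t01 x.
split; first by rewrite (le_trans b1)// lerDl.
move=> j /andP[j0]; rewrite leq_eqVlt => /orP[/eqP ->|jk]; last first.
  by apply: (le_trans (b2 j _)); rewrite ?j0// lerDl.
(* [Ds_bound_derive1n] bounds the rate by [C F sigma] for this very [F]; the point [x] stays fixed
   while Gronwall's lemma runs in time. *)
pose F t := 1 + enorm (derive1n k.+2 (g t) x).
have F0 s : 0 < F s by rewrite ltr_wpDr// enorm_ge0.
have dF s : 0 <= s <= 1 -> dini F s (C * F s * sigma s).
  move=> s01; apply: dini1D; apply: diniW (dini_enorm_derive1n g k.+2 x sg s).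
  apply: (HC _ _ x (sigma s) (ig s) (sv s) (HB g S sigma sp s s01 x)).
  by move=> i y il; exact: (HK1 g S sigma sp s s01 i y il).
have [h1 _] := short_gronwall F C g S sigma C0 rg S1 (fun s _ => F0 s) dF t t01.
have [_ /(_ k.+2)] := jK x; rewrite /= -ltnS (prednK (ltnW l2)) => /(_ kl) a0.
have : F 0 * expR C <= (1 + `|K|) * expR C.
  by rewrite ler_wpM2r ?expR_ge0// lerD2l (le_trans a0)// ler_norm.
move=> h; apply: (@le_trans _ _ (F t)); first by rewrite /F lerDr ler01.
by apply: (le_trans h1); apply: (le_trans h); rewrite lerDr.
Qed.

End PathEstimates.

(** * From the length of a path to the H^l norm of its displacement *)

Section PathLipschitz.
Context {R : realType}.
Local Notation V := 'rV[R]_2.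
Local Notation curve := (R -> V).
Variable l : nat.
Hypothesis l2 : (2 <= l)%N.
Implicit Types (c h f : curve) (g : R -> curve) (S sigma : R -> R).

(** Passes from [d theta] to arc length through [1 <= K |c'|]. *)
Lemma sqr_l2norm_le_arc (K : R) c f : Imm c -> smooth f ->
  (forall x, (enorm (derive1 c x))^-1 <= K) ->
  l2norm f ^+ 2 <= K * arc_int c (fun t => dot (f t) (f t)).
Proof.
move=> ic sf cK; have [[sc _] c'0] := ic.
have ca := smooth_continuous_enorm _ (smooth_derive1 sc).
have cd := continuous_dot _ _ sf sf; have cda := continuous_mul _ _ cd ca.
rewrite sqr_l2norm /arc_int -(circle_intZ K _ cda).
apply: le_circle_int => //; first exact: continuous_mul (continuous_cst K) cda.
move=> t _; rewrite mulrCA ler_peMr ?dot_ge0//.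
by rewrite -ler_pdivrMr ?enorm_gt0// mul1r.
Qed.

Let sqr3 (u p q r : R) : 0 <= u -> u <= p + q + r ->
  u ^+ 2 <= 3 * (p ^+ 2 + q ^+ 2 + r ^+ 2).
Proof.
move=> u0 H; have : u ^+ 2 <= (p + q + r) ^+ 2.
  by rewrite ler_pXn2r// nnegrE// (le_trans u0).
have := sqr_ge0 (p - q); have := sqr_ge0 (q - r); have := sqr_ge0 (p - r); nra.
Qed.

Let l2_aux (A D s L W : R) : 0 <= L -> 0 <= W -> W <= D * s ^+ 2 -> 0 <= D ->
  3 * (A ^+ 2 * s ^+ 2 * (2 * pi) + A ^+ 2 * s ^+ 2 * L ^+ 2 + W) <=
  (3 * (A ^+ 2 * (2 * pi) + A ^+ 2 + D)) * ((1 + L) ^+ 2 * s ^+ 2).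
Proof.
move=> L0 W0 WD D0; rewrite -[leRHS]mulrA ler_pM2l//.
have As : 0 <= A ^+ 2 * s ^+ 2 by rewrite mulr_ge0 ?sqr_ge0.
have L1 : 1 <= (1 + L) ^+ 2 by rewrite exprn_ege1// lerDl.
have L2 : L ^+ 2 <= (1 + L) ^+ 2 by rewrite ler_pXn2r ?nnegrE ?addr_ge0// lerDr.
rewrite (_ : (_ + D) * _ = A ^+ 2 * s ^+ 2 * (2 * pi) * (1 + L) ^+ 2 +
  A ^+ 2 * s ^+ 2 * (1 + L) ^+ 2 + D * s ^+ 2 * (1 + L) ^+ 2); last by ring.
apply: lerD; first apply: lerD.
- by rewrite ler_peMr// mulr_ge0// twopi_ge0.
- by rewrite ler_wpM2l.
- by apply: le_trans WD _; rewrite ler_peMr// mulr_ge0// sqr_ge0.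
Qed.

Let le_sqrtM (a B L s : R) : 0 <= B -> 0 <= L -> 0 <= s -> 0 <= a ->
  a ^+ 2 <= B * ((1 + L) ^+ 2 * s ^+ 2) -> a <= Num.sqrt B * (1 + L) * s.
Proof.
move=> B0 L0 s0 a0 H; rewrite -(@ler_pXn2r _ 2)// ?nnegrE//.
  by rewrite -mulrA !exprMn (sqr_sqrtr B0).
by rewrite !mulr_ge0// ?sqrtr_ge0// addr_ge0.
Qed.

(** Squares and integrates the pointwise bound of [l2_bound_derive1n]: [fT] will be the top
    derivative of [c], and [fE] the function [D_s^l h]. *)
Let l2norm_le3 (f fT fE : R -> V) (A s C : R) : smooth f -> smooth fT -> smooth fE ->
  (forall x, enorm (f x) <= A * s + A * s * enorm (fT x) + C * enorm (fE x)) ->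
  l2norm f ^+ 2 <= 3 * (A ^+ 2 * s ^+ 2 * (2 * pi) +
    A ^+ 2 * s ^+ 2 * l2norm fT ^+ 2 + C ^+ 2 * l2norm fE ^+ 2).
Proof.
move=> sf sT sE pt.
have cT := continuous_dot _ _ sT sT; have cE := continuous_dot _ _ sE sE.
have cst1 := continuous_cst (A ^+ 2 * s ^+ 2).
have c1 := continuous_mul _ _ cst1 cT.
have c2 := continuous_mul _ _ (continuous_cst (C ^+ 2)) cE.
have c3 := continuous_add _ _ cst1 c1; have c4 := continuous_add _ _ c3 c2.
rewrite !sqr_l2norm -circle_int_cst -(circle_intZ _ _ cT) -(circle_intZ _ _ cE).
rewrite -(circle_intD _ _ cst1 c1) -(circle_intD _ _ c3 c2) -(circle_intZ 3 _ c4).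
apply: le_circle_int; [exact: continuous_dot|exact: continuous_mul (continuous_cst 3) c4|].
move=> x _; have := sqr3 _ _ _ _ (enorm_ge0 _) (pt x).
by rewrite !exprMn !sqr_enorm.
Qed.

(** The last term [D_s^l h] of the expansion is split off, its L2 norm being bounded by the metric
    itself; the other arc length derivatives are bounded pointwise by [K1 s]. *)
Lemma l2_bound_derive1n (K K1 : R) : exists2 C : R, 0 <= C &
  forall c h (s : R), Imm c -> Csmooth h -> (forall x, jet_bounded l.-1 K c x) ->
    0 <= s -> (forall i x, (0 < i < l)%N -> enorm (iter i (Ds c) h x) <= K1 * s) ->
    sobolev_metric l c h h <= s ^+ 2 ->
    l2norm (derive1n l h) <= C * (1 + l2norm (derive1n l c)) * s.
Proof.
case: l l2 => [//|[//|m]] _ /=.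
have [C0 C00 HC] := derive1n_le_arc (R := R) m K.
(* [A] collects the terms of order below [l], and [D] the term [D_s^l h] after conversion to arc
   length; the 3 in [B] comes from squaring a sum of three terms. *)
pose A := C0 * (K1 + K1 *+ m); pose D := C0 ^+ 2 * `|K|.
have D0 : 0 <= D by rewrite mulr_ge0// sqr_ge0.
pose B := 3 * (A ^+ 2 * (2 * pi) + A ^+ 2 + D).
have B0 : 0 <= B.
  by rewrite mulr_ge0// !addr_ge0 ?sqr_ge0// mulr_ge0 ?sqr_ge0 ?twopi_ge0.
exists (Num.sqrt B) => [|c h s ic sh jK s0 hX hs]; first exact: sqrtr_ge0.
have [sc _] := ic.1; have [sX _] := Csmooth_iter_Ds m.+2 c h ic sh.
have L0 := l2norm_ge0 (derive1n m.+2 c).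
pose E x := enorm (iter m.+2 (Ds c) h x).
pose T x := enorm (derive1n m.+2 c x).
have pt x : enorm (derive1n m.+2 h x) <= A * s + A * s * T x + C0 * E x.
  pose X (i : nat) := enorm (iter i.+2 (Ds c) h x).
  have := HC c h x ic sh (jK x).
  rewrite -[\sum_(i < m.+1) _]/(\sum_(i < m.+1) X i) big_ord_recr.
  rewrite -[X _]/(E x) -[1 + _]/(1 + T x) => /le_trans; apply.
  have h1 : enorm (Ds c h x) <= K1 * s by apply: (hX 1%N x).
  have s1 : 0 <= K1 * s by exact: le_trans (enorm_ge0 _) h1.
  have h2 : \sum_(i < m) X i <= (K1 * s) *+ m.
    rewrite -[Y in _ <= _ *+ Y]card_ord -sumr_const; apply: ler_sum => i _.
    by apply: hX; exact: (ltn_ord i).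
  rewrite addrA mulrDr; apply: lerD; last exact: lexx.
  have T0 : 0 <= T x by exact: enorm_ge0.
  apply: (@le_trans _ _ (C0 * ((1 + T x) * (K1 * s) + (K1 * s) *+ m))).
    apply: ler_wpM2l => //; apply: lerD h2; apply: ler_wpM2l h1.
    by rewrite addr_ge0.
  rewrite (_ : A * s + A * s * T x = C0 * ((K1 + K1 *+ m) * ((1 + T x) * s))).
    rewrite ler_wpM2l//.
    have -> : (K1 + K1 *+ m) * ((1 + T x) * s) =
        (1 + T x) * (K1 * s) + (K1 * s) *+ m * (1 + T x).
      by rewrite -(mulr_natl K1) -(mulr_natl (K1 * s)); ring.
    by rewrite lerD2l ler_peMr ?mulrn_wge0// lerDl.
  by rewrite /A; ring.
apply: (le_sqrtM _ _ _ _ B0 L0 s0 (l2norm_ge0 _)).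
have W0 : 0 <= C0 ^+ 2 * l2norm (iter m.+2 (Ds c) h) ^+ 2 by rewrite mulr_ge0 ?sqr_ge0.
have WD : C0 ^+ 2 * l2norm (iter m.+2 (Ds c) h) ^+ 2 <= D * s ^+ 2.
  rewrite /D -mulrA ler_wpM2l ?sqr_ge0//.
  have cK x : (enorm (derive1 c x))^-1 <= `|K|.
    by have [h1 _] := jK x; exact: le_trans h1 (ler_norm K).
  apply: le_trans (sqr_l2norm_le_arc _ _ _ ic sX cK) _.
  rewrite ler_wpM2l//; apply: le_trans hs; exact: (arc_int_le_sobolev m.+2 m.+2).
apply: le_trans _ (l2_aux A D s _ _ L0 W0 WD D0).
exact: (l2norm_le3 _ _ _ A s C0 (smooth_derive1n m.+2 sh.1) (smooth_derive1n m.+2 sc) sX pt).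
Qed.

Lemma dini_l2norm_derive1n g k (w : curve) : smooth_path g -> Csmooth w -> forall t,
  dini (fun t => l2norm (derive1n k (g t - w))) t (l2norm (derive1n k (velocity g t))).
Proof.
move=> sg sw t; apply: (path_dini g (fun f => l2norm (derive1n k f)) k
  (Num.sqrt (2 * pi) * 2) w sg sw).
- by rewrite mulr_ge0// sqrtr_ge0.
- move=> f f' [sf _] [sf' _]; rewrite (derive1nD k _ _ sf sf').
  exact: l2normD (smooth_derive1n k sf) (smooth_derive1n k sf').
- move=> a f [sf _]; rewrite (derive1nZ k _ _ sf).
  exact: l2normZ (smooth_derive1n k sf).
- move=> f M [sf _] M0 fM; rewrite -mulrA; apply: l2norm_le.
  + exact: smooth_derive1n.
  + by rewrite mulr_ge0.
  + by move=> x _; apply: le_trans (enorm_le_norm _) _; rewrite ler_pM2l//; exact: fM.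
Qed.

Lemma short_path_l2 (K : R) : exists2 B : R, 0 <= B &
  forall g S sigma, short_path l K g S sigma -> forall t, 0 <= t <= 1 ->
  l2norm (derive1n l (g t)) <= B.
Proof.
have [K1 K10 HK1] := short_path_Ds l l2 K.
have [B B0 HB] := short_path_jet l l2 K.
have [C C0 HC] := l2_bound_derive1n B K1.
exists ((1 + `|K|) * expR C) => [|g S sigma sp t t01].
  by rewrite mulr_ge0 ?expR_ge0// addr_ge0.
have [rg [_ _ lK] S1] := sp; have [sg ig dS s0 hs] := rg.
have sv := smooth_path_Csmooth _ (smooth_path_velocity _ sg).
pose F t := 1 + l2norm (derive1n l (g t)).
have F0 s : 0 < F s by rewrite ltr_wpDr// l2norm_ge0.
have dF s : 0 <= s <= 1 -> dini F s (C * F s * sigma s).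
  move=> s01; apply: dini1D.
  have := dini_l2norm_derive1n g l 0 sg Csmooth0 s.
  rewrite (_ : (fun t => _) = fun t => l2norm (derive1n l (g t))); last first.
    by apply/funext => u; rewrite subr0.
  apply: diniW; apply: (HC _ _ _ (ig s) (sv s) (HB g S sigma sp s s01) (s0 s)) => //.
  by move=> i y il; exact: (HK1 g S sigma sp s s01 i y il).
have [h1 _] := short_gronwall l F C g S sigma C0 rg S1 (fun s _ => F0 s) dF t t01.
apply: (@le_trans _ _ (F t)); first by rewrite /F lerDr ler01.
apply: (le_trans h1); rewrite ler_wpM2r ?expR_ge0// lerD2l.
exact: le_trans lK (ler_norm K).
Qed.

Lemma short_path_velocity_sup (K : R) k : (0 < k < l)%N -> exists2 C : R, 0 <= C &
  forall g S sigma, short_path l K g S sigma -> forall t, 0 <= t <= 1 ->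
  forall x, enorm (derive1n k (velocity g t) x) <= C * sigma t.
Proof.
case: k => [//|k] /andP[_ kl].
have [K1 K10 HK1] := short_path_Ds l l2 K.
have [B B0 HB] := short_path_jet l l2 K.
have jet g S sigma : short_path l K g S sigma -> forall t, 0 <= t <= 1 ->
    forall x, enorm (derive1n k.+1 (g t) x) <= B.
  move=> sp t t01 x; have [_] := HB g S sigma sp t t01 x; apply.
  by rewrite /= -ltnS (prednK (ltnW l2)).
(* Order 1 is [h' = |c'| D_s h]; [Ds_bound_derive1n] starts at order 2. *)
case: k kl jet => [|k] kl jet.
  exists (B * K1) => [|g S sigma sp t t01 x]; first exact: mulr_ge0.
  have [[sg ig dS s0 hs] _ _] := sp.
  rewrite derive1n1 (derive1_Ds _ _ _ (ig t)) enormZ ger0_norm ?enorm_ge0// -mulrA.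
  apply: ler_pM; [exact: enorm_ge0|exact: enorm_ge0|exact: (jet g S sigma sp t t01 x)|].
  exact: (HK1 g S sigma sp t t01 1%N x).
have [C C0 HC] := Ds_bound_derive1n l l2 k.+1 B K1 isT kl K10.
exists (C * (1 + B)) => [|g S sigma sp t t01 x]; first by rewrite mulr_ge0// addr_ge0.
have [[sg ig dS s0 hs] _ _] := sp.
have sv := smooth_path_Csmooth _ (smooth_path_velocity _ sg).
have jB : jet_bounded k.+1 B (g t) x.
  apply: jet_boundedW (HB g S sigma sp t t01 x) => //.
  by rewrite -ltnS (prednK (ltnW l2)) ltnW.
apply: le_trans (HC _ _ x (sigma t) (ig t) (sv t) jB
  (fun i y il => HK1 g S sigma sp t t01 i y il)) _.
by rewrite ler_wpM2r// ler_wpM2l// lerD2l; exact: (jet g S sigma sp t t01 x).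
Qed.

Lemma short_path_velocity_l2 (K : R) k : (k <= l)%N -> exists2 C : R, 0 <= C &
  forall g S sigma, short_path l K g S sigma -> forall t, 0 <= t <= 1 ->
  l2norm (derive1n k (velocity g t)) <= C * sigma t.
Proof.
rewrite leq_eqVlt => /orP[/eqP ->|kl].
  have [K1 K10 HK1] := short_path_Ds l l2 K.
  have [B B0 HB] := short_path_jet l l2 K.
  have [D D0 HD] := short_path_l2 K.
  have [C C0 HC] := l2_bound_derive1n B K1.
  exists (C * (1 + D)) => [|g S sigma sp t t01]; first by rewrite mulr_ge0// addr_ge0.
  have [[sg ig dS s0 hs] _ _] := sp.
  have sv := smooth_path_Csmooth _ (smooth_path_velocity _ sg).
  apply: le_trans (HC _ _ _ (ig t) (sv t) (HB g S sigma sp t t01) (s0 t)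
    (fun i y il => HK1 g S sigma sp t t01 i y il) (hs t)) _.
  by rewrite ler_wpM2r// ler_wpM2l// lerD2l; exact: (HD g S sigma sp t t01).
(* Order 0 is outside the pointwise bounds on the [D_s^i h]; the first summand of the Sobolev metric
   bounds it in L2. *)
case: k kl => [|k] kl.
  have [B B0 HB] := short_path_jet l l2 K.
  exists (Num.sqrt B) => [|g S sigma sp t t01]; first exact: sqrtr_ge0.
  have [[sg ig dS s0 hs] _ _] := sp.
  have sv := smooth_path_Csmooth _ (smooth_path_velocity _ sg) t.
  have [sv' _] := sv.
  rewrite derive1n0 -(@ler_pXn2r _ 2)// ?nnegrE ?l2norm_ge0//; last first.
    by rewrite mulr_ge0// sqrtr_ge0.
  rewrite exprMn (sqr_sqrtr B0).
  have cB x : (enorm (derive1 (g t) x))^-1 <= B by have [] := HB g S sigma sp t t01 x.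
  apply: le_trans (sqr_l2norm_le_arc _ _ _ (ig t) sv' cB) _.
  rewrite ler_wpM2l//; apply: le_trans (hs t).
  exact: (arc_int_le_sobolev l 0 _ _ (ig t) sv (leq0n l)).
have [C C0 HC] := short_path_velocity_sup K k.+1 kl.
exists (Num.sqrt (2 * pi) * C) => [|g S sigma sp t t01].
  by rewrite mulr_ge0// sqrtr_ge0.
have [[sg ig dS s0 hs] _ _] := sp.
have [sv _] := smooth_path_Csmooth _ (smooth_path_velocity _ sg) t.
rewrite -mulrA; apply: l2norm_le; [exact: smooth_derive1n|exact: mulr_ge0|].
by move=> x _; exact: (HC g S sigma sp t t01 x).
Qed.

Lemma l2norm0 : l2norm (0 : curve) = 0.
Proof.
by rewrite -(scale0r (0 : curve)) l2normZ ?normr0 ?mul0r//; exact: (smooth_curve_cst 0).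
Qed.

Lemma derive1n0E k : derive1n k (0 : curve) = 0.
Proof.
by rewrite (_ : (0 : curve) = (fun=> 0))// derive1n_cst; apply/funext => x; case: k.
Qed.

(** The norms of [g t - g 0] vanish at time 0 and grow at a rate at most [M sigma], so the mean
    value inequality compares them with [M S]. *)
Lemma short_path_lipschitz (K : R) : exists K' C : R, 0 <= C /\
  forall g S sigma, short_path l K g S sigma ->
  [/\ controlled l K' (g 1),
      forall k, (k <= l)%N -> l2norm (derive1n k (g 1 - g 0)) <= C * (S 1 - S 0),
      forall x, enorm (derive1 (g 1 - g 0) x) <= C * (S 1 - S 0) &
      forall x, enorm ((g 1 - g 0) x) <= C * (S 1 - S 0)].
Proof.
have [B1 B10 HB1] := short_path_jet l l2 K.
have [B2 B20 HB2] := short_path_l2 K.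
have : forall k : 'I_l.+1, exists C : R, 0 <= C /\
    forall g S sigma, short_path l K g S sigma -> forall t, 0 <= t <= 1 ->
    l2norm (derive1n k (velocity g t)) <= C * sigma t.
  move=> k; have [C C0 HC] := short_path_velocity_l2 K k (ltn_ord k).
  by exists C.
move=> /boolp.choice [D HD].
have [E E0 HE] := short_path_velocity_sup K 1 l2.
pose M := \sum_k D k + E.
have D0 k : 0 <= D k by have [] := HD k.
have M0 : 0 <= M by rewrite addr_ge0// sumr_ge0.
have pM0 : 0 <= 2 * pi * M by rewrite mulr_ge0// twopi_ge0.
have DM k : D k <= M.
  rewrite /M (bigD1 k)//= -addrA lerDl addr_ge0// sumr_ge0//.
have EM : E <= M by rewrite /M lerDr sumr_ge0.
(* The second constant comes from [Sobolev_sup], which bounds the displacement itself by its L2 norm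
   and its derivative. *)
clearbody M; exists (B1 + B2), (2 * (M + 2 * pi * M)).
split=> [|g S sigma sp]; first by rewrite mulr_ge0// addr_ge0.
have [rg [_ _ lK] S1] := sp; have [sg ig dS s0 hs] := rg.
have sgt := smooth_path_Csmooth _ sg.
have L0 : 0 <= S 1 - S 0 by rewrite subr_ge0; exact: rectified_ndecr rg ler01.
have dMS (t : R) : 0 <= t <= 1 -> is_derive t 1 (fun t => M * S t) (M * sigma t).
  by move=> _; exact: (is_deriveZ M (dS t)).
have h1 k : (k <= l)%N -> l2norm (derive1n k (g 1 - g 0)) <= M * (S 1 - S 0).
  move=> kl.
  pose F t := l2norm (derive1n k (g t - g 0)).
  have F0 : F 0 = 0 by rewrite /F subrr derive1n0E l2norm0.
  have := dini_MVT F _ _ 0 1 ler01 dMS.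
  rewrite F0 subr0 -mulrBr; apply => t t01.
  apply: diniW (dini_l2norm_derive1n g k (g 0) sg (sgt 0) t).
  have kl' : (k < l.+1)%N by [].
  have [_ Hk] := HD (Ordinal kl').
  by apply: le_trans (Hk g S sigma sp t t01) _; rewrite ler_wpM2r.
have h2 x : enorm (derive1 (g 1 - g 0) x) <= M * (S 1 - S 0).
  pose F t := enorm (derive1n 1 (g t - g 0) x).
  have F0 : F 0 = 0 by rewrite /F subrr derive1n0E enorm0.
  have := dini_MVT F _ _ 0 1 ler01 dMS.
  rewrite F0 subr0 -mulrBr; apply => t t01.
  have P := path_dini g (fun f => enorm (derive1n 1 f x)) 1 2 (g 0) sg (sgt 0) (ler0n _ _).
  apply: diniW (P _ _ _ t).
  - by apply: le_trans (HE g S sigma sp t t01 x) _; rewrite ler_wpM2r.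
  - by move=> f f' [sf _] [sf' _]; rewrite (derive1nD 1 _ _ sf sf'); exact: enormD.
  - by move=> a f [sf _]; rewrite (derive1nZ 1 _ _ sf) enormZ.
  - by move=> f N _ _ fN; apply: le_trans (enorm_le_norm _) _; rewrite ler_pM2l//; exact: fN.
have MC : M <= 2 * (M + 2 * pi * M) by lra.
split.
- split; first exact: ig.
    move=> x; apply: jet_boundedW (HB1 g S sigma sp 1 _ x) => //; first by rewrite lerDl.
    by rewrite ler01 lexx.
  have := HB2 g S sigma sp 1; rewrite ler01 lexx => /(_ isT) H.
  by apply: le_trans H _; rewrite lerDr.
- by move=> k kl; apply: le_trans (h1 k kl) _; rewrite ler_wpM2r.
- by move=> x; apply: le_trans (h2 x) _; rewrite ler_wpM2r.
move=> x; have sd := CsmoothB _ _ (sgt 1) (sgt 0).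
apply: le_trans (Sobolev_sup _ _ sd h2 x) _.
rewrite -[leRHS]mulrA ler_pM2l// [leRHS]mulrDl -[X in _ <= _ + X]mulrA lerD2r.
exact: (h1 0%N (leq0n l)).
Qed.

End PathLipschitz.

(** * Resting paths and the triangle inequality for the geodesic distance *)

Section NormalizedPaths.
Context {R : realType}.
Local Notation V := 'rV[R]_2.
Local Notation curve := (R -> V).
Local Notation mu := (@lebesgue_measure R).
Variable G : curve -> curve -> curve -> R.
Hypothesis metG : is_metric G.
Implicit Types (c h f : curve) (g : R -> curve) (S : R -> R).

Lemma metricZ c h (a : R) : Imm c -> Csmooth h ->
  G c (a *: h) (a *: h) = a ^+ 2 * G c h h.
Proof.
move=> ic sh; have [L [[[[sL linL _] _] _ _ _ _] [GL _]]] := metG.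
have sah := CsmoothZ a _ sh.
have L0 : L c 0 = 0.
  have := linL c 0 0 1 ic Csmooth0 Csmooth0; rewrite !scale1r addr0.
  by move/eqP; rewrite -subr_eq subrr => /eqP.
have La : L c (a *: h) = a *: L c h.
  by have := linL c h 0 a ic sh Csmooth0; rewrite L0 !addr0.
rewrite !GL// /metric_of La /arc_int -circle_intZ; last first.
  have [sLh _] := sL c h ic sh; have [sh' _] := sh; have [[sc _] _] := ic.
  apply: continuous_mul; first exact: continuous_dot.
  exact: smooth_continuous_enorm (smooth_derive1 sc).
by apply: eq_circle_int => t _; rewrite !fctE dotZl dotZr !mulrA -expr2.
Qed.

Lemma metric0 c : Imm c -> G c 0 0 = 0.
Proof.
move=> ic; have := metricZ c 0 0 ic Csmooth0.
by rewrite scaler0 expr0n mul0r.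
Qed.

Lemma smooth_path_sup_continuous g (t : R) k (e : R) : smooth_path g -> 0 < e ->
  exists2 r : R, 0 < r & forall s, `|s| < r -> forall x,
    enorm (derive1n k (g (t + s)) x - derive1n k (g t) x) <= e.
Proof.
move=> sg e0; have [r r0 Hr] := smooth_path_derivative _ sg t k 1 ltr01.
have [M M0 HM] := Csmooth_sup k _ (smooth_path_Csmooth _ (smooth_path_velocity _ sg) t).
have M1 : 0 < 2 * (1 + M) by lra.
exists (Num.min r (e / (2 * (1 + M)))) => [|s]; first by rewrite lt_min r0 divr_gt0.
rewrite lt_min ltr_pdivlMr// => /andP[sr se] x.
apply: le_trans (enorm_le_norm _) _.
have := Hr s sr x; have := HM x.
move: (derive1n k (velocity g t) x) (derive1n k (g (t + s)) x) (derive1n k (g t) x).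
move=> w u v wM h.
have := ler_normD (u - v - s *: w) (s *: w); rewrite subrK normrZ => H.
have := ler_wpM2l (normr_ge0 s) wM.
move: H h se; rewrite mul1r; move: (`|_|) => n1; lra.
Qed.

Let dot_diff (u v u' v' : V) (a a' M d : R) : enorm u <= M -> enorm v <= M -> `|a| <= M ->
  enorm (u' - u) <= d -> enorm (v' - v) <= d -> `|a' - a| <= d -> d <= 1 -> 0 <= M ->
  `|dot u' v' * a' - dot u v * a| <= 3 * (M + 1) ^+ 2 * d.
Proof.
move=> hu hv ha du dv da d1 M0.
have d0 : 0 <= d := le_trans (normr_ge0 _) da.
have ndot (x y : V) : `|dot x y| <= enorm x * enorm y.
  rewrite ler_norml dot_le_enorm andbT; have := dot_le_enorm (- x) y.
  by rewrite enormN -scaleN1r dotZl mulN1r lerNl.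
have hv' : enorm v' <= M + 1.
  have := enormD (v' - v) v; rewrite subrK; lra.
have ha' : `|a'| <= M + 1.
  have := ler_normD (a' - a) a; rewrite subrK; lra.
have -> : dot u' v' * a' - dot u v * a =
    dot (u' - u) v' * a' + dot u (v' - v) * a' + dot u v * (a' - a).
  by rewrite !dotE !mxE; ring.
apply: le_trans (ler_normD _ _) _; apply: le_trans (lerD (ler_normD _ _) (lexx _)) _.
rewrite !normrM.
have b1 : `|dot (u' - u) v'| * `|a'| <= d * (M + 1) * (M + 1).
  apply: ler_pM ha' => //; apply: le_trans (ndot _ _) _.
  by apply: ler_pM; rewrite ?enorm_ge0.
have b2 : `|dot u (v' - v)| * `|a'| <= M * d * (M + 1).
  apply: ler_pM ha' => //; apply: le_trans (ndot _ _) _.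
  by apply: ler_pM; rewrite ?enorm_ge0.
have b3 : `|dot u v| * `|a' - a| <= M * M * d.
  apply: ler_pM da => //; apply: le_trans (ndot _ _) _.
  by apply: ler_pM; rewrite ?enorm_ge0.
have : 0 <= M * d by rewrite mulr_ge0.
have : 0 <= M * M * d by rewrite !mulr_ge0.
rewrite expr2; nra.
Qed.

(** [L] maps the smooth paths [g] and [h] to a smooth path, so the integrand of the metric is
    continuous in time uniformly over the circle. *)
Lemma metric_continuous g (h : R -> curve) : smooth_path g -> (forall t, Imm (g t)) ->
  smooth_path h -> continuous (fun t => G (g t) (h t) (h t)).
Proof.
move=> sg ig sh; have [L [[[[sL _ pL] _] _ _ _ _] [GL _]]] := metG.
pose w t := L (g t) (h t); have sw : smooth_path w := pL g h sg ig sh.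
have cw := smooth_path_Csmooth _ sw; have ch := smooth_path_Csmooth _ sh.
have cg := smooth_path_Csmooth _ sg.
pose I t x := dot (w t x) (h t x) * enorm (derive1 (g t) x).
have cI t : continuous (I t).
  apply: continuous_mul; first exact: continuous_dot (cw t).1 (ch t).1.
  exact: smooth_continuous_enorm (smooth_derive1 (cg t).1).
rewrite (_ : (fun t => _) = fun t => circle_int (I t)); last first.
  by apply/funext => t; rewrite GL.
move=> t; apply/cvgrPdist_le => e e0.
have [M1 M10 H1] := Csmooth_bounded _ (cw t).
have [M2 M20 H2] := Csmooth_bounded _ (ch t).
have [M3 M30 H3] := Csmooth_bounded _ (Csmooth_derive1n 1 _ (cg t)).
pose M := M1 + M2 + M3; have M0 : 0 <= M by rewrite /M; lra.
(* The constant of [dot_diff] times the length of the circle. *)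
pose B := 2 * pi * (3 * (M + 1) ^+ 2).
have B0 : 0 < B.
  by apply: mulr_gt0; [exact: twopi_gt0|apply: mulr_gt0 => //; apply: exprn_gt0; lra].
pose d := Num.min 1 (e / B).
have d0 : 0 < d by rewrite lt_min ltr01 divr_gt0.
have d1 : d <= 1 by rewrite ge_min lexx.
have dB : B * d <= e.
  by rewrite mulrC -ler_pdivlMr// ge_min lexx orbT.
have [r1 r10 K1] := smooth_path_sup_continuous _ t 0 d sw d0.
have [r2 r20 K2] := smooth_path_sup_continuous _ t 0 d sh d0.
have [r3 r30 K3] := smooth_path_sup_continuous _ t 1 d sg d0.
exists (Num.min r1 (Num.min r2 r3)) => /=; first by rewrite !lt_min r10 r20.
move=> s; rewrite /= distrC !lt_min => /and3P[s1 s2 s3].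
rewrite distrC -circle_intB//; apply: (@le_trans _ _ (B * d)) => //.
rewrite /B -mulrA; apply: circle_int_le_cst.
  move=> x; apply: continuousB; exact: cI.
move=> x _; apply: dot_diff => //.
- by apply: le_trans (H1 x) _; rewrite /M; lra.
- by apply: le_trans (H2 x) _; rewrite /M; lra.
- by rewrite ger0_norm ?enorm_ge0//; apply: le_trans (H3 x) _; rewrite /M; lra.
- by have := K1 _ s1 x; rewrite !derive1n0 subrKC.
- by have := K2 _ s2 x; rewrite !derive1n0 subrKC.
- by apply: le_trans (ler_enormB _ _) _; have := K3 _ s3 x; rewrite !derive1n1 subrKC.
Qed.

Definition speed g t : R := Num.sqrt (G (g t) (velocity g t) (velocity g t)).

Lemma speed_continuous g : smooth_path g -> (forall t, Imm (g t)) -> continuous (speed g).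
Proof.
move=> sg ig t; apply: (@continuous_comp _ _ _ _ Num.sqrt); last exact: sqrt_continuous.
exact: (metric_continuous _ _ sg ig (smooth_path_velocity _ sg)).
Qed.

(* Resting outside [0, 1] makes the concatenation [g1 (2 t) + g2 (2 t - 1) - c1] smooth. *)
Definition resting_path c0 c1 (len : R) g S : Prop :=
  [/\ smooth_path g, forall t, Imm (g t),
      forall t, t <= 0 -> [/\ g t = c0, velocity g t = 0 & S t = 0],
      forall t, 1 <= t -> [/\ g t = c1, velocity g t = 0 & S t = len] &
      forall t : R, is_derive t 1 S (speed g t)].

Lemma resting_path_length c0 c1 len g S : resting_path c0 c1 len g S ->
  path_length G g = len%:E.
Proof.
move=> [sg ig g0 g1 dS]; rewrite /path_length.
rewrite (FTC_continuous S _ 0 1 ler01 dS (speed_continuous _ sg ig)).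
have [_ _ ->] := g0 0 (lexx 0); have [_ _ ->] := g1 1 (lexx 1).
by rewrite subr0.
Qed.

Lemma resting_path_dist c0 c1 len g S : resting_path c0 c1 len g S ->
  (geodesic_dist G c0 c1 <= len%:E)%E.
Proof.
move=> rp; have [sg ig g0 g1 dS] := rp; rewrite -(resting_path_length _ _ _ _ _ rp).
apply: ereal_inf_lbound; exists g => //; split=> //.
  by have [] := g0 0 (lexx 0).
by have [] := g1 1 (lexx 1).
Qed.

Lemma resting_path_cst c : Imm c -> resting_path c c 0 (fun=> c) (fun=> 0).
Proof.
move=> ic; have [sc _] := ic; have v0 := velocity_cst c.
split=> //; first exact: smooth_path_cst.
- by move=> t _; rewrite v0.
- by move=> t _; rewrite v0.
move=> t; rewrite /speed v0 (metric0 _ ic) sqrtr0; exact: is_derive_cst.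
Qed.

Lemma resting_path_cat c0 c1 c2 l1 l2 g1 g2 S1 S2 :
  resting_path c0 c1 l1 g1 S1 -> resting_path c1 c2 l2 g2 S2 ->
  exists g S, resting_path c0 c2 (l1 + l2) g S.
Proof.
move=> [sg1 ig1 a1 b1 dS1] [sg2 ig2 a2 b2 dS2].
have sphi1 : smooth (fun t : R => 2 * t + 0) by exact: smooth_affine.
have sphi2 : smooth (fun t : R => 2 * t + -1) by exact: smooth_affine.
have dphi (b t : R) : is_derive t 1 (fun t : R => 2 * t + b) 2.
  have D := is_deriveD (is_deriveZ (2 : R) (is_derive_id t (1 : R))) (is_derive_cst b t (1 : R)).
  by apply: is_derive_eq D _; rewrite addr0 [LHS]mulr1.
pose p1 := g1 \o (fun t => 2 * t + 0); pose p2 := g2 \o (fun t => 2 * t + -1).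
have sp1 : smooth_path p1 := smooth_path_comp _ _ sphi1 sg1.
have sp2 : smooth_path p2 := smooth_path_comp _ _ sphi2 sg2.
have c1s : Csmooth (- c1).
  rewrite -scaleN1r; apply: CsmoothZ; have [<- _ _] := a2 0 (lexx 0).
  exact: smooth_path_Csmooth.
pose p t := p1 t + p2 t + - c1.
have sp12 := smooth_pathD _ _ sp1 sp2.
have sp : smooth_path p := smooth_pathD _ _ sp12 (smooth_path_cst _ c1s).
have vp t : velocity p t = 2 *: velocity g1 (2 * t + 0) + 2 *: velocity g2 (2 * t + -1).
  rewrite /p (velocityD _ _ sp12 (smooth_path_cst _ c1s)) velocity_cst addr0.
  rewrite (velocityD _ _ sp1 sp2) (velocity_comp _ _ sphi1 sg1) (velocity_comp _ _ sphi2 sg2).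
  by rewrite (derive1_eq (dphi 0 t)) (derive1_eq (dphi (-1) t)).
pose S t := S1 (2 * t + 0) + S2 (2 * t + -1).
(* On each half of the time interval one summand rests at [c1]: it cancels against the correction
   [- c1] and has no speed, so nothing has to be glued at [1 / 2]. *)
have case1 t : t <= 1 / 2 -> [/\ p t = g1 (2 * t + 0),
    velocity p t = 2 *: velocity g1 (2 * t + 0), S t = S1 (2 * t + 0) &
    speed g2 (2 * t + -1) = 0].
  move=> t2; have t0 : 2 * t + -1 <= 0 by lra.
  have [h1 h2 h3] := a2 _ t0; split.
  - by rewrite /p /p2 /= h1 addrK.
  - by rewrite vp h2 scaler0 addr0.
  - by rewrite /S h3 addr0.
  - by rewrite /speed h2 metric0 ?sqrtr0.
have case2 t : 1 / 2 <= t -> [/\ p t = g2 (2 * t + -1),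
    velocity p t = 2 *: velocity g2 (2 * t + -1), S t = l1 + S2 (2 * t + -1) &
    speed g1 (2 * t + 0) = 0].
  move=> t2; have t0 : 1 <= 2 * t + 0 by lra.
  have [h1 h2 h3] := b1 _ t0; split.
  - by rewrite /p /p1 /= h1 addrC addKr.
  - by rewrite vp h2 scaler0 add0r.
  - by rewrite /S h3.
  - by rewrite /speed h2 metric0 ?sqrtr0.
exists p, S; split; first exact: sp.
- by move=> t; case: (leP t (1 / 2)) => [/case1|/ltW/case2] [->].
- move=> t t0; have t2 : t <= 1 / 2 by lra.
  have t1 : 2 * t + 0 <= 0 by lra.
  by have [-> -> -> _] := case1 _ t2; have [-> -> ->] := a1 _ t1; rewrite scaler0.
- move=> t t1; have t2 : 1 / 2 <= t by lra.
  have t3 : 1 <= 2 * t + -1 by lra.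
  by have [-> -> -> _] := case2 _ t2; have [-> -> ->] := b2 _ t3; rewrite scaler0.
move=> t.
have D := is_deriveD (is_derive_comp S1 _ _ _ _ (dphi 0 t) (dS1 _))
  (is_derive_comp S2 _ _ _ _ (dphi (-1) t) (dS2 _)).
apply: is_derive_eq D _; rewrite /speed.
have sv1 := smooth_path_Csmooth _ (smooth_path_velocity _ sg1).
have sv2 := smooth_path_Csmooth _ (smooth_path_velocity _ sg2).
have sqrt4 (x : R) : Num.sqrt (2 ^+ 2 * x) = Num.sqrt x * 2.
  by rewrite sqrtrM ?sqr_ge0// sqrtr_sqr ger0_norm// mulrC.
case: (leP t (1 / 2)) => [/case1|/ltW/case2] [-> -> _]; rewrite /speed => ->.
  by rewrite mul0r addr0 metricZ// sqrt4.
by rewrite mul0r add0r metricZ// sqrt4.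
Qed.

(** [smooth_step] is a homeomorphism of [[0, 1]], so continuity descends from the composite. In this
    way the speed of a path is continuous on [[0, 1]] although [metric_continuous] asks for
    immersions at all times, a condition that the reparametrised path meets. *)
Lemma smooth_step_homeo (sigma : R -> R) : continuous (sigma \o smooth_step) ->
  {within `[0, 1], continuous sigma}.
Proof.
move=> ctau; apply/subspace_continuousP => x /=; rewrite in_itv/= => /andP[x0 x1].
have cpsi : continuous (@smooth_step R) := smooth_continuous _ smooth_smooth_step.
have psi0 : smooth_step (0 : R) = 0 by exact: smooth_step0.
have psi1 : smooth_step (1 : R) = 1 by exact: smooth_step1.
have surj (y : R) : 0 <= y <= 1 -> exists2 t : R, 0 <= t <= 1 & smooth_step t = y.
  move=> y01.
  have H : Num.min (smooth_step (0 : R)) (smooth_step 1) <= y <=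
      Num.max (smooth_step 0) (smooth_step 1).
    by rewrite psi0 psi1 (min_l ler01) (max_r ler01).
  have [t tI ty] := IVT ler01 (continuous_subspaceT cpsi) H.
  by exists t => //; move: tI; rewrite in_itv.
have [t0 /andP[t00 t01] t0x] : exists2 t : R, 0 <= t <= 1 & smooth_step t = x.
  by apply: surj; rewrite x0.
apply/cvgrPdist_le => e e0.
have /cvgrPdist_le /(_ e e0) [r /= r0 Hr] := ctau t0.
pose a := t0 - r / 2; pose b := t0 + r / 2.
have incr (s t : R) : 0 <= s -> t <= 1 -> s < t -> smooth_step s < smooth_step t.
  move=> s0 t1 st; apply: smooth_step_incr => //; rewrite in_itv/=.
    by rewrite s0 (le_trans (ltW st)).
  by rewrite t1 (le_trans s0 (ltW st)).
(* The neighbourhood of [x] is bounded by the images of [a] and [b]; the value 1 is a dummy for an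
   endpoint that lies outside [[0, 1]]. *)
pose eta1 := if 0 <= a then x - smooth_step a else 1.
pose eta2 := if b <= 1 then smooth_step b - x else 1.
have e1 : 0 < eta1.
  rewrite /eta1; case: ifP => // a0; rewrite subr_gt0 -t0x; apply: incr => //.
  by rewrite /a; lra.
have e2 : 0 < eta2.
  rewrite /eta2; case: ifP => // b1; rewrite subr_gt0 -t0x; apply: incr => //.
  by rewrite /b; lra.
exists (Num.min eta1 eta2) => /=; first by rewrite lt_min e1.
move=> y /= + y01; rewrite lt_min => /andP[y1 y2].
have {y01}[t /andP[ta tb] ty] : exists2 t : R, 0 <= t <= 1 & smooth_step t = y.
  by apply: surj; move: y01; rewrite /= in_itv.
rewrite -t0x -ty; apply: Hr => /=.
rewrite ltr_norml; apply/andP; split.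
  rewrite ltrNl opprB ltNge; apply/negP => tt0.
  have bt : b < t by rewrite /b; lra.
  have b1 : b <= 1 by lra.
  have b0 : 0 <= b by rewrite /b; lra.
  have := incr _ _ b0 tb bt; move: y2; rewrite /eta2 b1 ty ltr_norml => /andP[]; lra.
rewrite ltNge; apply/negP => tt0.
have at' : t < a by rewrite /a; lra.
have a0 : 0 <= a by lra.
have a1 : a <= 1 by rewrite /a; lra.
have := incr _ _ ta a1 at'; move: y1; rewrite /eta1 a0 ty ltr_norml => /andP[]; lra.
Qed.

Lemma antiderivative (f : R -> R) : continuous f -> (forall t, t <= 0 -> f t = 0) ->
  exists S : R -> R, (forall t : R, is_derive t 1 S (f t)) /\ forall t, t <= 0 -> S t = 0.
Proof.
(* Integrating from [-1] puts every [t >= 0] in the interior of the domain, and adds nothing because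
   [f] vanishes before 0. *)
move=> cf f0; pose S (y : R) := \int[mu]_(t in `[-1, y]) f t.
have S0 t : t <= 0 -> S t = 0.
  move=> t0; rewrite /S (@eq_Rintegral _ _ _ mu _ (fun=> 0)); last first.
    by move=> s /[!inE]/=; rewrite in_itv/= => /andP[_ st]; rewrite f0// (le_trans st).
  by rewrite Rintegral_cst// mul0r.
exists S; split=> // t; have [t0|t0] := ltP t 0.
  rewrite f0 ?(ltW t0)//; apply: (near_eq_is_derive (f := cst (0 : R))).
  near=> s; rewrite S0//; apply: ltW.
  by near: s; exact: lt_nbhsl.
have t1 : t < t + 1 by rewrite ltrDl.
have ax : -1 < t by lra.
have [d dE] := continuous_FTC1_closed t1 (continuous_integrable _ _ _ cf) ax (cf t).
by apply: DeriveDef; [exact: d|rewrite -derive1E].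
Unshelve. all: by end_near. Qed.

(** Composition with [smooth_step] keeps the length by substitution, keeps the path among immersions
    for all times, and kills its velocity outside [[0, 1]]. *)
Lemma resting_path_of_path c0 c1 g : smooth_path g ->
  (forall t, 0 <= t <= 1 -> Imm (g t)) -> g 0 = c0 -> g 1 = c1 ->
  exists len p S, path_length G g = len%:E /\ resting_path c0 c1 len p S.
Proof.
move=> sg ig g0 g1; pose psi := @smooth_step R.
have spsi : smooth psi by exact: smooth_smooth_step.
have psi01 t : 0 <= psi t <= 1 by rewrite smooth_step_ge0 smooth_step_le1.
pose p := g \o psi; have sp : smooth_path p := smooth_path_comp _ _ spsi sg.
have ip t : Imm (p t) by apply: ig; exact: psi01.
have sv := smooth_path_velocity _ sg.
have vp := velocity_comp _ _ spsi sg.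
(* The metric is evaluated along [p], a path of immersions, on the field [velocity g] composed with
   [psi] and not yet multiplied by [derive1 psi]. *)
have ctau : continuous (speed g \o psi).
  move=> t; apply: (@continuous_comp _ _ _ (fun t => G (p t) ((velocity g \o psi) t)
    ((velocity g \o psi) t)) Num.sqrt); last exact: sqrt_continuous.
  exact: (metric_continuous _ _ sp ip (smooth_path_comp _ _ spsi sv)).
have cd : continuous (derive1 psi) := smooth_continuous _ (smooth_derive1 spsi).
pose f t := (speed g \o psi) t * derive1 psi t.
have cf : continuous f by exact: continuous_mul.
have f0 t : t <= 0 -> f t = 0 by move=> t0; rewrite /f derive1_smooth_step0// mulr0.
have f1 t : 1 <= t -> f t = 0 by move=> t1; rewrite /f derive1_smooth_step1// mulr0.
have [S [dS S0]] := antiderivative f cf f0.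
have S1 t : 1 <= t -> S t = S 1.
  move=> t1; have := FTC_continuous S f 1 t t1 dS cf.
  rewrite (@eq_integral _ _ _ mu _ (fun=> 0%E)) ?integral0.
    by case => /eqP; rewrite eq_sym subr_eq0 => /eqP.
  by move=> s /[!inE]/=; rewrite in_itv/= => /andP[/f1 ->].
exists (S 1), p, S; split.
  have := @integration_by_substitution_increasing R psi (speed g) 0 1 ler01.
  rewrite /psi smooth_step0// smooth_step1// -/psi => sub.
  rewrite /path_length sub.
  - rewrite (FTC_continuous S f 0 1 ler01 dS cf).
    by rewrite (S0 0)// subr0.
  - exact: smooth_step_incr.
  - by move=> x _; exact: cd.
  - by apply: cvgP; apply: cvg_at_right_filter; exact: cd.
  - by apply: cvgP; apply: cvg_at_left_filter; exact: cd.
  - have cpsi := smooth_continuous _ spsi.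
    split=> [x _||]; first exact: smooth_derivable.
      exact: cvg_at_right_filter (cpsi 0).
    exact: cvg_at_left_filter (cpsi 1).
  - exact: smooth_step_homeo.
split=> //.
- move=> t t0; rewrite vp derive1_smooth_step0// scale0r S0//.
  by split=> //; rewrite /p /= /psi smooth_step0.
- move=> t t1; rewrite vp derive1_smooth_step1// scale0r S1//.
  by split=> //; rewrite /p /= /psi smooth_step1.
move=> t; suff -> : speed p t = f t by exact: dS.
rewrite /speed vp metricZ//; last exact: smooth_path_Csmooth.
rewrite sqrtrM ?sqr_ge0// sqrtr_sqr ger0_norm ?derive1_smooth_step_ge0//.
by rewrite /f mulrC.
Qed.

Lemma geodesic_dist_lt c0 c1 (r : R) : (geodesic_dist G c0 c1 < r%:E)%E ->
  exists len p S, len < r /\ resting_path c0 c1 len p S.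
Proof.
move=> /ereal_inf_lt [_ [g [sg ig g0 g1] <-]].
have [len [p [S [-> rp]]]] := resting_path_of_path _ _ _ sg ig g0 g1.
by rewrite lte_fin => lr; exists len, p, S.
Qed.

(** Strict real bounds dispense with sums of infinite distances and with minimising paths: two short
    resting paths are concatenated. *)
Lemma geodesic_dist_triangle c0 c1 c2 (r s : R) :
  (geodesic_dist G c0 c1 < r%:E)%E -> (geodesic_dist G c1 c2 < s%:E)%E ->
  (geodesic_dist G c0 c2 < (r + s)%:E)%E.
Proof.
move=> /geodesic_dist_lt [l1 [p1 [S1 [lr rp1]]]] /geodesic_dist_lt [l2 [p2 [S2 [ls rp2]]]].
have [p [S rp]] := resting_path_cat _ _ _ _ _ _ _ _ _ rp1 rp2.
by apply: le_lt_trans (resting_path_dist _ _ _ _ _ rp) _; rewrite lte_fin ltrD.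
Qed.

Lemma geodesic_dist_ge0 c0 c1 : (0 <= geodesic_dist G c0 c1)%E.
Proof.
apply/ereal_infP => _ [g _ <-]; apply: integral_ge0 => t _.
by rewrite lee_fin sqrtr_ge0.
Qed.

Lemma geodesic_dist_refl c : Imm c -> geodesic_dist G c c = 0%E.
Proof.
move=> ic; apply/eqP; rewrite eq_le geodesic_dist_ge0 andbT.
exact: resting_path_dist (resting_path_cst _ ic).
Qed.

Lemma sobolev_metric_ge0 l c h : 0 <= sobolev_metric l c h h.
Proof.
apply: circle_int_ge0 => t _; rewrite mulr_ge0 ?enorm_ge0//.
by apply: sumr_ge0 => i _; exact: dot_ge0.
Qed.

Lemma resting_path_rectified l c0 c1 len g S : stronger G (@sobolev_metric R l) ->
  resting_path c0 c1 len g S -> rectified l g S (speed g).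
Proof.
move=> stG [sg ig _ _ dS]; split=> // t; first exact: sqrtr_ge0.
have H := stG _ _ (ig t) (smooth_path_Csmooth _ (smooth_path_velocity _ sg) t).
by rewrite /speed sqr_sqrtr// (le_trans _ H)// sobolev_metric_ge0.
Qed.

End NormalizedPaths.

(** * Square integrable functions and completeness of L2 *)

Section SquareIntegrable.
Context {R : realType}.
Local Notation mu := (@lebesgue_measure R).
Local Notation D := (`[0%R, (2 * pi)%R]%classic : set R).
Implicit Types (f g u phi : R -> R).

Definition square_integrable f : Prop := measurable_fun D f /\
  (\int[mu]_(x in D) ((f x) ^+ 2)%:E < +oo)%E.

Lemma measurable_circle : (measurable : set (set (measurableTypeR R))) D.
Proof. exact: measurable_itv. Qed.

Lemma integrable_dominated f g : measurable_fun D f ->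
  mu.-integrable D (EFin \o g) -> (forall x, `|f x| <= g x) ->
  mu.-integrable D (EFin \o f).
Proof.
move=> mf ig fg; apply: (le_integrable measurable_circle _ _ ig).
  exact/measurable_EFinP.
by move=> x _ /=; rewrite lee_fin; exact: le_trans (fg x) (ler_norm _).
Qed.

Lemma integrable_add f g : mu.-integrable D (EFin \o f) ->
  mu.-integrable D (EFin \o g) -> mu.-integrable D (EFin \o (fun x => f x + g x)).
Proof. by move=> If Ig; have := integrableD measurable_circle If Ig. Qed.

Lemma integrable_scale (a : R) f : mu.-integrable D (EFin \o f) ->
  mu.-integrable D (EFin \o (fun x => a * f x)).
Proof. by move=> If; have := integrableZl measurable_circle a If. Qed.

Lemma square_integrable_sqr f : square_integrable f ->
  mu.-integrable D (EFin \o (fun x => f x ^+ 2)).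
Proof.
move=> [mf foo]; apply/integrableP; split.
  by apply/measurable_EFinP; exact: measurable_funX.
by under eq_integral => x _ do rewrite /= ger0_norm ?sqr_ge0//.
Qed.

Lemma integrable_sqr f : measurable_fun D f ->
  mu.-integrable D (EFin \o (fun x => f x ^+ 2)) -> square_integrable f.
Proof.
move=> mf /integrableP [_ foo]; split=> //; move: foo.
by under eq_integral => x _ do rewrite /= ger0_norm ?sqr_ge0//.
Qed.

Lemma square_integrableM f g : square_integrable f -> square_integrable g ->
  mu.-integrable D (EFin \o (fun x => f x * g x)).
Proof.
move=> sf sg.
apply: (integrable_dominated _ _ _ (integrable_add _ _
   (square_integrable_sqr _ sf) (square_integrable_sqr _ sg))).
  by apply: measurable_funM; [case: sf|case: sg].
move=> x; rewrite normrM.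
rewrite -(real_normK (num_real (f x))) -(real_normK (num_real (g x))).
have := sqr_ge0 (`|f x| - `|g x|); have := normr_ge0 (f x); have := normr_ge0 (g x); nra.
Qed.

Lemma continuous_square_integrable f : continuous f -> square_integrable f.
Proof.
move=> cf; apply: integrable_sqr.
  by apply/measurable_EFinP; exact: measurable_int (continuous_integrable _ 0 (2 * pi) cf).
by apply: continuous_integrable; exact: continuous_mul.
Qed.

Lemma square_integrableB f g : square_integrable f -> square_integrable g ->
  square_integrable (fun x => f x - g x).
Proof.
move=> sf sg; have mfg : measurable_fun D (fun x => f x - g x).
  by apply: measurable_funB; [case: sf|case: sg].
apply: integrable_sqr => //.
apply: (integrable_dominated _ _ _ (integrable_scale 2 _ (integrable_add _ _
   (square_integrable_sqr _ sf) (square_integrable_sqr _ sg)))).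
  exact: measurable_funX.
move=> x; rewrite ger0_norm ?sqr_ge0//; have := sqr_ge0 (f x + g x); nra.
Qed.

Lemma square_integrable_integrable f : square_integrable f ->
  mu.-integrable D (EFin \o f).
Proof.
move=> sf; have := square_integrableM _ _ sf (continuous_square_integrable _ (continuous_cst 1)).
by rewrite (_ : (fun x => f x * 1) = f)//; apply/funext => x; rewrite mulr1.
Qed.

Lemma integral_sqr f : square_integrable f ->
  (\int[mu]_(x in D) ((f x) ^+ 2)%:E)%E = (circle_int (fun x => f x ^+ 2))%:E.
Proof.
move=> sf; rewrite /circle_int /Rintegral fineK//.
exact: integrable_fin_num (square_integrable_sqr _ sf).
Qed.

Lemma integrable_circle_intB f g : mu.-integrable D (EFin \o f) ->
  mu.-integrable D (EFin \o g) ->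
  circle_int (fun x => f x - g x) = circle_int f - circle_int g.
Proof. by move=> If Ig; exact: (RintegralB measurable_circle If Ig). Qed.

Lemma integrable_circle_intD f g : mu.-integrable D (EFin \o f) ->
  mu.-integrable D (EFin \o g) ->
  circle_int (fun x => f x + g x) = circle_int f + circle_int g.
Proof. by move=> If Ig; exact: (RintegralD measurable_circle If Ig). Qed.

Lemma integrable_circle_intZ (a : R) f : mu.-integrable D (EFin \o f) ->
  circle_int (fun x => a * f x) = a * circle_int f.
Proof. by move=> If; exact: (RintegralZl a measurable_circle If). Qed.

Lemma integrable_le_circle_int f g : mu.-integrable D (EFin \o f) ->
  mu.-integrable D (EFin \o g) -> (forall x, f x <= g x) -> circle_int f <= circle_int g.
Proof. by move=> If Ig fg; apply: (le_Rintegral measurable_circle If Ig) => x _. Qed.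

Definition l2_cvg (u : nat -> R -> R) g : Prop := forall e : R, 0 < e ->
  exists N : nat, forall n, (N <= n)%N -> circle_int (fun x => (u n x - g x) ^+ 2) <= e.

Lemma l2_cvg_integral (u : nat -> R -> R) g phi : (forall n, square_integrable (u n)) ->
  square_integrable g -> continuous phi -> Defs.periodic phi -> l2_cvg u g ->
  circle_int (fun x => u n x * phi x) @[n --> \oo] --> circle_int (fun x => g x * phi x).
Proof.
move=> su sg cphi pphi ug; have sphi := continuous_square_integrable _ cphi.
have [M M0 HM] := periodic_bounded _ cphi pphi.
apply/cvgrPdist_le => e e0.
(* From [|a| <= d + a ^ 2 / d]: with the squared L2 distance at most [d ^ 2], the total error is
   [d M (2 pi + 1)], that is [e]. *)
pose d := e / (M * (2 * pi + 1)).
have p0 : 0 < M * (2 * pi + 1) by rewrite mulr_gt0// ltr_wpDl ?twopi_ge0.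
have d0 : 0 < d by rewrite divr_gt0.
have [N HN] := ug (d ^+ 2) (exprn_gt0 2 d0).
near=> n.
have nN : (N <= n)%N by near: n; exact: nbhs_infty_ge.
have sd := square_integrableB _ _ (su n) sg.
rewrite distrC -(integrable_circle_intB _ _ (square_integrableM _ _ (su n) sphi)
  (square_integrableM _ _ sg sphi)).
rewrite (_ : (fun x => _) = fun x => (u n x - g x) * phi x); last first.
  by apply/funext => x; rewrite mulrBl.
have I1 := square_integrableM _ _ sd sphi.
apply: le_trans (le_normr_Rintegral measurable_circle I1) _.
have J1 : mu.-integrable D (EFin \o (fun _ : R => M * d)).
  exact: continuous_integrable (continuous_cst _).
have J3 := square_integrable_sqr _ sd; have J2 := integrable_scale (M / d) _ J3.
apply: (@le_trans _ _ (circle_int (fun x => M * d + M / d * (u n x - g x) ^+ 2))).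
  apply: integrable_le_circle_int; [exact: integrable_norm I1|exact: integrable_add|].
  move=> x; rewrite normrM; apply: (@le_trans _ _ (`|u n x - g x| * M)).
    by rewrite ler_wpM2l.
  rewrite -(real_normK (num_real (u n x - g x))); move: (normr_ge0 (u n x - g x)).
  move: (`|u n x - g x|) => a a0.
  have -> : M * d + M / d * a ^+ 2 = M * (d + a ^+ 2 / d) by ring.
  rewrite mulrC ler_pM2l// -(ler_pM2l d0).
  have -> : d * (d + a ^+ 2 / d) = d ^+ 2 + a ^+ 2 by field; rewrite gt_eqF.
  have := sqr_ge0 (a - d); have := mulr_ge0 a0 (ltW d0); rewrite !expr2; nra.
rewrite (integrable_circle_intD _ _ J1 J2) circle_int_cst (integrable_circle_intZ _ _ J3).
have H := HN n nN; apply: (@le_trans _ _ (M * d * (2 * pi) + M / d * d ^+ 2)).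
  by rewrite lerD2l ler_wpM2l// divr_ge0 ?ltW.
rewrite (_ : _ + _ = d * (M * (2 * pi + 1))); last by field; rewrite gt_eqF.
by rewrite /d divfK// gt_eqF.
Unshelve. all: by end_near. Qed.

Let integral_weighted (f : R -> R) (a b : R) : square_integrable f -> 0 <= a ->
  circle_int (fun x => f x ^+ 2) <= b ->
  (\int[mu]_(x in D) (a * f x ^+ 2)%:E <= (a * b)%:E)%E.
Proof.
move=> sf a0 fb; rewrite (_ : (fun x => _) = fun x => (a%:E * (f x ^+ 2)%:E)%E)//.
have If := square_integrable_sqr _ sf.
by rewrite (integralZl measurable_circle If) (integral_sqr _ sf) -EFinM lee_fin ler_wpM2l.
Qed.

(* If [sum 2^j d_j^2] is finite then [sum |d_j|] is, since [|d| <= 2^-j + 2^j d^2]. *)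
Let cvg_of_weighted (v : nat -> R) :
  (\sum_(j <oo) (2 ^+ j * (v j.+1 - v j) ^+ 2)%:E < +oo)%E -> cvgn v.
Proof.
move=> H; have t0 (j : nat) : (0 <= (2 ^+ j * (v j.+1 - v j) ^+ 2)%:E :> \bar R)%E.
  by rewrite lee_fin mulr_ge0 ?sqr_ge0 ?exprn_ge0.
have Sfin : (\sum_(j <oo) (2 ^+ j * (v j.+1 - v j) ^+ 2)%:E)%E \is a fin_num.
  by rewrite ge0_fin_numE//; apply: nneseries_ge0 => j _ _; exact: t0.
pose S := fine (\sum_(j <oo) (2 ^+ j * (v j.+1 - v j) ^+ 2)%:E)%E.
have partial n : \sum_(j < n) 2 ^+ j * (v j.+1 - v j) ^+ 2 <= S.
  rewrite -lee_fin /S fineK// -sumEFin.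
  have := @nneseries_lim_ge R (fun j => (2 ^+ j * (v j.+1 - v j) ^+ 2)%:E) xpredT 0%N n.
  by rewrite big_mkord; apply=> j _ _; exact: t0.
have geo n : \sum_(j < n) (2 ^- j : R) <= 2.
  suff -> : \sum_(j < n) (2 ^- j : R) = 2 - 2 * 2 ^- n.
    by rewrite lerBlDr lerDl mulr_ge0// invr_ge0 exprn_ge0.
  elim: n => [|n IH]; first by rewrite big_ord0 expr0 invr1 mulr1 subrr.
  by rewrite big_ord_recr/= IH exprS invfM; field; rewrite expf_neq0.
have bnd n : \sum_(j < n) `|v j.+1 - v j| <= 2 + S.
  apply: le_trans (lerD (geo n) (partial n)); rewrite -big_split/=; apply: ler_sum => j _.
  rewrite -(real_normK (num_real (v j.+1 - v j))).
  have p0 : 0 < 2 ^+ j :> R by rewrite exprn_gt0.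
  move: p0 (normr_ge0 (v j.+1 - v j)); move: (2 ^+ j : R) (`|v j.+1 - v j|) => p a p0 a0.
  rewrite -(ler_pM2l p0).
  have -> : p * (p^-1 + p * a ^+ 2) = 1 + (p * a) ^+ 2 by field; rewrite gt_eqF.
  have := sqr_ge0 (p * a - 1); have := mulr_ge0 (ltW p0) a0.
  move: (p * a) => y y0 h; nra.
have C : cvgn [normed series (telescope v)].
  apply: nondecreasing_is_cvgn.
    apply/nondecreasing_seqP => n; rewrite /normed_series_of /= !seriesEnat/= big_nat_recr//=.
    by rewrite lerDl.
  exists (2 + S) => _ [n _ <-]; rewrite /= seriesEord/=; exact: bnd.
have {C}/cvg_ex[L HL] := normed_cvg C.
apply/cvg_ex; exists (L + v 0%N).
have : series (telescope v) n + v 0%N @[n --> \oo] --> L + v 0%N.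
  exact: (cvgD HL (cvg_cst (v 0%N))).
by rewrite (_ : (fun n => _) = v)//; apply/funext => n; rewrite telescopeK/= subrK.
Qed.

Let cvg_to_EFin (w : nat -> R) (a : R) : w n @[n --> \oo] --> a ->
  (w n)%:E @[n --> \oo] --> a%:E.
Proof. by move=> H; apply: cvg_EFin; [exact: nearW|exact: H]. Qed.

(** Riesz-Fischer: a fast subsequence converges almost everywhere by [cvg_of_weighted], and Fatou's
    lemma shows that its limit is the L2 limit of the whole sequence. *)
Lemma l2_complete (u : nat -> R -> R) : (forall n, continuous (u n)) ->
  (forall e : R, 0 < e -> exists N : nat, forall m n, (N <= m)%N -> (N <= n)%N ->
    circle_int (fun x => (u m x - u n x) ^+ 2) <= e) ->
  exists2 g, square_integrable g & l2_cvg u g.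
Proof.
move=> cu Cu; have mD := measurable_circle.
have su n := continuous_square_integrable _ (cu n).
(* The weight [2 ^ j] of [cvg_of_weighted] times [eps j] leaves the summable [1 / 2 ^ (j + 1)]. *)
pose eps j : R := (2 ^+ j * 2 ^+ j.+1)^-1.
have eps0 j : 0 < eps j by rewrite invr_gt0 mulr_gt0 ?exprn_gt0.
have [N HN] := boolp.choice (fun j => Cu (eps j) (eps0 j)).
(* Adding up the [N i] makes [k] monotone while keeping [k j >= N j]; the summand [j] makes it tend
   to infinity. *)
pose k j := (j + \sum_(i < j.+1) N i)%N.
have kN j : (N j <= k j)%N.
  by rewrite /k big_ord_recr/= addnA leq_addl.
have kS j : (k j <= k j.+1)%N.
  by rewrite /k [X in (_ <= _ + X)%N]big_ord_recr/=;
    apply: leq_add; [exact: leqnSn|exact: leq_addr].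
have kj j : (j <= k j)%N by rewrite leq_addr.
pose v j := u (k j).
have sv j : square_integrable (fun x => v j.+1 x - v j x) :=
  square_integrableB _ _ (su (k j.+1)) (su (k j)).
pose F j x := (2 ^+ j * (v j.+1 x - v j x) ^+ 2)%:E.
have mF j : measurable_fun D (F j).
  apply/measurable_EFinP; apply: measurable_funM; first exact: measurable_cst.
  by apply: measurable_funX; case: (sv j).
have F0 j x : D x -> (0 <= F j x)%E.
  by move=> _; rewrite lee_fin mulr_ge0 ?sqr_ge0 ?exprn_ge0.
have IF : (\int[mu]_(x in D) (\sum_(j <oo) F j x) < +oo)%E.
  rewrite integral_nneseries//.
  apply: (@le_lt_trans _ _ (1%:E)); last exact: ltry.
  apply: le_trans (epsilon_trick0 xpredT ler01).
  apply: lee_nneseries => [j _ _|j _]; first by apply: integral_ge0 => x; exact: F0.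
  apply: le_trans (integral_weighted _ _ _ (sv j) (exprn_ge0 j (ler0n _ _))
    (HN j _ _ (leq_trans (kN j) (kS j)) (kN j))) _.
  by rewrite lee_fin /eps natrX invfM mulrA mulfV// expf_neq0.
have good : {ae mu, forall x, D x -> cvgn (fun j => v j x)}.
  have mS : measurable_fun D (fun x => \sum_(j <oo) F j x)%E.
    by apply: ge0_emeasurable_sum => // j x xD _; exact: F0.
  have iS : mu.-integrable D (fun x => \sum_(j <oo) F j x)%E.
    apply/integrableP; split=> //.
    under eq_integral => x /[!inE] xD.
      rewrite gee0_abs; last by apply: nneseries_ge0 => j _ _; exact: F0.
      over.
    exact: IF.
  have := integrable_ae mD iS; apply: filterS => x H xD.
  by apply: cvg_of_weighted; rewrite ltey_eq H.
(* The upper limit is measurable without any convergence, and agrees with the limit wherever [v]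
   converges. *)
pose g x := fine (limn_esup (fun j => (v j x)%:E)).
have mg : measurable_fun D g.
  apply: (measurableT_comp (fine_measurable measurableT)).
  apply: measurable_fun_limn_esup => j; apply/measurable_EFinP.
  by case: (su (k j)).
have gE x : cvgn (fun j => v j x) -> v j x @[j --> \oo] --> g x.
  move=> /cvg_ex[L HL]; have HL' : (v j x)%:E @[j --> \oo] --> L%:E.
    exact: cvg_to_EFin.
  by rewrite /g (cvg_limn_einf_sup HL').2.
have main e : 0 < e -> exists M : nat, forall n, (M <= n)%N ->
    (\int[mu]_(x in D) ((u n x - g x) ^+ 2)%:E <= e%:E)%E.
  move=> e0; have [M HM] := Cu e e0; exists M => n nM.
  (* The shift by [M] puts every index of the subsequence beyond [M], so that the Cauchy bound holds
     for each [j] and passes to Fatou's lower limit. *)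
  pose f j x := ((u n x - v (j + M)%N x) ^+ 2)%:E.
  have sd j := square_integrableB _ _ (su n) (su (k (j + M)%N)).
  have mf j : measurable_fun D (f j).
    by apply/measurable_EFinP; apply: measurable_funX; case: (sd j).
  have f0 j x : D x -> (0 <= f j x)%E by move=> _; rewrite lee_fin sqr_ge0.
  have fe j : (\int[mu]_(x in D) f j x <= e%:E)%E.
    rewrite (integral_sqr _ (sd j)) lee_fin; apply: HM => //.
    by apply: leq_trans (kj _); exact: leq_addl.
  have aeE : ae_eq mu D (fun x => ((u n x - g x) ^+ 2)%:E) (fun x => limn_einf (f ^~ x)).
    move: good; apply: filterS; first exact: (ae_filter_ringOfSetsType mu).
    move=> x H xD; apply/esym.
    have vg : v (j + M)%N x @[j --> \oo] --> g x.
      by rewrite (cvg_shiftn M (fun j => v j x)); exact: gE (H xD).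
    have fc : f j x @[j --> \oo] --> ((u n x - g x) ^+ 2)%:E.
      apply: cvg_to_EFin; rewrite expr2; under eq_fun do rewrite expr2.
      have c1 : u n x - v (j + M)%N x @[j --> \oo] --> u n x - g x.
        by apply: cvgB => //; exact: cvg_cst.
      exact: (cvgM c1 c1).
    by have [] := cvg_limn_einf_sup fc.
  rewrite (ge0_ae_eq_integral mD _ _ _ _ aeE).
  - apply: le_trans (fatou mu mD mf f0) _; rewrite limn_einf_lim.
    apply: lime_le; first exact: is_cvg_einfs.
    apply: nearW => m; apply: le_trans (fe m); apply: ereal_inf_lbound.
    by exists m => //=.
  - by apply/measurable_EFinP; apply: measurable_funX; apply: measurable_funB => //; case: (su n).
  - rewrite (_ : (fun x => _) = (-%E \o (fun x => limn_esup (fun j => - f j x)%E))).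
      apply: measurableT_comp; first exact: oppe_measurable.
      apply: measurable_fun_limn_esup => j.
      by apply: measurableT_comp; [exact: oppe_measurable|exact: mf].
    apply/funext => x /=.
    by rewrite -[(fun j => - f j x)%E]/(-%E \o (f ^~ x)) limn_esupN oppeK.
  - by move=> x _; rewrite lee_fin sqr_ge0.
  - move=> x xD; rewrite limn_einf_lim; apply: lime_ge; first exact: is_cvg_einfs.
    by apply: nearW => m; apply/ereal_infP => _ [j _ <-]; exact: f0.
have sg : square_integrable g.
  have [M /(_ M (leqnn M)) HM] := main 1 ltr01.
  have sd : square_integrable (fun x => u M x - g x).
    split; first by apply: measurable_funB => //; case: (su M).
    by apply: le_lt_trans HM _; exact: ltry.
  have := square_integrableB _ _ (su M) sd.
  by rewrite (_ : (fun x => _) = g)//; apply/funext => x; rewrite subKr.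
exists g => // e e0; have [M HM] := main e e0; exists M => n nM.
by have := HM n nM; rewrite (integral_sqr _ (square_integrableB _ _ (su n) sg)) lee_fin.
Qed.

End SquareIntegrable.

(** * Uniqueness of weak derivatives *)

Section TestFunctions.
Context {R : realType}.
Local Notation mu := (@lebesgue_measure R).
Local Notation D := (`[0%R, (2 * pi)%R]%classic : set R).
Implicit Types (f g w phi : R -> R).

(** Provides a smooth periodic function that is positive exactly on the arc []0, 2 r[], which is
    centred at [r]. *)
Lemma cos_shift_gt (r t : R) : 0 < r <= pi -> 0 <= t <= 2 * pi ->
  (0 < cos (t - r) - cos r) = (0 < t < 2 * r).
Proof.
move=> /andP[r0 rpi] /andP[t0 tpi]; rewrite subr_gt0.
have rI : r \in `[0, pi] by rewrite in_itv/= (ltW r0).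
have [t2|t2] := ltP t (2 * r).
  have [tr|rt] := leP r t.
    rewrite ltr_cos ?andbT//; last by rewrite in_itv/=; apply/andP; split; lra.
    by rewrite (lt_le_trans r0 tr); lra.
  rewrite -(cosN (t - r)) opprB ltr_cos//; last by rewrite in_itv/=; apply/andP; split; lra.
  by rewrite andbT; apply/idP/idP; lra.
rewrite andbF; apply/negbTE; rewrite -leNgt.
have [trp|trp] := leP (t - r) pi.
  by rewrite leNgt ltr_cos//; [lra|rewrite in_itv/=; apply/andP; split; lra].
rewrite -(cosN (t - r)) -cosD2pi mulr2n.
by rewrite leNgt ltr_cos//; [lra|rewrite in_itv/=; apply/andP; split; lra].
Qed.

(** The step saturates at 1 as soon as [n] times the cosine gap exceeds 1 and is 0 where the gap is
    not positive, hence the indicator of the arc in the limit. *)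
Definition arc_bump (r : R) (n : nat) (t : R) : R :=
  smooth_step (n%:R * (cos (t - r) - cos r)).

Lemma smooth_arc_bump r n : smooth (arc_bump r n).
Proof.
have s1 : smooth (fun t : R => cos (t - r)).
  have := smooth_comp _ _ smooth_cos (smooth_affine 1 (- r)).
  by rewrite (_ : _ \o _ = fun t => cos (t - r))//; apply/funext => t /=; rewrite mul1r.
have s2 := smoothD _ _ s1 (smooth_cst (- cos r)).
exact: (smooth_comp _ _ smooth_smooth_step (smoothM _ _ (smooth_cst n%:R) s2)).
Qed.

Lemma periodic_arc_bump r n : Defs.periodic (arc_bump r n).
Proof.
move=> t; rewrite /arc_bump (_ : t + 2 * pi - r = (t - r) + pi *+ 2) ?cosD2pi//.
by ring.
Qed.

Lemma arc_bump_cvg (r t : R) : 0 < r <= pi -> 0 <= t <= 2 * pi ->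
  arc_bump r n t @[n --> \oo] --> (((0 < t < 2 * r)%R)%:R : R).
Proof.
move=> r0 t0; have H := cos_shift_gt r t r0 t0.
case: (boolP (0 < t < 2 * r)) => h; apply: cvg_near_cst; near=> n.
  apply: smooth_step1.
  rewrite h in H; have s0 : 0 < cos (t - r) - cos r by rewrite H.
  rewrite -ler_pdivrMr// mul1r; near: n; exact: nbhs_infty_ger.
apply: smooth_step0.
by rewrite mulr_ge0_le0// leNgt H (negbTE h).
Unshelve. all: by end_near. Qed.

(** Dominated convergence along the bumps, which lie between 0 and 1, with [|w|] as dominating
    function. *)
Lemma integral_bump_cvg w r : mu.-integrable D (EFin \o w) -> 0 < r <= pi ->
  (forall phi, smooth phi -> Defs.periodic phi -> circle_int (fun x => w x * phi x) = 0) ->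
  \int[mu]_(x in `[0, 2 * r]) w x = 0.
Proof.
move=> iw r0 Hw; have mD := @measurable_circle R.
have mw : measurable_fun D w by apply/measurable_EFinP; exact: measurable_int iw.
have mb n : measurable_fun D (arc_bump r n).
  apply: measurable_funTS; apply: continuous_measurable_fun.
  exact: smooth_continuous (smooth_arc_bump r n).
pose f n x := (w x * arc_bump r n x)%:E.
pose h := w \_ `]0, (2 * r)[.
have mI : (measurable : set (set (measurableTypeR R))) (`]0, (2 * r)[%classic).
  exact: measurable_itv.
have mh : measurable_fun D h.
  apply: measurable_funTS; apply/(measurable_restrictT _ _).1 => //.
  apply: (measurable_funS mD _ mw) => x /=; rewrite !in_itv/= => /andP[x0 x1].
  by rewrite (ltW x0) (le_trans (ltW x1))//; case/andP: r0 => _ rp; lra.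
have a1 n : measurable_fun D (f n) by apply/measurable_EFinP; exact: measurable_funM.
have a2 : measurable_fun D (EFin \o h) by exact/measurable_EFinP.
have a3 : {ae mu, forall x, D x -> f ^~ x @ \oo --> (EFin \o h) x}.
  apply: aeW => x; rewrite /= in_itv/= => xD; apply: cvg_EFin; first exact: nearW.
  rewrite /comp/= (_ : h x = w x * ((0 < x < 2 * r)%R)%:R).
    by apply: cvgM; [exact: cvg_cst|exact: arc_bump_cvg].
  rewrite /h patchE; case: ifPn; rewrite ?notin_setE ?inE /= in_itv/=.
    by move=> ->; rewrite mulr1.
  by move=> /negP/negbTE ->; rewrite mulr0.
have a4 : mu.-integrable D (EFin \o (fun x => `|w x|)) by exact: integrable_norm iw.
have a5 : {ae mu, forall x n, D x -> (`|f n x| <= (EFin \o (fun x => `|w x|%R)) x)%E}.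
  apply: aeW => x n _; rewrite /f /= lee_fin normrM ler_piMr// ger0_norm ?smooth_step_ge0//.
  exact: smooth_step_le1.
have [_ _ C] := dominated_convergence mD a1 a2 a3 a4 a5.
have f0 n : (\int[mu]_(x in D) f n x = 0)%E.
  have ifn : mu.-integrable D (f n).
    apply: (integrable_dominated (fun x => w x * arc_bump r n x) (fun x => `|w x|)).
    - exact: measurable_funM.
    - exact: integrable_norm iw.
    - move=> x; rewrite normrM ler_piMr// ger0_norm ?smooth_step_ge0//.
      exact: smooth_step_le1.
  rewrite -[LHS]fineK ?integrable_fin_num//.
  have := Hw _ (smooth_arc_bump r n) (periodic_arc_bump r n).
  by rewrite /circle_int /Rintegral /f => ->.
have {C f0} h0 : (\int[mu]_(x in D) ((EFin \o h) x) = 0)%E.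
  have E : (fun n => \int[mu]_(x in D) f n x)%E = cst 0%E.
    by apply/funext => n; exact: f0.
  have C' : cst 0%E @ \oo --> (\int[mu]_(x in D) ((EFin \o h) x))%E by rewrite -E; exact: C.
  exact/esym/(cvg_unique _ (cvg_cst _) C').
have : \int[mu]_(x in D) h x = 0 by rewrite /Rintegral h0.
rewrite -Rintegral_mkcondr (_ : D `&` _ = `]0, (2 * r)[%classic); last first.
  apply/seteqP; split=> x /=; rewrite !in_itv/=; first by case.
  move=> /andP[x0 x1]; split; last by rewrite x0.
  by rewrite (ltW x0) (le_trans (ltW x1))//; case/andP: r0 => _ rp; lra.
have iI : mu.-integrable `[0, (2 * r)] (EFin \o w).
  apply: (integrableS mD _ _ iw); first exact: measurable_itv.
  move=> x /=; rewrite !in_itv/= => /andP[-> x1].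
  by rewrite (le_trans x1)//; case/andP: r0 => _ rp; lra.
have iI1 : mu.-integrable `]0, (2 * r)] (EFin \o w).
  by apply: (integrableS _ _ _ iI) => // x /=; rewrite !in_itv/= => /andP[/ltW -> ->].
have iI2 : mu.-integrable `]0, (2 * r)[ (EFin \o w).
  by apply: (integrableS _ _ _ iI) => // x /=; rewrite !in_itv/= => /andP[/ltW -> /ltW ->].
by rewrite (Rintegral_itv_bndo_bndc iI2) (Rintegral_itv_obnd_cbnd iI1).
Qed.

(** All the integrals of [w] over initial arcs vanish, so its primitive is constant and [w] is 0
    almost everywhere by Lebesgue's differentiation theorem. *)
Lemma test_function_vanish w : mu.-integrable D (EFin \o w) ->
  (forall phi, smooth phi -> Defs.periodic phi -> circle_int (fun x => w x * phi x) = 0) ->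
  {ae mu, forall x, D x -> w x = 0}.
Proof.
move=> iw Hw; have mD := @measurable_circle R.
(* The primitive in [FTC1Ny] starts at [-oo], hence the extension of [w] by 0. *)
have iT : mu.-integrable setT (EFin \o (w \_ D)).
  by rewrite -restrict_EFin; apply/(integrable_mkcond _ mD).1.
have iy y : mu.-integrable `]-oo, y] (EFin \o (w \_ D)).
  by apply: (integrableS _ _ _ iT).
have F0 y : \int[mu]_(t in [set` `]-oo, y]]) (w \_ D) t = 0.
  rewrite -Rintegral_mkcondr; have [y0|y0] := ltP y 0.
    rewrite (_ : _ `&` _ = set0) ?Rintegral_set0//.
    apply/seteqP; split=> x //=; rewrite !in_itv/= => -[xy /andP[x0 _]].
    by have := le_lt_trans (le_trans x0 xy) y0; rewrite ltxx.
  have [y2|y2] := leP y (2 * pi).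
    rewrite (_ : _ `&` _ = `[0, y]%classic); last first.
      apply/seteqP; split=> x /=; rewrite !in_itv/=; first by move=> [-> /andP[->]].
      by move=> /andP[-> xy]; rewrite xy (le_trans xy).
    have [->|yn0] := eqVneq y 0; first by rewrite set_itv1 Rintegral_set1.
    have E : 2 * (y / 2) = y by field.
    have := integral_bump_cvg w (y / 2) iw _ Hw; rewrite E; apply.
    by apply/andP; split; [rewrite divr_gt0// lt_def yn0|lra].
  rewrite (_ : _ `&` _ = D); last first.
    apply/seteqP; split=> x /=; rewrite !in_itv/=; first by case.
    by move=> /andP[-> x2]; rewrite x2 (le_trans x2)// ltW.
  have := integral_bump_cvg w pi iw _ Hw; apply.
  by rewrite pi_gt0 lexx.
have := FTC1Ny iy (integrable_locally mD iw).
apply: filterS; first exact: (ae_filter_ringOfSetsType mu).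
move=> x [_ H] xD; move: H.
rewrite (_ : (fun x => _) = cst 0); last by apply/funext => y; exact: F0.
by rewrite derive1_cst patchE mem_set.
Qed.

(** The functions agree almost everywhere; the equality of their squared norms is what
    [sobolev_norm] needs. *)
Lemma weak_unique g1 g2 : square_integrable g1 -> square_integrable g2 ->
  (forall phi, smooth phi -> Defs.periodic phi ->
     circle_int (fun x => g1 x * phi x) = circle_int (fun x => g2 x * phi x)) ->
  circle_int (fun x => g1 x ^+ 2) = circle_int (fun x => g2 x ^+ 2).
Proof.
move=> s1 s2 H; have sd := square_integrableB _ _ s1 s2.
have A : {ae mu, forall x, D x -> g1 x - g2 x = 0}.
  apply: (test_function_vanish _ (square_integrable_integrable _ sd)) => phi sphi pphi.
  have cphi := continuous_square_integrable _ (smooth_continuous _ sphi).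
  rewrite (_ : (fun x => _) = fun x => g1 x * phi x - g2 x * phi x); last first.
    by apply/funext => x; rewrite mulrBl.
  rewrite (integrable_circle_intB _ _ (square_integrableM _ _ s1 cphi)
    (square_integrableM _ _ s2 cphi)).
  by rewrite (H phi sphi pphi) subrr.
congr fine; apply: ae_eq_integral; first exact: measurable_circle.
- by apply/measurable_EFinP; apply: measurable_funX; case: s1.
- by apply/measurable_EFinP; apply: measurable_funX; case: s2.
move: A; apply: filterS; first exact: (ae_filter_ringOfSetsType mu).
by move=> x E xD; move/eqP: (E xD); rewrite subr_eq0 => /eqP ->.
Qed.

End TestFunctions.

(** * Uniform limits and their derivatives *)

Section UniformLimits.
Context {R : realType}.
Local Notation V := 'rV[R]_2.
Local Notation curve := (R -> V).
Implicit Types (F f g phi : R -> R).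

Lemma real_cauchy_cvg (w : nat -> R) :
  (forall e : R, 0 < e -> exists N : nat, forall m n, (N <= m)%N -> (N <= n)%N ->
     `|w m - w n| <= e) -> exists L : R, w n @[n --> \oo] --> L.
Proof.
move=> H; suff : cvgn w by move=> /cvg_ex.
apply: cauchy_cvg; apply: cauchy_exP => e e0.
have [N HN] := H (e / 2) (divr_gt0 e0 (ltr0n _ 2)).
exists (w N); exists N => // n /= Nn; rewrite /ball/=.
by apply: le_lt_trans (HN N n (leqnn N) Nn) _; lra.
Qed.

Lemma cvgn_le_dist (w : nat -> R) (L a e : R) N : w n @[n --> \oo] --> L ->
  (forall n, (N <= n)%N -> `|a - w n| <= e) -> `|a - L| <= e.
Proof.
move=> wL H; apply/ler_addgt0Pr => d d0.
move/cvgrPdist_le : (wL) => /(_ d d0) [M _ HM].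
have := HM (maxn N M) (leq_maxr _ _); have := H (maxn N M) (leq_maxl _ _).
move: (w _) => b h1 /=; rewrite distrC => h2.
have := ler_normD (a - b) (b - L); rewrite addrA subrK; lra.
Qed.

Definition unif_cvg (u : nat -> R -> R) F : Prop := forall e : R, 0 < e ->
  exists N : nat, forall n, (N <= n)%N -> forall x, `|u n x - F x| <= e.

Lemma unif_cauchy_cvg (u : nat -> R -> R) :
  (forall e : R, 0 < e -> exists N : nat, forall m n, (N <= m)%N -> (N <= n)%N ->
     forall x, `|u m x - u n x| <= e) -> exists F, unif_cvg u F.
Proof.
move=> H; have /boolp.choice[F HF] : forall x, exists L : R, u n x @[n --> \oo] --> L.
  move=> x; apply: real_cauchy_cvg => e e0; have [N HN] := H e e0.
  by exists N => m n Nm Nn; exact: HN.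
exists F => e e0; have [N HN] := H e e0; exists N => n Nn x.
by apply: (cvgn_le_dist _ _ _ _ N (HF x)) => m Nm; exact: HN.
Qed.

Lemma unif_cvg_pointwise (u : nat -> R -> R) F x : unif_cvg u F ->
  u n x @[n --> \oo] --> F x.
Proof.
move=> H; apply/cvgrPdist_le => e e0; have [N HN] := H e e0.
by exists N => // n Nn; rewrite distrC; exact: HN.
Qed.

Lemma unif_cvg_continuous (u : nat -> R -> R) F : (forall n, continuous (u n)) ->
  unif_cvg u F -> continuous F.
Proof.
move=> cu H x; apply/cvgrPdist_le => e e0.
have e3 : 0 < e / 3 by rewrite divr_gt0.
have [N HN] := H _ e3; have h0 := HN N (leqnn N).
have := cu N x => /cvgrPdist_le /(_ _ e3); apply: filterS => y h1.
have := h0 x; have := h0 y; have := h1; rewrite (distrC _ (F y)).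
move: (u N x) (u N y) => a b h2 h3 h4.
have -> : F x - F y = - (a - F x) + (a - b) - (F y - b) by ring.
apply: le_trans (ler_normB _ _) _; apply: le_trans (lerD (ler_normD _ _) (lexx _)) _.
rewrite normrN; lra.
Qed.

Lemma derive_lipschitz F f (M : R) : (forall x : R, is_derive x 1 F (f x)) ->
  (forall x, `|f x| <= M) -> forall x y, `|F y - F x| <= M * `|y - x|.
Proof.
move=> dF fM x y; wlog xy : x y / x <= y => [H|].
  by have [/H|/ltW/H] := leP x y => //; rewrite distrC (distrC y).
have cF : continuous F by move=> z; exact: is_derive_continuous (dF z).
have [c _ ->] := MVT_segment xy (fun z _ => dF z) (continuous_subspaceT cF).
by rewrite normrM ler_wpM2r.
Qed.

(** By the mean value theorem [u m - u N] has a small Lipschitz constant, uniform in [m]. It is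
    inherited by [F - u N], so [F] is as well approximated by its tangent as [u N]. *)
Lemma unif_cvg_derive (u : nat -> R -> R) (u' : nat -> R -> R) F F' :
  (forall n (x : R), is_derive x 1 (u n) (u' n x)) ->
  unif_cvg u F -> unif_cvg u' F' -> forall x : R, is_derive x 1 F (F' x).
Proof.
move=> du uF uF' x; apply/is_deriveP => e e0.
have e4 : 0 < e / 4 by rewrite divr_gt0.
have [N HN] := uF' _ e4.
have [r r0 Hr] := is_deriveP.1 (du N x) _ e4.
exists r => // s sr.
(* The Lipschitz bound for [u m - u N], in the limit of large [m]. *)
have key : `|(F (x + s) - u N (x + s)) - (F x - u N x)| <= e / 2 * `|s|.
  have H m : (N <= m)%N -> `|(u m (x + s) - u N (x + s)) - (u m x - u N x)| <= e / 2 * `|s|.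
    move=> Nm.
    have := derive_lipschitz (fun y => u m y - u N y) (fun y => u' m y - u' N y) (e / 2)
      (fun y => is_deriveB (du m y) (du N y)).
    move=> /(_ _ x (x + s)); rewrite (addrC x s) addrK; apply => y.
    have := HN m Nm y; have := HN N (leqnn N) y.
    have -> : u' m y - u' N y = (u' m y - F' y) - (u' N y - F' y) by ring.
    move=> h1 h2; apply: le_trans (ler_normB _ _) _; lra.
  apply/ler_addgt0Pr => d d0; have d2 : 0 < d / 2 by rewrite divr_gt0.
  have [M HM] := uF _ d2.
  have h1 := HM (maxn N M) (leq_maxr _ _) x; have h2 := HM (maxn N M) (leq_maxr _ _) (x + s).
  have h3 := H (maxn N M) (leq_maxl _ _).
  move: h1 h2 h3; move: (u (maxn N M)) => w h1 h2 h3.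
  have -> : F (x + s) - u N (x + s) - (F x - u N x) =
    (w (x + s) - u N (x + s) - (w x - u N x)) - (w (x + s) - F (x + s)) + (w x - F x) by ring.
  apply: le_trans (ler_normD _ _) _; apply: le_trans (lerD (ler_normB _ _) (lexx _)) _; lra.
have h1 := Hr s sr; have h2 := HN N (leqnn N) x.
rewrite /GRing.scale/= in h1 *.
have -> : F (x + s) - F x - s * F' x = (F (x + s) - u N (x + s) - (F x - u N x)) +
  (u N (x + s) - u N x - s * u' N x) + s * (u' N x - F' x) by ring.
apply: le_trans (ler_normD _ _) _; apply: le_trans (lerD (ler_normD _ _) (lexx _)) _.
rewrite normrM; have := ler_wpM2l (normr_ge0 s) h2; lra.
Qed.

Lemma unif_l2_cvg (u : nat -> R -> R) F : (forall n, continuous (u n)) ->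
  unif_cvg u F -> l2_cvg u F.
Proof.
move=> cu uF e e0; have cF := unif_cvg_continuous _ _ cu uF.
have d0 : 0 < e / (2 * pi) by rewrite divr_gt0// twopi_gt0.
pose d := Num.sqrt (e / (2 * pi)).
have dd : 0 < d by rewrite sqrtr_gt0.
have [N HN] := uF d dd.
exists N => n Nn; apply: (@le_trans _ _ (circle_int (fun _ : R => e / (2 * pi)))).
  have cd : continuous (fun x => u n x - F x)
    by move=> x; apply: continuousB; [exact: cu|exact: cF].
  apply: le_circle_int; [exact: continuous_mul|exact: continuous_cst|move=> x _].
  rewrite -(sqr_sqrtr (ltW d0)) -/d -real_normK ?num_real// ler_pXn2r ?nnegrE ?sqrtr_ge0//.
  exact: HN.
by rewrite circle_int_cst divfK// gt_eqF// twopi_gt0.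
Qed.

Lemma circle_int_parts_n k f phi : smooth f -> smooth phi -> Defs.periodic f ->
  Defs.periodic phi -> circle_int (fun x => f x * derive1n k phi x) =
  (-1) ^+ k * circle_int (fun x => derive1n k f x * phi x).
Proof.
move=> sf sphi pf pphi; elim: k f sf pf => [|k IH] f sf pf.
  by rewrite expr0 mul1r.
rewrite derive1nS (circle_int_parts f (derive1n k phi) sf (smooth_derive1n k sphi) pf
  (periodic_derive1n k _ pphi)).
rewrite (IH (derive1 f) (smooth_derive1 sf) (periodic_derive1 _ pf)).
by rewrite exprS mulN1r mulNr -derive1Sn.
Qed.

End UniformLimits.

(** * Cauchy sequences for the geodesic distance *)

Section CauchySequences.
Context {R : realType}.
Local Notation V := 'rV[R]_2.
Local Notation curve := (R -> V).
Variables (l : nat) (G : curve -> curve -> curve -> R).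
Hypotheses (l2 : (2 <= l)%N) (metG : is_metric G) (stG : stronger G (@sobolev_metric R l)).
Implicit Types (c w : curve) (u v : nat -> curve).
Local Notation d := (geodesic_dist G).
Local Notation cauchy := (cauchy_seq (@Imm R) d).

(** The C^1 bounds accompany the H^l one because the limit must be a C^1 curve with values and
    derivatives at every point. *)
Definition close (r : R) c w : Prop :=
  [/\ forall k, (k <= l)%N -> l2norm (derive1n k (w - c)) <= r,
      forall x, enorm (derive1 (w - c) x) <= r &
      forall x, enorm ((w - c) x) <= r].

Lemma dist_close K : exists2 K',
  forall c w, controlled l K c -> (d c w < 1%:E)%E -> controlled l K' w &
  forall e, 0 < e -> exists2 r, 0 < r & forall c w, controlled l K c ->
    (d c w < r%:E)%E -> close e c w.
Proof.
have [K' [C [C0 HC]]] := short_path_lipschitz l l2 K.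
have est c w r : controlled l K c -> r <= 1 -> (d c w < r%:E)%E ->
    controlled l K' w /\ close (C * r) c w.
  move=> cK r1 dr.
  have [len [p [S [lenr rp]]]] := geodesic_dist_lt G metG c w r dr.
  have rect := resting_path_rectified G l c w len p S stG rp.
  have [_ _ H0 H1 _] := rp.
  have [p0 _ S0] := H0 0 (lexx _); have [p1 _ S1] := H1 1 (lexx _).
  have sp : short_path l K p S (speed G p).
    split => //; first by rewrite p0.
    by rewrite S0 S1 subr0 (le_trans (ltW lenr)).
  have [h1 h2 h3 h4] := HC p S (speed G p) sp.
  rewrite p1 p0 S1 S0 subr0 in h1 h2 h3 h4.
  have Cr : C * len <= C * r by rewrite ler_wpM2l// ltW.
  by split => //; split => [k kl|x|x]; apply: le_trans Cr; [exact: h2|exact: h3|exact: h4].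
exists K' => [c w cK /(est c w 1 cK (lexx _))[]//|e e0].
have C1 : 0 < C + 1 by lra.
(* [short_path] admits lengths up to 1; the divisor [C + 1] is positive even when [C] is 0. *)
pose r := Num.min 1 (e / (C + 1)).
have r0 : 0 < r by rewrite lt_min ltr01 divr_gt0.
have r1 : r <= 1 by rewrite ge_min lexx.
have Cr : C * r <= e.
  apply: (@le_trans _ _ ((C + 1) * (e / (C + 1)))); last by rewrite mulrC divfK// gt_eqF.
  by apply: ler_pM => //; [exact: ltW|lra|rewrite ge_min lexx orbT].
exists r => // c w cK /(est c w r cK r1)[_ [h1 h2 h3]].
by split => [k kl|x|x]; apply: le_trans Cr; [exact: h1|exact: h2|exact: h3].
Qed.

Lemma Imm_controlled c : Imm c -> exists K, controlled l K c.
Proof.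
move=> cI; have [[sc pc] c'0] := cI.
have sinv := smooth_inv_enorm (derive1 c) c'0 (smooth_derive1 sc).
have pinv : Defs.periodic (fun t => (enorm (derive1 c t))^-1).
  by move=> t; rewrite (periodic_derive1 c pc).
have [M M0 HM] := periodic_bounded _ (smooth_continuous _ sinv) pinv.
have /boolp.choice[B HB] : forall j : nat, exists B : R, 0 < B /\
    forall t, enorm (derive1n j c t) <= B.
  by move=> j; have [B ? ?] := Csmooth_bounded _ (Csmooth_derive1n j _ (conj sc pc)); exists B.
exists (M + (\sum_(j < l.+1) B j + l2norm (derive1n l c))).
have Bs (j : nat) : (j <= l)%N -> B j <= \sum_(j < l.+1) B j.
  rewrite -ltnS => jl; rewrite (bigD1 (Ordinal jl))//= lerDl sumr_ge0// => i _.
  by rewrite ltW// (HB i).1.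
have n0 := l2norm_ge0 (derive1n l c).
have s0 := le_trans (ltW (HB 0%N).1) (Bs 0%N (leq0n _)).
split => //; last by rewrite addrA lerDr addr_ge0// ltW.
move=> x; split.
  by apply: le_trans (le_trans (ler_norm _) (HM x)) _; rewrite lerDl addr_ge0.
move=> j /andP[_ jl]; apply: le_trans ((HB j).2 x) _.
have jl' : (j <= l)%N by apply: leq_trans jl (leq_pred _).
apply: le_trans (Bs j jl') _; have := ltW M0; lra.
Qed.

(** A tail of the sequence lies in the unit ball around one of its terms, and that term is
    controlled by compactness of the circle. *)
Lemma cauchy_controlled u : cauchy u ->
  exists K (N : nat), forall n, (N <= n)%N -> controlled l K (u n).
Proof.
move=> [uI uC]; have [N HN] := uC 1 ltr01.
have [K0 uN] := Imm_controlled _ (uI N).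
have [K H _] := dist_close K0.
by exists K, N => n Nn; apply: (H (u N)) => //; exact: HN.
Qed.

Lemma eventually_close u v : cauchy u ->
  (forall r : R, 0 < r -> exists N : nat, forall n, (N <= n)%N -> (d (u n) (v n) < r%:E)%E) ->
  forall e : R, 0 < e -> exists N : nat, forall n, (N <= n)%N -> close e (u n) (v n).
Proof.
move=> uC uv e e0; have [K [N HN]] := cauchy_controlled u uC.
have [K' _ /(_ e e0)[r r0 Hr]] := dist_close K.
have [M HM] := uv r r0; exists (maxn N M) => n; rewrite geq_max => /andP[Nn Mn].
by apply: Hr; [exact: HN|exact: HM].
Qed.

Lemma cauchy_close u : cauchy u -> forall e : R, 0 < e -> exists N : nat, forall m n,
  (N <= m)%N -> (N <= n)%N -> close e (u m) (u n).
Proof.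
move=> uC e e0; have [uI ud] := uC.
have [K [N HN]] := cauchy_controlled u uC.
have [K' _ /(_ e e0)[r r0 Hr]] := dist_close K.
have [M HM] := ud r r0; exists (maxn N M) => m n.
rewrite !geq_max => /andP[Nm Mm] /andP[Nn Mn].
by apply: Hr; [exact: HN|exact: HM].
Qed.

(* The limit exists by the triangle inequality: the distances are eventually all [+oo], or
   eventually finite and Cauchy. *)
Lemma lim_dist_lt u v (r : R) : cauchy u -> cauchy v ->
  (lim (d (u n) (v n) @[n --> \oo]) < r%:E)%E ->
  exists N : nat, forall n, (N <= n)%N -> (d (u n) (v n) < r%:E)%E.
Proof.
move=> [_ uC] [_ vC]; set D := fun n => d (u n) (v n) => Dr.
have osc (e : R) : 0 < e -> exists N : nat, forall m n, (N <= m)%N -> (N <= n)%N ->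
    forall s : R, (D n < s%:E)%E -> (D m < (e + s + e)%:E)%E.
  move=> e0; have [N HN] := uC e e0; have [M HM] := vC e e0.
  exists (maxn N M) => m n; rewrite !geq_max => /andP[Nm Mm] /andP[Nn Mn] s Ds.
  apply: (geodesic_dist_triangle G metG (u m) (v n) (v m)); last exact: HM.
  by apply: (geodesic_dist_triangle G metG (u m) (u n) (v n)) => //; exact: HN.
have [N1 HN1] := osc 1 ltr01.
have [[n0 Nn0 Dn0]|noN] := pselect (exists2 n, (N1 <= n)%N & (D n < +oo)%E); last first.
  suff Doo : D n @[n --> \oo] --> +oo%E by move: Dr; rewrite (cvg_lim _ Doo)// ltNge leey.
  have {}noN n : (N1 <= n)%N -> D n = +oo%E.
    by move=> Nn; apply/eqP; rewrite -leye_eq leNgt; apply/negP => ?; apply: noN; exists n.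
  apply: cvg_near_cst; exists N1 => // n /= Nn; rewrite noN//.
have fin n : D n \is a fin_num = (D n < +oo)%E by rewrite ge0_fin_numE// geodesic_dist_ge0.
have Dfin n : (N1 <= n)%N -> D n = (fine (D n))%:E.
  move=> Nn; rewrite fineK// fin.
  have := HN1 n n0 Nn Nn0 (fine (D n0) + 1); rewrite -{1}(@fineK _ (D n0)) ?fin//.
  by rewrite lte_fin ltrDl => /(_ ltr01) h; apply: lt_trans h (ltry _).
have [L wL] : exists L : R, fine (D n) @[n --> \oo] --> L.
  apply: real_cauchy_cvg.
  move=> e e0; have e4 : 0 < e / 4 by rewrite divr_gt0.
  have [N HN] := osc _ e4; exists (maxn N N1) => m n.
  rewrite !geq_max => /andP[Nm N1m] /andP[Nn N1n] /=.
  have h a b : (N <= a)%N -> (N1 <= a)%N -> (N <= b)%N -> (N1 <= b)%N ->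
      fine (D a) - fine (D b) <= e.
    move=> Na N1a Nb N1b; have := HN a b Na Nb (fine (D b) + e / 4).
    rewrite (Dfin a)// (Dfin b)//= !lte_fin ltrDl => /(_ e4); lra.
  by rewrite ler_norml lerNl opprB; apply/andP; split; exact: h.
have DL : D n @[n --> \oo] --> L%:E.
  have : (fine (D n))%:E @[n --> \oo] --> L%:E by apply: cvg_EFin => //; exact: nearW.
  by apply: cvg_trans; apply: near_eq_cvg; exists N1 => // n /= Nn; rewrite -Dfin.
move: Dr; rewrite (cvg_lim _ DL)// lte_fin => Lr.
have rL : 0 < (r - L) / 2 by lra.
move/cvgrPdist_le : (wL) => /(_ _ rL) [M _ HM].
exists (maxn M N1) => n; rewrite geq_max => /andP[Mn Nn].
rewrite -/(D n) Dfin// lte_fin.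
have := HM n Mn; rewrite /= distrC => /ler_normlP[_]; lra.
Qed.

End CauchySequences.

(** * The limit curve of a point of the completion *)

Section CompletionLimit.
Context {R : realType}.
Local Notation V := 'rV[R]_2.
Local Notation curve := (R -> V).
Variables (l : nat) (G : curve -> curve -> curve -> R).
Hypotheses (l2 : (2 <= l)%N) (metG : is_metric G) (stG : stronger G (@sobolev_metric R l)).
Local Notation d := (geodesic_dist G).
Local Notation cauchy := (cauchy_seq (@Imm R) d).

(** Rests on [(a + b) ^ 2 <= 2 (a ^ 2 + b ^ 2)], which suits square integrable functions; [l2normD]
    concerns smooth curves. *)
Lemma circle_int_sqr_triangle (f g h : R -> R) (p q : R) : square_integrable f ->
  square_integrable g -> square_integrable h ->
  circle_int (fun x => (f x - g x) ^+ 2) <= p -> circle_int (fun x => (g x - h x) ^+ 2) <= q ->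
  circle_int (fun x => (f x - h x) ^+ 2) <= 2 * (p + q).
Proof.
move=> sf sg sh fg gh.
have ifg := square_integrable_sqr _ (square_integrableB _ _ sf sg).
have igh := square_integrable_sqr _ (square_integrableB _ _ sg sh).
have ifh := square_integrable_sqr _ (square_integrableB _ _ sf sh).
have isum := integrable_add _ _ ifg igh.
apply: le_trans (integrable_le_circle_int _ _ ifh (integrable_scale 2 _ isum) _) _.
  move=> x; have := sqr_ge0 ((f x - g x) - (g x - h x)).
  have -> : f x - h x = (f x - g x) + (g x - h x) by ring.
  move: (f x - g x) (g x - h x) => a b; nra.
by rewrite (integrable_circle_intZ 2 _ isum) (integrable_circle_intD _ _ ifg igh) ler_pM2l// lerD.
Qed.

Lemma forall_I2 (P : 'I_2 -> Prop) : P 0 -> P 1 -> forall i, P i.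
Proof.
move=> P0 P1 i; suff [->|->] : i = 0 \/ i = 1 by [].
case: i => -[|[|//]] i2; [left|right]; exact: val_inj.
Qed.

Definition coord (f : curve) (i : 'I_2) (theta : R) : R := f theta 0 i.

Lemma coordB f g i theta : coord (f - g) i theta = coord f i theta - coord g i theta.
Proof. by rewrite /coord !mxE. Qed.

Lemma smooth_derive1n_coord n (f : curve) i : smooth f -> smooth (coord (derive1n n f) i).
Proof. by move=> sf; apply: (smooth_coord _ i); exact: smooth_derive1n. Qed.

Lemma continuous_derive1n_coord n (f : curve) i : smooth f ->
  continuous (coord (derive1n n f) i).
Proof. by move=> sf; exact: (smooth_continuous _ (smooth_derive1n_coord n f i sf)). Qed.

Lemma circle_int_coord_sqr k (f g : curve) i (r : R) : smooth f -> smooth g ->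
  l2norm (derive1n k (f - g)) <= r ->
  circle_int (fun x => (coord (derive1n k f) i x - coord (derive1n k g) i x) ^+ 2) <= r ^+ 2.
Proof.
move=> sf sg; rewrite (derive1nB k f g sf sg) => hr.
apply: (@le_trans _ _ (l2norm (derive1n k f - derive1n k g) ^+ 2)); last first.
  by rewrite ler_pXn2r// nnegrE ?l2norm_ge0// (le_trans (l2norm_ge0 _) hr).
have cf j := continuous_derive1n_coord k f j sf; have cg j := continuous_derive1n_coord k g j sg.
have cfg j : continuous (fun x => coord (derive1n k f) j x - coord (derive1n k g) j x).
  by move=> x; apply: continuousB; [exact: cf|exact: cg].
have csq j : continuous (fun x => (coord (derive1n k f) j x - coord (derive1n k g) j x) ^+ 2).
  exact: continuous_mul.
rewrite sqr_l2norm.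
have -> : circle_int (fun t => dot ((derive1n k f - derive1n k g) t)
    ((derive1n k f - derive1n k g) t)) =
  circle_int (fun x => (coord (derive1n k f) 0 x - coord (derive1n k g) 0 x) ^+ 2 +
    (coord (derive1n k f) 1 x - coord (derive1n k g) 1 x) ^+ 2).
  by apply: eq_circle_int => t _; rewrite dotE -!expr2 -!coordB.
apply: le_circle_int; [exact: csq|exact: continuous_add|move=> x _].
have := sqr_ge0 (coord (derive1n k f) 0 x - coord (derive1n k g) 0 x).
have := sqr_ge0 (coord (derive1n k f) 1 x - coord (derive1n k g) 1 x).
by move: i; apply: forall_I2; lra.
Qed.

(** All representatives are treated at once, with a common [K]: the distance of the completion is an
    infimum over representatives, so a radius must be fixed before they are known. *)
Definition limit_of (x : set (nat -> curve)) (f : curve) (g : nat -> curve) : Prop :=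
  [/\ Imm_sobolev l f,
      forall k, (k <= l)%N -> L2 (g k) /\ weak_derivative k f (g k) &
      exists K, forall u, x u ->
        [/\ exists N : nat, forall n, (N <= n)%N -> controlled l K (u n),
            forall i theta, coord (u n) i theta @[n --> \oo] --> coord f i theta &
            forall k i, (k <= l)%N ->
              l2_cvg (fun n => coord (derive1n k (u n)) i) (coord (g k) i)]].

Lemma L2_coord (f : curve) : L2 f <-> forall i, square_integrable (coord f i).
Proof. by []. Qed.

Lemma close_coord r (c w : curve) i theta : close l r c w ->
  `|coord w i theta - coord c i theta| <= r.
Proof. by move=> [_ _ h]; rewrite -coordB; apply: le_trans (coord_le_enorm _ i) (h theta). Qed.

Lemma close_derive1_coord r (c w : curve) i theta : smooth c -> smooth w -> close l r c w ->
  `|coord (derive1 w) i theta - coord (derive1 c) i theta| <= r.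
Proof.
move=> sc sw [_ h _]; rewrite -coordB; apply: le_trans (coord_le_enorm _ i) _.
by have := derive1nB 1 w c sw sc; rewrite /derive1n/= => <-; exact: h.
Qed.

Lemma cauchy_smooth u n : cauchy u -> smooth (u n).
Proof. by move=> [uI _]; have [[]] := uI n. Qed.

Lemma cauchy_periodic u n : cauchy u -> Defs.periodic (u n).
Proof. by move=> [uI _]; have [[]] := uI n. Qed.

Lemma cauchy_limit u : cauchy u -> exists F F' : 'I_2 -> R -> R,
  forall i, unif_cvg (fun n => coord (u n) i) (F i) /\
            unif_cvg (fun n => coord (derive1 (u n)) i) (F' i).
Proof.
move=> uC.
have /boolp.choice[F HF] : forall i, exists F, unif_cvg (fun n => coord (u n) i) F.
  move=> i; apply: unif_cauchy_cvg => e e0.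
  have [N HN] := cauchy_close l G l2 metG stG u uC e e0; exists N => m n Nm Nn x.
  by apply: close_coord; exact: HN.
have /boolp.choice[F' HF'] : forall i, exists F, unif_cvg (fun n => coord (derive1 (u n)) i) F.
  move=> i; apply: unif_cauchy_cvg => e e0.
  have [N HN] := cauchy_close l G l2 metG stG u uC e e0; exists N => m n Nm Nn x.
  apply: close_derive1_coord; [exact: cauchy_smooth uC|exact: cauchy_smooth uC|exact: HN].
by exists F, F'.
Qed.

Lemma cauchy_derivative_limit u k i : cauchy u -> (k <= l)%N ->
  exists g, square_integrable g /\ l2_cvg (fun n => coord (derive1n k (u n)) i) g.
Proof.
move=> uC kl; have [||g ? ?] := l2_complete (fun n => coord (derive1n k (u n)) i).
- by move=> n; apply: continuous_derive1n_coord; exact: cauchy_smooth uC.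
- move=> e e0; have se : 0 < Num.sqrt e by rewrite sqrtr_gt0.
  have [N HN] := cauchy_close l G l2 metG stG u uC _ se; exists N => m n Nm Nn.
  rewrite -[leRHS](sqr_sqrtr (ltW e0)); apply: circle_int_coord_sqr;
    [exact: cauchy_smooth uC|exact: cauchy_smooth uC|].
  by have [h _ _] := HN n m Nn Nm; exact: h.
by exists g.
Qed.

(** Integration by parts holds for each [u n], and both of its sides converge. *)
Lemma weak_derivative_limit u k (f g : R -> R) i phi : cauchy u ->
  unif_cvg (fun n => coord (u n) i) f -> square_integrable g ->
  l2_cvg (fun n => coord (derive1n k (u n)) i) g -> smooth phi -> Defs.periodic phi ->
  circle_int (fun x => f x * derive1n k phi x) = (-1) ^+ k * circle_int (fun x => g x * phi x).
Proof.
move=> uC uf sg ug sphi pphi.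
have cu n : continuous (coord (u n) i).
  exact: (continuous_derive1n_coord 0 (u n) i (cauchy_smooth u n uC)).
have cf := unif_cvg_continuous _ _ cu uf.
have h1 := l2_cvg_integral (fun n => coord (u n) i) f (derive1n k phi)
  (fun n => continuous_square_integrable _ (cu n)) (continuous_square_integrable _ cf)
  (smooth_continuous _ (smooth_derive1n k sphi)) (periodic_derive1n k _ pphi)
  (unif_l2_cvg _ _ cu uf).
have cku n := continuous_derive1n_coord k (u n) i (cauchy_smooth u n uC).
have h2 := l2_cvg_integral (fun n => coord (derive1n k (u n)) i) g phi
  (fun n => continuous_square_integrable _ (cku n)) sg (smooth_continuous _ sphi) pphi ug.
have h3 : circle_int (fun x => coord (u n) i x * derive1n k phi x) @[n --> \oo] -->
    (-1) ^+ k * circle_int (fun x => g x * phi x).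
  have -> : (fun n => circle_int (fun x => coord (u n) i x * derive1n k phi x)) =
      (fun n => (-1) ^+ k * circle_int (fun x => coord (derive1n k (u n)) i x * phi x)).
    apply/funext => n; have su := cauchy_smooth u n uC.
    rewrite (circle_int_parts_n k (coord (u n) i) phi (smooth_coord _ i su) sphi _ pphi).
      by rewrite (derive1n_coord k (u n) i su : coord _ _ = derive1n k (coord _ _)).
    by move=> t; rewrite /coord (cauchy_periodic u n uC).
  by apply: cvgM; [exact: cvg_cst|exact: h2].
exact: (cvg_unique _ h1 h3).
Qed.

(** The lower bound [1 <= K |c'|] along the tail of the sequence survives in the limit. *)
Lemma derive1_limit_neq0 u (F' : 'I_2 -> R -> R) : cauchy u ->
  (forall i, unif_cvg (fun n => coord (derive1 (u n)) i) (F' i)) ->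
  forall x, (\row_i F' i x : V) != 0.
Proof.
move=> uC uF x; apply/eqP => F0.
have Fi i : F' i x = 0 by have := congr1 (fun v : V => v 0 i) F0; rewrite /= !mxE.
have [K [N HN]] := cauchy_controlled l G l2 metG stG u uC.
have c'0 n : 0 < enorm (derive1 (u n) x) by rewrite enorm_gt0 (uC.1 n).2.
have K1 n : (N <= n)%N -> 1 <= K * enorm (derive1 (u n) x).
  move=> Nn; have [_ h _] := HN n Nn; have [h' _] := h x.
  by rewrite -ler_pdivrMr// div1r.
have K0 : 0 < K.
  have := K1 N (leqnn N); rewrite -(pmulr_lgt0 K (c'0 N)); exact: lt_le_trans.
(* If the limit vanished, both coordinates would be at most [1 / (4 K)] for large [n], whence
   [K |c'| <= 1 / 2]. *)
have e0 : 0 < 1 / (4 * K) by rewrite divr_gt0// mulr_gt0.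
have [M0 HM0] := uF 0 _ e0; have [M1 HM1] := uF 1 _ e0.
pose n := maxn N (maxn M0 M1).
have h0 : `|coord (derive1 (u n)) 0 x| <= 1 / (4 * K).
  have := HM0 n _ x; rewrite Fi subr0; apply.
  by rewrite (leq_trans (leq_maxl M0 M1))// leq_maxr.
have h1 : `|coord (derive1 (u n)) 1 x| <= 1 / (4 * K).
  have := HM1 n _ x; rewrite Fi subr0; apply.
  by rewrite (leq_trans (leq_maxr M0 M1))// leq_maxr.
have := K1 n (leq_maxl _ _); rewrite leNgt => /negP; apply.
have : K * enorm (derive1 (u n) x) <= K * (1 / (4 * K) + 1 / (4 * K)).
  rewrite ler_pM2l//; apply: le_trans (enorm_le_coords _) _; exact: lerD.
have -> : K * (1 / (4 * K) + 1 / (4 * K)) = 1 / 2 by field; rewrite gt_eqF.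
lra.
Qed.

Lemma completion_limit x : completion (@Imm R) d x -> exists f g, limit_of x f g.
Proof.
move=> [u uC ->]; have [F [F' HF]] := cauchy_limit u uC.
have uF i := (HF i).1; have uF' i := (HF i).2.
(* Nothing is asked for orders above [l], where 0 is taken, so that the choice is a total function
   of the order and the coordinate. *)
have /boolp.choice[h Hh] : forall ki : nat * 'I_2, exists g, (ki.1 <= l)%N ->
    square_integrable g /\ l2_cvg (fun n => coord (derive1n ki.1 (u n)) ki.2) g.
  move=> [k i] /=; have [kl|kl] := boolP (k <= l)%N; last by exists (fun=> 0).
  by have [g hg] := cauchy_derivative_limit u k i uC kl; exists g.
pose f : curve := fun t => \row_i F i t.
pose g : nat -> curve := fun k t => \row_i h (k, i) t.
have fE i : coord f i = F i by apply/funext => t; rewrite /coord mxE.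
have gE k i : coord (g k) i = h (k, i) by apply/funext => t; rewrite /coord mxE.
have cu n i : continuous (coord (u n) i).
  exact: (continuous_derive1n_coord 0 (u n) i (cauchy_smooth u n uC)).
have cu' n i : continuous (coord (derive1 (u n)) i).
  exact: (continuous_derive1n_coord 1 (u n) i (cauchy_smooth u n uC)).
have dF i : forall t : R, is_derive t 1 (F i) (F' i t).
  apply: (unif_cvg_derive (fun n => coord (u n) i) (fun n => coord (derive1 (u n)) i)) => // n t.
  exact: (is_derive_coord (smooth_is_derive (cauchy_smooth u n uC) t) i).
have df (t : R) : is_derive t 1 f (\row_i F' i t : V).
  apply: is_derive_vec => i; rewrite mxE.
  have -> : (fun s => f s 0 i) = F i by exact: fE.
  exact: dF.
have df1 : derive1 f = (fun t => \row_i F' i t).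
  by apply/funext => t; exact: derive1_eq.
have cF i : continuous (F i) := unif_cvg_continuous _ _ (fun n => cu n i) (uF i).
have cF' i : continuous (F' i) := unif_cvg_continuous _ _ (fun n => cu' n i) (uF' i).
have gL k : (k <= l)%N -> L2 (g k) /\ weak_derivative k f (g k).
  move=> kl; split.
    by move=> i; have [+ _] := Hh (k, i) kl; rewrite -gE.
  move=> phi sphi pphi i; have [sg hg] := Hh (k, i) kl.
  have := weak_derivative_limit u k (F i) (h (k, i)) i phi uC (uF i) sg hg sphi pphi.
  by rewrite -fE -gE.
exists f, g; split => //.
- split.
  + split.
    * move=> t; apply/rowP => i; rewrite !mxE.
      have ha := unif_cvg_pointwise _ _ (t + 2 * pi) (uF i).
      have hb := unif_cvg_pointwise _ _ t (uF i).
      have E : (fun n => coord (u n) i (t + 2 * pi)) = (fun n => coord (u n) i t).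
        by apply/funext => n; rewrite /coord (cauchy_periodic u n uC).
      by rewrite E in ha; exact: (cvg_unique _ ha hb).
    * by apply/L2_coord => i; rewrite fE; exact: continuous_square_integrable.
    * by move=> k kl; exists (g k); exact: gL.
  + by move=> t; have [] := df t.
  + rewrite df1 => t; apply/cvgrPdist_le => e e0.
    have near0 : \forall s \near t, forall i, `|F' i t - F' i s| <= e.
      have near1 i : \forall s \near t, `|F' i t - F' i s| <= e.
        by have := cF' i t => /cvgrPdist_le /(_ _ e0).
      by apply: filterS2 (near1 0) (near1 1) => s h0 h1; exact: forall_I2.
    apply: filterS near0 => s hs; apply: norm_le_coords; first exact: ltW.
    by move=> i; rewrite !mxE.
  + by move=> t; rewrite df1; exact: (derive1_limit_neq0 u).
- have uK v : cauchy_class (@Imm R) d u v -> forall r : R, 0 < r -> exists N : nat,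
      forall n, (N <= n)%N -> (d (u n) (v n) < r%:E)%E.
    move=> [_ uv] r r0.
    have [N _ HN] : \forall n \near \oo, (d (u n) (v n) < r%:E)%E.
      apply: (uv [set y | (y < r%:E)%E]); apply: open_nbhs_nbhs; split => /=.
        exact: open_ereal_lt_ereal.
      by rewrite lte_fin.
    by exists N.
  have [K [N HK]] := cauchy_controlled l G l2 metG stG u uC.
  (* Every representative is eventually at distance less than 1 from [u], which makes [K'] common to
     all of them. *)
  have [K' HK' _] := dist_close l G l2 metG stG K.
  exists K' => v xv; have uv := uK v xv; have vC := xv.1.
  have cl := eventually_close l G l2 metG stG u v uC uv.
  split.
  + have [M HM] := uv 1 ltr01; exists (maxn N M) => n; rewrite geq_max => /andP[Nn Mn].
    by apply: (HK' (u n)); [exact: HK|exact: HM].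
  + move=> i t; rewrite fE; apply/cvgrPdist_le => e e0.
    have e2 : 0 < e / 2 by rewrite divr_gt0.
    have [M HM] := cl _ e2; have [P HP] := uF i _ e2.
    exists (maxn M P) => // n /=; rewrite geq_max => /andP[Mn Pn].
    have := close_coord _ _ _ i t (HM n Mn); have := HP n Pn t.
    move: (coord (u n) i t) (coord (v n) i t) => a b h1 h2.
    have -> : F i t - b = - (a - F i t) - (b - a) by ring.
    by apply: le_trans (ler_normB _ _) _; rewrite normrN; lra.
  + move=> k i kl e e0; rewrite gE; have [sg ug] := Hh (k, i) kl.
    have e4 : 0 < e / 4 by rewrite divr_gt0.
    have se : 0 < Num.sqrt (e / 4) by rewrite sqrtr_gt0.
    have [M HM] := cl _ se; have [P HP] := ug _ e4.
    exists (maxn M P) => // n /=; rewrite geq_max => /andP[Mn Pn].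
    have su := cauchy_smooth u n uC; have sv := cauchy_smooth v n vC.
    have [hk _ _] := HM n Mn.
    have h1 := circle_int_coord_sqr k (v n) (u n) i _ sv su (hk k kl).
    rewrite (sqr_sqrtr (ltW e4)) in h1; have h2 := HP n Pn.
    have -> : e = 2 * (e / 4 + e / 4) by field.
    apply: (circle_int_sqr_triangle _ (coord (derive1n k (u n)) i)) => //;
      by apply: continuous_square_integrable; exact: continuous_derive1n_coord.
Qed.

End CompletionLimit.

(** * The Sobolev distance between two limits *)

Section LimitsDistance.
Context {R : realType}.
Local Notation V := 'rV[R]_2.
Local Notation curve := (R -> V).

Lemma circle_int_dot (g : curve) : L2 g -> circle_int (fun x => dot (g x) (g x)) =
  circle_int (fun x => coord g 0 x ^+ 2) + circle_int (fun x => coord g 1 x ^+ 2).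
Proof.
move=> /L2_coord sg.
rewrite -(integrable_circle_intD _ _ (square_integrable_sqr _ (sg 0))
  (square_integrable_sqr _ (sg 1))).
by apply: eq_circle_int => t _; rewrite dotE -!expr2.
Qed.

Lemma weak_derivative_norm k (f g h : curve) i : L2 g -> L2 h ->
  weak_derivative k f g -> weak_derivative k f h ->
  circle_int (fun x => coord g i x ^+ 2) = circle_int (fun x => coord h i x ^+ 2).
Proof.
move=> /L2_coord sg /L2_coord sh fg fh; apply: (weak_unique _ _ (sg i) (sh i)) => phi sphi pphi.
have s0 : (-1 : R) ^+ k != 0 by rewrite signr_eq0.
apply: (mulfI s0); rewrite -(fg phi sphi pphi i); exact: (fh phi sphi pphi i).
Qed.

Lemma L2B (f g : curve) : L2 f -> L2 g -> L2 (f - g).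
Proof.
move=> /L2_coord sf /L2_coord sg; apply/L2_coord => i.
have -> : coord (f - g) i = (fun x => coord f i x - coord g i x).
  by apply/funext => x; exact: coordB.
exact: square_integrableB.
Qed.

Lemma weak_derivativeB k (f1 f2 g1 g2 : curve) : L2 f1 -> L2 f2 -> L2 g1 -> L2 g2 ->
  weak_derivative k f1 g1 -> weak_derivative k f2 g2 ->
  weak_derivative k (f1 - f2) (g1 - g2).
Proof.
move=> /L2_coord F1 /L2_coord F2 /L2_coord G1 /L2_coord G2 H1 H2 phi sphi pphi i.
have cp := continuous_square_integrable _ (smooth_continuous _ sphi).
have ck := continuous_square_integrable _ (smooth_continuous _ (smooth_derive1n k sphi)).
have split_int (f g : curve) (psi : R -> R) : square_integrable psi ->
    square_integrable (coord f i) -> square_integrable (coord g i) ->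
    circle_int (fun x => (f - g) x 0 i * psi x) =
    circle_int (fun x => coord f i x * psi x) - circle_int (fun x => coord g i x * psi x).
  move=> sp sf sg.
  rewrite -(integrable_circle_intB _ _ (square_integrableM _ _ sf sp)
    (square_integrableM _ _ sg sp)).
  by apply: eq_circle_int => x _; rewrite -mulrBl -coordB.
rewrite (split_int _ _ _ ck (F1 i) (F2 i)) (split_int _ _ _ cp (G1 i) (G2 i)) mulrBr.
by congr (_ - _); [exact: H1|exact: H2].
Qed.

(** By uniqueness of weak derivatives, any of them may stand in for the ones picked by [wderive].
    Two coordinates and [l + 1] orders turn the given bound into [e ^ 2 / 2], which is strictly
    below [e ^ 2]. *)
Lemma sobolev_norm_lt l (f : curve) (g : nat -> curve) (e : R) : 0 < e ->
  (forall k, (k <= l)%N -> [/\ L2 (g k), weak_derivative k f (g k) &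
     forall i, circle_int (fun x => coord (g k) i x ^+ 2) <= e ^+ 2 / (4 * l.+1%:R)]) ->
  sobolev_norm l f < e.
Proof.
move=> e0 H; have l0 : 0 < l.+1%:R :> R by rewrite ltr0n.
have wk k : (k <= l)%N -> circle_int (fun t => dot (wderive k f t) (wderive k f t)) <=
    e ^+ 2 / (2 * l.+1%:R).
  move=> kl; have [Lg fg gb] := H k kl.
  have [Lw fw] : L2 (wderive k f) /\ weak_derivative k f (wderive k f).
    by apply: (@getPex _ [set g | L2 g /\ weak_derivative k f g]); exists (g k).
  rewrite circle_int_dot//.
  rewrite (weak_derivative_norm k f _ (g k) 0)// (weak_derivative_norm k f _ (g k) 1)//.
  apply: le_trans (lerD (gb 0) (gb 1)) _.
  by rewrite le_eqVlt; apply/orP; left; apply/eqP; field; rewrite gt_eqF.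
have S : \sum_(k < l.+1) circle_int (fun t => dot (wderive k f t) (wderive k f t)) <=
    e ^+ 2 / 2.
  apply: (@le_trans _ _ (\sum_(k < l.+1) e ^+ 2 / (2 * l.+1%:R))).
    by apply: ler_sum => k _; apply: wk; rewrite -ltnS.
  rewrite sumr_const card_ord -mulr_natr.
  by rewrite le_eqVlt; apply/orP; left; apply/eqP; field; rewrite gt_eqF.
have e2 : e ^+ 2 / 2 < e ^+ 2 by have : 0 < e ^+ 2 by [exact: exprn_gt0]; lra.
have -> : e = Num.sqrt (e ^+ 2) by rewrite sqrtr_sqr gtr0_norm.
by rewrite ltr_sqrt ?exprn_gt0//; exact: le_lt_trans S e2.
Qed.

Lemma limits_close l (r : R) (x y : set (nat -> curve)) f1 g1 f2 g2 u v N :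
  limit_of l x f1 g1 -> limit_of l y f2 g2 -> x u -> y v ->
  (forall n, smooth (u n) /\ smooth (v n)) ->
  (forall n, (N <= n)%N -> close l r (u n) (v n)) -> forall k i, (k <= l)%N ->
  circle_int (fun t => coord (g1 k - g2 k) i t ^+ 2) <= 4 * r ^+ 2.
Proof.
move=> [_ G1 [K1 H1]] [_ G2 [K2 H2]] xu yv suv uv k i kl.
have [_ _ ug] := H1 u xu; have [_ _ vg] := H2 v yv.
have /L2_coord s1 := (G1 k kl).1; have /L2_coord s2 := (G2 k kl).1.
(* The triangle inequality for squares is used twice: [2 (e / 6 + 2 (r ^ 2 + e / 6)) = 4 r ^ 2 +
   e]. *)
apply/ler_addgt0Pr => e e0; have e6 : 0 < e / 6 by rewrite divr_gt0.
have [N1 HN1] := ug k i kl _ e6; have [N2 HN2] := vg k i kl _ e6.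
pose n := maxn N (maxn N1 N2).
have h1 := HN1 n (leq_trans (leq_maxl N1 N2) (leq_maxr _ _)).
have h2 := HN2 n (leq_trans (leq_maxr N1 N2) (leq_maxr _ _)).
have [h3 _ _] := uv n (leq_maxl _ _); have [su sv] := suv n.
have {}h3 := circle_int_coord_sqr k _ _ i r sv su (h3 k kl).
have sU := continuous_square_integrable _ (continuous_derive1n_coord k _ i su).
have sV := continuous_square_integrable _ (continuous_derive1n_coord k _ i sv).
have sqC (a b : R -> R) : circle_int (fun t => (a t - b t) ^+ 2) =
    circle_int (fun t => (b t - a t) ^+ 2).
  by apply: eq_circle_int => t _; rewrite -sqrrN opprB.
have -> : circle_int (fun t => coord (g1 k - g2 k) i t ^+ 2) =
    circle_int (fun t => (coord (g1 k) i t - coord (g2 k) i t) ^+ 2).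
  by apply: eq_circle_int => t _; rewrite coordB.
rewrite sqC in h1; rewrite sqC in h3.
have h4 := circle_int_sqr_triangle _ _ _ _ _ sU sV (s2 i) h3 h2.
have := circle_int_sqr_triangle _ _ _ _ _ (s1 i) sU (s2 i) h1 h4; lra.
Qed.

End LimitsDistance.

(** Points of the completion are classes of sequences, so containment is expressed by a map: [iota]
    sends a class to its limit curve. Fixing [Imm] and being continuous into the H^l norm ties it to
    the given curves. *)
Theorem corollary11 (R : realType) (l : nat)
    (G : (R -> 'rV[R]_2) -> (R -> 'rV[R]_2) -> (R -> 'rV[R]_2) -> R) :
  (2 <= l)%N ->
  is_metric G ->
  stronger G (@sobolev_metric R l) ->
  exists iota : set (nat -> (R -> 'rV[R]_2)) -> (R -> 'rV[R]_2),
    [/\ forall x, completion (@Imm R) (geodesic_dist G) x ->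
          Imm_sobolev l (iota x),
        forall c, Imm c ->
          iota (completion_embed (@Imm R) (geodesic_dist G) c) = c &
        forall x, completion (@Imm R) (geodesic_dist G) x ->
        forall e : R, 0 < e -> exists2 r : R, 0 < r &
          forall y, completion (@Imm R) (geodesic_dist G) y ->
            (completion_dist (geodesic_dist G) x y < r%:E)%E ->
            sobolev_norm l (iota x - iota y) < e].
Proof.
move=> l2 metG stG; set d := geodesic_dist G.
have /boolp.choice[iota Hiota] : forall x, exists f, completion (@Imm R) d x ->
    exists g, limit_of l x f g.
  move=> x; have [xC|nxC] := pselect (completion (@Imm R) d x); last by exists (fun=> 0).
  by have [f [g fg]] := completion_limit l G l2 metG stG x xC; exists f => _; exists g.
exists iota; split => [x xC|c cI|x xC e e0].
- by have [g []] := Hiota x xC.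
- have dcc : d c c = 0 := geodesic_dist_refl G metG c cI.
  have cC : cauchy_seq (@Imm R) d (fun=> c).
    by split => // e e0; exists 0%N => m n _ _; rewrite dcc lte_fin.
  have cc : completion_embed (@Imm R) d c (fun=> c).
    by split => //; rewrite dcc; exact: cvg_cst.
  (* The constant sequence represents the class of [c], so its pointwise limit is both [c] and the
     limit curve. *)
  have [|g [_ _ [K /(_ _ cc)[_ lc _]]]] := Hiota (completion_embed (@Imm R) d c).
    by exists (fun=> c).
  apply/funext => t; apply/rowP => i.
  exact: (cvg_unique _ (lc i t) (cvg_cst (coord c i t))).
have [g1 L1] := Hiota x xC; have [I1 G1 [K H1]] := L1.
have l0 : 0 < l.+1%:R :> R by rewrite ltr0n.
(* [b] is the bound that [sobolev_norm_lt] requires; [limits_close] loses a factor 4, hence the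
   distance [sqrt (b / 4)] asked of [dist_close]. *)
pose b := e ^+ 2 / (4 * l.+1%:R).
have b0 : 0 < b by rewrite divr_gt0// ?exprn_gt0// mulr_gt0.
have b4 : 0 < b / 4 by rewrite divr_gt0.
have r0 : 0 < Num.sqrt (b / 4) by rewrite sqrtr_gt0.
(* As [K] serves all representatives of [x], the radius [r] is fixed before [y] and before the
   sequences [u] and [v]. *)
have [K' _ /(_ _ r0)[r rpos Hr]] := dist_close l G l2 metG stG K.
exists r => // y yC dxy; have [g2 L2] := Hiota y yC; have [I2 G2 _] := L2.
(* Some pair of representatives already has a limit distance below [r]. *)
have [_ [[u v]/= [xu yv] <-] lim_r] := ereal_inf_lt dxy.
have rep z w : completion (@Imm R) d z -> z w -> cauchy_seq (@Imm R) d w.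
  by move=> [w0 _ ->] [].
have uC := rep x u xC xu; have vC := rep y v yC yv.
have [N HN] := lim_dist_lt G metG u v r uC vC lim_r.
have [[M HM] _ _] := H1 u xu.
apply: (sobolev_norm_lt l _ (fun k => g1 k - g2 k)) => // k kl.
have [S1 W1] := G1 k kl; have [S2 W2] := G2 k kl.
have [[_ F1 _] _ _ _] := I1; have [[_ F2 _] _ _ _] := I2.
split => [||i]; [exact: L2B|exact: weak_derivativeB|].
have -> : e ^+ 2 / (4 * l.+1%:R) = 4 * Num.sqrt (b / 4) ^+ 2.
  by rewrite (sqr_sqrtr (ltW b4)) [RHS]mulrC divfK.
apply: (limits_close l _ x y _ g1 _ g2 u v (maxn N M) L1 L2) => // [n|n].
  by split; [exact: (cauchy_smooth G u n uC)|exact: (cauchy_smooth G v n vC)].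
rewrite geq_max => /andP[Nn Mn]; apply: Hr; [exact: HM|exact: HN].
Qed.
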